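(* Let $V\in C^5(\mathbb R)$ be real-valued with $V(0)=V'(0)=0$, $V''(0)=1$, $V'''(0)=1$. Let $r_0,r_1$ be real functions on $\mathbb Z$ with $r_0\in\ell^2(\mathbb Z)$ and $|\nabla_1|^{-1}r_1\in \ell^2(\mathbb Z)$ satisfying $$\| r_0\|_{\ell^2(\mathbb Z)}+\||\nabla_1|^{-1}r_1\|_{\ell^2(\mathbb Z)}\le \frac{1}{20\max\big(1,\sup_{|R|\le 1}|V'''(R)|\big)} .$$ Then there exists a unique solution $r\in C(\mathbb R;\ell^2(\mathbb Z))$ to the FPU system $$\partial_t^2 r-\Delta_1 r=\Delta_1\big(V'(r)-r\big),\qquad (t,n)\in\mathbb R\times\mathbb Z,$$ with initial data $(r,\partial_t r)|_{t=0}=(r_0,r_1)$. Moreover, for any $t\in\mathbb R$, $$\|r(t)\|_{\ell^2(\mathbb Z)}+\||\nabla_1|^{-1}\partial_t r(t)\|_{\ell^2(\mathbb Z)}\le 2\|r_0\|_{\ell^2(\mathbb Z)}+2\||\nabla_1|^{-1}r_1\|_{\ell^2(\mathbb Z)} .$$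
   Context: $\Delta_1 f(n)=f(n+1)+f(n-1)-2f(n)$ is the discrete Laplacian on $\mathbb Z$. With the discrete Fourier transform $\mathcal F^1f(\xi)=\sum_{n\in\mathbb Z}f(n)e^{-i\xi n}$, $\xi\in[-\pi,\pi)$, $|\nabla_1|=\sqrt{-\Delta_1}$ is the Fourier multiplier with symbol $2|\sin(\xi/2)|$, and $|\nabla_1|^{-1}f\in\ell^2(\mathbb Z)$ means $\mathcal F^1 f(\xi)/(2|\sin(\xi/2)|)\in L^2([-\pi,\pi))$. Solutions are understood in the Duhamel sense: $$r(t)=\cos(t|\nabla_1|)r_0+\frac{\sin(t|\nabla_1|)}{|\nabla_1|}r_1-\int_0^t\sin((t-t')|\nabla_1|)\,|\nabla_1|\big(V'(r(t'))-r(t')\big)dt'.$$ Uniqueness means: for every $T>0$ there is only one solution in $C([-T,T];\ell^2(\mathbb Z))$. All functions are real-valued. *)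

(* Defs.v *)
From HB Require Import structures.
From mathcomp Require Import all_boot all_order all_algebra.
From mathcomp Require Import all_classical all_reals all_analysis.
From mathcomp Require Import complex.

Set Implicit Arguments.
Unset Strict Implicit.
Unset Printing Implicit Defensive.

Import Order.TTheory GRing.Theory Num.Theory.
Import numFieldNormedType.Exports.

Local Open Scope complex_scope.
Local Open Scope ring_scope.
Local Open Scope classical_set_scope.

Section Defs.
Variable R : realType.
Local Notation leb := (@lebesgue_measure R).
Implicit Types (f : int -> R) (g : R -> R[i]) (m : R -> R).

Definition C_k (k : nat) (V : R -> R) : Prop :=
  (forall j, (j < k)%N -> forall x, derivable (V^`(j)) x 1) /\
  continuous (V^`(k)).

Definition sql2norm f : \bar R := \esum_(n in [set: int]) ((f n) ^+ 2)%:E.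

Definition in_l2 f : Prop := (sql2norm f < +oo)%E.

(* Meaningful only under [in_l2 f], since [fine +oo = 0]. *)
Definition l2norm f : R := Num.sqrt (fine (sql2norm f)).

Definition torus : set R := `[- pi, pi[.

Definition sqL2norm g : \bar R :=
  (\int[leb]_(x in torus) ((Normc.normc (g x)) ^+ 2)%:E)%E.

Definition in_L2 g : Prop :=
  [/\ measurable_fun torus (fun x => complex.Re (g x)),
      measurable_fun torus (fun x => complex.Im (g x))
    & (sqL2norm g < +oo)%E].

Definition expi (x : R) : R[i] := cos x +i* sin x.

(* The sum of f(n) e^{-i x n} over -N <= n <= N. *)
Definition dft_partial f (N : nat) (x : R) : R[i] :=
  \sum_(k < N.*2.+1)
    (f (k%:Z - N%:Z))%:C * expi (- (x * (k%:Z - N%:Z)%:~R)).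

Definition is_dft f g : Prop :=
  in_L2 g /\
  (fun N : nat => sqL2norm (fun x => dft_partial f N x - g x)) @ \oo --> 0%E.

(* For f in l^2 the series sum_n f(n) e^{-i x n} converges in L^2([-pi, pi));
   its sum is determined almost everywhere and [dft f] is a representative.
   When f is not in l^2, no such g exists and [dft f] is the junk value 0. *)
Definition dft f : R -> R[i] := xget (fun=> 0) [set g | is_dft f g].

(* The multiplier with symbol m, that is F^{-1} (m * F f). All the symbols
   below are real and even, so the inversion integral of a real f is real and
   taking its real part loses nothing. *)
Definition multiplier m f (n : int) : R :=
  (2 * pi)^-1 *
  \int[leb]_(x in torus) complex.Re ((m x)%:C * dft f x * expi (x * n%:~R)).

Definition absgrad (x : R) : R := 2 * `|sin (x / 2)|.

(* As 0^-1 = 0, this symbol, like the one of sin (t |grad|) / |grad| below,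
   is 0 at x = 0: a null set, irrelevant to L^2. *)
Definition absgrad_inv (x : R) : R := (absgrad x)^-1.

(* |grad|^{-1} f belongs to l^2. The first conjunct excludes the junk value of
   [dft]; it is implied by the informal condition, since
   F f = absgrad * (F f / absgrad) is then in L^2. *)
Definition in_dom_absgrad_inv f : Prop :=
  in_l2 f /\ in_L2 (fun x => (absgrad_inv x)%:C * dft f x).

(* The oriented integral from 0 to t. *)
Definition int0 (t : R) (h : R -> R) : R :=
  if 0 <= t then \int[leb]_(s in `[0, t]) h s
  else - \int[leb]_(s in `[t, 0]) h s.

(* C(I; l^2(Z)); the values of r outside I are irrelevant. *)
Definition continuous_l2 (I : set R) (r : R -> int -> R) : Prop :=
  forall t, I t ->
    in_l2 (r t) /\ l2norm (r s \- r t) @[s --> within I (nbhs t)] --> (0 : R).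

(* Evaluation at n is a bounded linear functional on l^2, so the l^2-valued
   integral of the continuous integrand is computed coordinate by coordinate. *)
Definition duhamel (V : R -> R) (r0 r1 : int -> R) (I : set R)
    (r : R -> int -> R) : Prop :=
  forall t, I t -> forall n : int,
    r t n =
      multiplier (fun x => cos (t * absgrad x)) r0 n
      + multiplier (fun x => sin (t * absgrad x) / absgrad x) r1 n
      - int0 t (fun t' =>
          multiplier (fun x => sin ((t - t') * absgrad x) * absgrad x)
            (fun k => (V^`()%classic) (r t' k) - r t' k) n).

(* A solution on I of
     r_tt(n) - (Lap r)(n) = (Lap (V'(r) - r))(n),   (r, r_t)(0) = (r0, r1),
     (Lap f)(n) = f(n+1) + f(n-1) - 2 f(n) = - (|grad|^2 f)(n),
   in C(I; l^2), in the Duhamel sense. *)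
Definition fpu_solution (V : R -> R) (r0 r1 : int -> R) (I : set R)
    (r : R -> int -> R) : Prop :=
  continuous_l2 I r /\ duhamel V r0 r1 I r.

Definition time_derivative (r : R -> int -> R) (t : R) (n : int) : R :=
  ((fun s => r s n)^`()%classic) t.

End Defs.

(* Main.v *)
Require Import Defs.
From mathcomp Require Import all_boot all_order all_algebra.
From mathcomp Require Import all_classical all_reals all_analysis.
From mathcomp Require Import complex measurable_realfun.
From mathcomp Require Import ring lra zify.
Import Order.TTheory GRing.Theory Num.Theory.
Import numFieldNormedType.Exports.
Local Open Scope ring_scope.
Local Open Scope classical_set_scope.

Set Implicit Arguments.
Unset Strict Implicit.
Unset Printing Implicit Defensive.

(** Why the theorem holds. Write D for the forward difference on sequences. Its symbol
    exp (i x) - 1 has modulus 2 |sin (x / 2)|, the symbol of |grad|, so D and |grad|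
    differ by a phase. Hence r_t = D p for a momentum p with the l2 norm of
    |grad|^(-1) r_t ([momentum_exists], [difference_in_domain]), and the equation becomes
    the Hamiltonian system
        r_t(n) = p(n+1) - p(n),     p_t(n) = V'(r(n)) - V'(r(n-1)),
    whose energy, the sum over n of p(n)^2 / 2 + V(r(n)), is conserved. For small r the
    potential V(r) is comparable to r^2 / 2, and conservation of energy bounds (r, p) in
    l2 for all times.

    To obtain a global flow at once, V' is replaced by a globally Lipschitz force that
    agrees with it for |r| at most [cutoff] and whose potential lies between 2/5 r^2 and
    3/5 r^2 on the whole line. The truncated system is an ordinary differential equation
    in l2 with Lipschitz field. Interleaving p and r turns it into a nearest-neighbour
    chain x_m' = phi_(m+1)(x_(m+1)) - phi_(m-1)(x_(m-1)), solved by Picard iteration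
    ([chain_flow_exists]), whose energy is controlled by weighted sums over growing windows
    ([energy_bound]). The resulting bound |r| + |p| <= 2 (|r0| + |p0|) is exactly small
    enough to keep r below the cutoff, so the truncated solution solves the original
    system.

    The Duhamel formulation is reached through Fourier multipliers. The transform of a
    square-summable sequence exists by completeness of L2 ([L2_complete], [dft_exists]).
    Plancherel's and Bessel's inequalities bound a multiplier by the supremum of its symbol
    ([multiplier_bound]), and as the symbol of |grad| is bounded, the propagators are
    smooth in time in operator norm. Differentiating
    cos ((t - s) |grad|) r(s) + sin ((t - s) |grad|) / |grad| r_t(s) in s gives the Duhamel
    formula ([duhamel_formula]). Recovering p from |grad|^(-1) r_t requires
    |grad| |grad|^(-1) = 1 on Fourier coefficients; this follows by approximating
    |sin (x / 2)| uniformly by polynomials in cos x ([absgrad_determined]).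

    Uniqueness is a Gronwall argument on the Duhamel formula: solutions are bounded on
    compact time intervals, where the nonlinearity is Lipschitz ([fpu_unique]). *)

(** * Square-summable sequences *)

Section SquareSummable.
Variable R : realType.
Implicit Types (f g : int -> R) (s : seq int) (c : R).

(** The bound is stated over finite sums so that it passes to pointwise limits
    and can be tested coordinate by coordinate, without any convergent series. *)
Definition l2_le f c : Prop :=
  0 <= c /\ forall s, uniq s -> \sum_(n <- s) f n ^+ 2 <= c ^+ 2.

(** Induction on the list: adding the terms a and b to the three sums C <= sqrt (A * B)
    is harmless because 2 * C * a * b <= A * b^2 + a^2 * B. *)
Lemma cauchy_schwarz_sq s f g :
  (\sum_(n <- s) f n * g n) ^+ 2 <=
  (\sum_(n <- s) f n ^+ 2) * (\sum_(n <- s) g n ^+ 2).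
Proof.
elim: s => [|m s IH]; first by rewrite !big_nil expr0n mul0r.
rewrite !big_cons.
have A0 : 0 <= \sum_(n <- s) f n ^+ 2 by apply: sumr_ge0 => *; exact: sqr_ge0.
have B0 : 0 <= \sum_(n <- s) g n ^+ 2 by apply: sumr_ge0 => *; exact: sqr_ge0.
move: IH A0 B0; set C := \sum_(n <- s) _ * _; set A := \sum_(n <- s) f n ^+ 2.
set B := \sum_(n <- s) g n ^+ 2; move: (f m) (g m) => a b IH A0 B0.
suff : 2 * (C * (a * b)) <= A * b ^+ 2 + a ^+ 2 * B by move: IH; nra.
have E0 : 0 <= A * b ^+ 2 + a ^+ 2 * B by rewrite addr_ge0// mulr_ge0// sqr_ge0.
apply: le_trans (ler_norm _) _; rewrite -ler_sqr ?nnegrE// real_normK ?num_real//.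
have h1 : C ^+ 2 * (a * b) ^+ 2 <= A * B * (a * b) ^+ 2.
  by rewrite ler_wpM2r// sqr_ge0.
have := sqr_ge0 (A * b ^+ 2 - a ^+ 2 * B); move: h1; nra.
Qed.

Definition norm_on s f : R := Num.sqrt (\sum_(n <- s) f n ^+ 2).

Lemma norm_on_ge0 s f : 0 <= norm_on s f.
Proof. exact: sqrtr_ge0. Qed.

Lemma sqr_norm_on s f : norm_on s f ^+ 2 = \sum_(n <- s) f n ^+ 2.
Proof. by rewrite sqr_sqrtr// sumr_ge0// => *; exact: sqr_ge0. Qed.

Lemma cauchy_schwarz s f g : \sum_(n <- s) f n * g n <= norm_on s f * norm_on s g.
Proof.
apply: le_trans (ler_norm _) _.
rewrite -ler_sqr ?nnegrE ?mulr_ge0 ?norm_on_ge0// real_normK ?num_real//.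
by rewrite exprMn !sqr_norm_on cauchy_schwarz_sq.
Qed.

Lemma l2_le_norm_on f c s : l2_le f c -> uniq s -> norm_on s f <= c.
Proof. by move=> [c0 H] us; rewrite -ler_sqr ?nnegrE ?norm_on_ge0// sqr_norm_on H. Qed.

Lemma l2_le_ge0 f c : l2_le f c -> 0 <= c. Proof. by case. Qed.

(** Testing against finitely supported sequences turns norm bounds on sums,
    derivatives and integrals of sequences into scalar inequalities. *)
Lemma l2_le_dual f c : 0 <= c ->
  (forall s (a : int -> R), uniq s -> \sum_(n <- s) a n * f n <= norm_on s a * c) ->
  l2_le f c.
Proof.
move=> c0 H; split=> // s us; rewrite -sqr_norm_on ler_sqr ?nnegrE ?norm_on_ge0//.
have := H s f us; under eq_bigr do rewrite -expr2.
rewrite -sqr_norm_on; have [/eqP->|n0] := boolP (norm_on s f == 0); first by [].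
by rewrite expr2 ler_pM2l// lt_neqAle eq_sym n0 norm_on_ge0.
Qed.

Lemma l2_le_dualE f c s (a : int -> R) : l2_le f c -> uniq s ->
  \sum_(n <- s) a n * f n <= norm_on s a * c.
Proof.
move=> H us; apply: le_trans (cauchy_schwarz _ _ _) _.
by rewrite ler_wpM2l ?norm_on_ge0// l2_le_norm_on.
Qed.

Lemma l2_leW f c c' : l2_le f c -> c <= c' -> l2_le f c'.
Proof.
move=> [c0 H] cc; split; first exact: le_trans cc.
by move=> s us; apply: le_trans (H s us) _; rewrite ler_sqr ?nnegrE// (le_trans c0).
Qed.

Lemma l2_leD f g c d : l2_le f c -> l2_le g d -> l2_le (fun n => f n + g n) (c + d).
Proof.
move=> Hf Hg; apply: l2_le_dual; first by rewrite addr_ge0 ?(l2_le_ge0 Hf) ?(l2_le_ge0 Hg).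
move=> s a us; under eq_bigr do rewrite mulrDr.
by rewrite big_split mulrDr lerD// l2_le_dualE.
Qed.

Lemma l2_le_lip f g c L : l2_le g c -> 0 <= L -> (forall n, `|f n| <= L * `|g n|) ->
  l2_le f (L * c).
Proof.
move=> [c0 H] L0 fg; split; first by rewrite mulr_ge0.
move=> s us; rewrite exprMn; apply: le_trans (ler_wpM2l (sqr_ge0 L) (H s us)).
rewrite mulr_sumr; apply: ler_sum => n _.
by rewrite -(real_normK (num_real (f n))) -(real_normK (num_real (g n))) -exprMn
  ler_sqr ?nnegrE ?mulr_ge0.
Qed.

Lemma l2_leZ f c k : l2_le f c -> l2_le (fun n => k * f n) (`|k| * c).
Proof. by move=> H; apply: (l2_le_lip H) => // n; rewrite normrM. Qed.

Lemma l2_leN f c : l2_le f c -> l2_le (fun n => - f n) c.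
Proof.
by move=> H; rewrite -[c]mul1r; apply: (l2_le_lip H) => // n; rewrite normrN mul1r.
Qed.

Lemma l2_leB f g c d : l2_le f c -> l2_le g d -> l2_le (fun n => f n - g n) (c + d).
Proof. by move=> Hf Hg; apply: l2_leD => //; exact: l2_leN. Qed.

Lemma l2_le0 : l2_le (fun _ => 0) 0.
Proof. by split=> // s _; rewrite expr0n big1// => *; rewrite expr0n. Qed.

Lemma l2_le_comp f c (h : int -> int) : l2_le f c -> injective h -> l2_le (f \o h) c.
Proof.
move=> [c0 H] ih; split=> // s us.
by have := H (map h s); rewrite big_map map_inj_uniq//; exact.
Qed.

Lemma l2_le_coord f c n : l2_le f c -> `|f n| <= c.
Proof.
move=> [c0 H]; have := H [:: n] isT; rewrite big_seq1.
by rewrite -(real_normK (num_real (f n))) ler_sqr ?nnegrE.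
Qed.

(** Fatou's lemma for sequences: only finite sums are involved, and these are
    continuous in finitely many coordinates. *)
Lemma l2_le_lim (u : nat -> int -> R) f c :
  (forall k, l2_le (u k) c) -> (forall n, u k n @[k --> \oo] --> f n) -> l2_le f c.
Proof.
move=> H uf; split; first exact: (l2_le_ge0 (H 0%N)).
move=> s us.
have cv : (\sum_(n <- s) u k n ^+ 2) @[k --> \oo] --> \sum_(n <- s) f n ^+ 2.
  elim: s {us} => [|m s IH].
    by rewrite big_nil; under eq_fun do rewrite big_nil; exact: cvg_cst.
  rewrite big_cons; under eq_fun do rewrite big_cons.
  by apply: cvgD => //; rewrite expr2; under eq_fun do rewrite expr2; exact: cvgM.
have cl := cvg_lim _ cv; rewrite -cl//.
apply: limr_le; first by apply/cvg_ex; eexists; exact: cv.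
by apply: nearW => k; case: (H k) => _; exact.
Qed.

Lemma fsbig_uniq_sum f s : uniq s ->
  (\sum_(n \in [set` s]) ((f n) ^+ 2)%:E = (\sum_(n <- s) f n ^+ 2)%:E)%E.
Proof. move=> us; rewrite -fsbig_seq//. by rewrite sumEFin; apply: congr1. Qed.

Lemma l2_le_norm f : in_l2 f -> l2_le f (l2norm f).
Proof.
rewrite /in_l2 => fl; split; first exact: sqrtr_ge0.
have f0 : (0 <= sql2norm f)%E by apply: esum_ge0 => n _; rewrite lee_fin sqr_ge0.
move=> s us; rewrite /l2norm sqr_sqrtr ?fine_ge0//.
rewrite -lee_fin fineK ?ge0_fin_numE// -fsbig_uniq_sum//.
apply: ereal_sup_ubound; exists [set` s]; last by []. split; last by []. exact: finite_seq.
Qed.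

Lemma sql2norm_le f c : l2_le f c -> (sql2norm f <= (c ^+ 2)%:E)%E.
Proof.
move=> [c0 H]; apply: ge_ereal_sup => _ [A [fA _] <-].
have [s ->] := (finite_seqP A).1 fA.
have -> : [set` s] = [set` undup s] by apply/seteqP; split=> n /=; rewrite mem_undup.
by rewrite fsbig_uniq_sum ?undup_uniq// lee_fin H ?undup_uniq.
Qed.

Lemma l2_le_in f c : l2_le f c -> in_l2 f.
Proof. by move/sql2norm_le => H; apply: le_lt_trans H (ltry _). Qed.

Lemma l2_le_norm_le f c : l2_le f c -> l2norm f <= c.
Proof.
move=> H; have fl := l2_le_in H; have [c0 _] := H.
have f0 : (0 <= sql2norm f)%E by apply: esum_ge0 => n _; rewrite lee_fin sqr_ge0.
rewrite -ler_sqr ?nnegrE ?sqrtr_ge0// sqr_sqrtr ?fine_ge0//.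
rewrite -lee_fin fineK ?ge0_fin_numE//.
exact: sql2norm_le.
Qed.
End SquareSummable.

(** * One-variable calculus and a mean value inequality in l2 *)

Section Calculus.
Variable R : realType.
Local Notation leb := (@lebesgue_measure R).
Implicit Types (f g : R -> R) (s t : R).

(** Every derivative of an l2-valued curve below comes with a quadratic remainder,
    which survives limits, finite sums and bounded operators better than a mere limit. *)
Lemma is_derive_quadratic f s d C :
  (forall h : R, `|h| <= 1 -> `|f (s + h) - f s - h * d| <= C * h ^+ 2) ->
  is_derive s 1 f d.
Proof.
move=> H.
have C0 : 0 <= C.
  by have := H 1; rewrite normr1 lexx expr1n mulr1 => /(_ isT); apply: le_trans.
suff L : (fun h => h^-1 *: (f (h *: (1 : R) + s) - f s)) @ 0^' --> d.
  split; first by apply/cvg_ex; exists d; exact: L.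
  exact: (cvg_lim _ L).
apply/cvgrPdist_le => e e0; near=> h.
have h0 : h != 0 by near: h; exact: nbhs_dnbhs_neq.
have hs : `|h| <= Num.min 1 (e / (C + 1)).
  near: h; apply: dnbhs0_le; rewrite lt_min ltr01 divr_gt0//.
  by rewrite ltr_wpDl.
move: hs; rewrite le_min => /andP[h1 h2].
have {}H := H h h1.
rewrite distrC scaler1 addrC /GRing.scale/=.
have -> : - d + h^-1 * (f (h + s) - f s) = h^-1 * (f (s + h) - f s - h * d).
  by rewrite [h + s]addrC; field.
rewrite normrM normfV mulrC ler_pdivrMr ?normr_gt0//.
apply: le_trans H _; rewrite -(real_normK (num_real h)) expr2 mulrA ler_wpM2r//.
move: h2; rewrite ler_pdivlMr ?ltr_wpDl//; have := normr_ge0 h; nra.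
Unshelve. all: by end_near. Qed.

Lemma is_derive_continuous f s d : is_derive s 1 f d -> {for s, continuous f}.
Proof. by case=> H _; apply: differentiable_continuous; exact/derivable1_diffP. Qed.

Lemma le_of_derive_le0 f (df : R -> R) (a b : R) : a <= b ->
  (forall x : R, is_derive x 1 f (df x)) ->
  (forall x, a <= x <= b -> df x <= 0) -> f b <= f a.
Proof.
move=> ab fd d0.
have [|c] := @MVT_segment _ f df a b ab _ _.
  by apply: continuous_subspaceT => x; exact: is_derive_continuous.
rewrite in_itv/= => /d0 dc E; rewrite -subr_le0 E.
by rewrite mulr_le0_ge0// subr_ge0.
Qed.

Lemma is_derive_comp_opp f (t d : R) : is_derive (- t) 1 f d ->
  is_derive t 1 (fun s => f (- s)) (- d).
Proof.
move=> fd; have := @is_derive1_comp R f (fun s => - s) t d (-1) _ _.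
by rewrite mulrN1 => H; apply: H.
Qed.

Lemma is_derive_sum_lin (I : Type) (r : seq I) (c : I -> R) (y : R -> I -> R)
    (d : I -> R) t :
  (forall n, is_derive t 1 (fun s => y s n) (d n)) ->
  is_derive t 1 (fun s => \sum_(n <- r) c n * y s n) (\sum_(n <- r) c n * d n).
Proof.
move=> H; elim: r => [|m r IH].
  by under eq_fun do rewrite big_nil; rewrite big_nil; exact: is_derive_cst.
under eq_fun do rewrite big_cons; rewrite big_cons.
by apply: is_deriveD; exact: is_deriveZ.
Qed.

(** For fixed coefficients a, the scalar function sum a_n y_n - |a| B is
    nonincreasing; duality then gives the bound on y. *)
Lemma l2_le_mean_value_pos (y f : R -> int -> R) (B b : R -> R) t : 0 <= t ->
  (forall s n, is_derive s 1 (fun s => y s n) (f s n)) ->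
  (forall n, y 0 n = 0) ->
  (forall s, is_derive s 1 B (b s)) -> 0 <= B 0 ->
  (forall s, 0 <= s <= t -> l2_le (f s) (b s)) ->
  l2_le (y t) (B t).
Proof.
move=> t0 yd y0 Bd B0 fb; apply: l2_le_dual.
  have : (- B t) <= (- B 0).
    apply: (@le_of_derive_le0 (fun s => - B s) (fun s => - b s)) => //.
    by move=> s /fb/l2_le_ge0; rewrite oppr_le0.
  by rewrite lerN2; apply: le_trans.
move=> s a us.
(* The slack between the two sides of the dual inequality is nonincreasing. *)
pose psi r := \sum_(n <- s) a n * y r n - norm_on s a * B r.
have : psi t <= psi 0.
  apply: (@le_of_derive_le0 psi (fun r => \sum_(n <- s) a n * f r n - norm_on s a * b r)).
  - exact: t0.
  - move=> r; apply: is_deriveB; first exact: is_derive_sum_lin.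
  - by move=> r rt; rewrite subr_le0; apply: l2_le_dualE us; exact: fb.
rewrite /psi [X in _ <= X - _ -> _]big1; last by move=> n _; rewrite y0 mulr0.
have := mulr_ge0 (norm_on_ge0 s a) B0; lra.
Qed.

(** Both time directions at once; this replaces the norm inequality for
    l2-valued integrals. *)
Lemma l2_le_mean_value (y f : R -> int -> R) (B b : R -> R) t :
  (forall s n, is_derive s 1 (fun s => y s n) (f s n)) ->
  (forall n, y 0 n = 0) ->
  (forall s, is_derive s 1 B (b s)) -> 0 <= B 0 ->
  (forall s, `|s| <= `|t| -> l2_le (f s) (b `|s|)) ->
  l2_le (y t) (B `|t|).
Proof.
move=> yd y0 Bd B0 fb; have [t0|t0] := leP 0 t.
  rewrite ger0_norm//; apply: (@l2_le_mean_value_pos y f B b) => // s /andP[s0 st].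
  by have := fb s; rewrite !ger0_norm//; exact.
rewrite ltr0_norm//; rewrite -[in y t](opprK t).
apply: (@l2_le_mean_value_pos (fun s n => y (- s) n) (fun s n => - f (- s) n) B b) => //.
- by rewrite oppr_ge0 ltW.
- by move=> s n; apply: is_derive_comp_opp.
- by move=> n; rewrite oppr0.
- move=> s /andP[s0 st]; apply: l2_leN; have := fb (- s).
  by rewrite normrN (ltr0_norm t0) (ger0_norm s0); exact.
Qed.

Lemma int0E (h : R -> R) a t : continuous h -> a <= 0 -> a <= t ->
  int0 t h = \int[leb]_(x in `[a, t]) h x - \int[leb]_(x in `[a, 0]) h x.
Proof.
move=> ch a0 at_; have ih u v : leb.-integrable `[u, v] (EFin \o h).
  apply: continuous_compact_integrable; first exact: segment_compact.
  exact: continuous_subspaceT.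
have iho u v : leb.-integrable `]u, v] (EFin \o h).
  by apply: integrableS (ih u v) => //; exact: subset_itv_oc_cc.
rewrite /int0; case: ifPn => [t0|]; last rewrite -ltNge => t0.
  by rewrite Rintegral_itvB ?bnd_simp// Rintegral_itv_obnd_cbnd.
by rewrite -[RHS]opprB Rintegral_itvB ?bnd_simp ?(ltW t0)// Rintegral_itv_obnd_cbnd.
Qed.

(** The primitive has to be differentiated at 0 and at negative times too, so it is
    compared with an integral whose lower end lies to the left of t. *)
Lemma is_derive_int0 (h : R -> R) t : continuous h ->
  is_derive t 1 (fun s => int0 s h) (h t).
Proof.
move=> ch.
(* Any lower end left of both 0 and t will do. *)
pose a := - (`|t| + 1).
have a0 : a < 0 by rewrite /a oppr_lt0 ltr_wpDl.
have at_ : a < t.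
  by rewrite /a ltrNl (le_lt_trans (ler_norm _))// normrN ltrDl.
have tu : t < t + 1 by rewrite ltrDl.
have ih : leb.-integrable `[a, t + 1] (EFin \o h).
  apply: continuous_compact_integrable; first exact: segment_compact.
  exact: continuous_subspaceT.
have [D1 D2] := continuous_FTC1_closed tu ih at_ (ch t).
have : is_derive t 1 (fun x => \int[leb]_(s in `[a, x]) h s) (h t).
  by split; [exact: D1|rewrite -derive1E; exact: D2].
move=> D; have {}D := is_deriveB D (is_derive_cst (\int[leb]_(x in `[a, 0]) h x) t 1).
rewrite subr0 in D.
apply: near_eq_is_derive D => //.
near=> x; rewrite /= (@int0E h a x) ?(ltW a0)//.
by near: x; exact: lt_le_nbhsr.
Unshelve. all: by end_near. Qed.

(** A function and the primitive of its derivative differ by a constant. *)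
Lemma int0_unique f (h : R -> R) t : continuous h ->
  (forall s, is_derive s 1 f (h s)) -> f t - f 0 = int0 t h.
Proof.
move=> ch fd.
have d0 s : is_derive s 1 (fun s => f s - int0 s h) 0.
  by rewrite -(subrr (h s)); apply: is_deriveB => //; exact: is_derive_int0.
have E := is_derive_0_is_cst t 0 d0.
have i0 : int0 (0 : R) h = 0.
  by rewrite (@int0E h 0)// subrr.
by move: E; rewrite i0 subr0 => <-; rewrite opprB addrC subrK.
Qed.

End Calculus.

(** * First-order nearest-neighbour chains *)

Section Chain.
Variable R : realType.
Variables (phi : int -> R -> R) (L : R).
Hypothesis L0 : 0 <= L.
Hypothesis phi_lip : forall m a b, `|phi m a - phi m b| <= L * `|a - b|.
Hypothesis phi0 : forall m, phi m 0 = 0.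
Implicit Types (x y : int -> R) (t s : R) (m : int) (k : nat).

(** The Fermi-Pasta-Ulam system in first-order form is such a chain, with the momenta
    at the even sites and the relative displacements at the odd sites. *)
Definition chain_field x m : R :=
  phi (m + 1) (x (m + 1)) - phi (m - 1) (x (m - 1)).
Local Notation F := chain_field.

Lemma addz_inj (d : int) : injective (fun m : int => m + d).
Proof. exact: addIr. Qed.

(** The field is the difference of two shifts of a sitewise Lipschitz map. *)
Lemma chain_field_lip x y d : l2_le (fun m => x m - y m) d ->
  l2_le (fun m => F x m - F y m) (2 * L * d).
Proof.
move=> H; have -> : 2 * L * d = L * d + L * d by ring.
have G : l2_le (fun m => phi m (x m) - phi m (y m)) (L * d).
  by apply: (l2_le_lip H).
have -> : (fun m => F x m - F y m) =
    (fun m => (phi (m + 1) (x (m + 1)) - phi (m + 1) (y (m + 1))) -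
              (phi (m - 1) (x (m - 1)) - phi (m - 1) (y (m - 1)))).
  by apply/funext => m; rewrite /F; ring.
apply: l2_leB.
  exact: (l2_le_comp G (@addz_inj 1)).
exact: (l2_le_comp G (@addz_inj (-1))).
Qed.

Lemma chain_field_bound x d : l2_le x d -> l2_le (F x) (2 * L * d).
Proof.
move=> H; have := @chain_field_lip x (fun=> 0) d.
have -> : (fun m => x m - 0) = x by apply/funext => m; rewrite subr0.
have -> : (fun m => F x m - F (fun=> 0) m) = F x.
  by apply/funext => m; rewrite /F !phi0 subrr subr0.
exact.
Qed.

Lemma phi_continuous m : continuous (phi m).
Proof.
move=> a; apply/cvgrPdist_le => e e0; near=> b.
apply: le_trans (phi_lip _ _ _) _.
have : `|a - b| <= e / (L + 1).
  by near: b; apply: cvgr_dist_le; [exact: cvg_id|rewrite divr_gt0// ltr_wpDl].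
rewrite ler_pdivlMr ?ltr_wpDl//; have := normr_ge0 (a - b); nra.
Unshelve. all: by end_near. Qed.

Variables (x0 : int -> R) (c : R).
Hypothesis x0c : l2_le x0 c.

Fixpoint picard k t m : R :=
  if k is k'.+1 then x0 m + int0 t (fun s => F (picard k' s) m) else x0 m.
Local Notation X := picard.

Lemma picard_field_continuous k m :
  (forall m, continuous (fun t => X k t m)) -> continuous (fun t => F (X k t) m).
Proof.
move=> H t; apply: cvgB.
  by apply: (continuous_comp (H _ t)); exact: phi_continuous.
by apply: (continuous_comp (H _ t)); exact: phi_continuous.
Qed.

Lemma picard_continuous k m : continuous (fun t => X k t m).
Proof.
elim: k m => [|k IH] m t /=; first exact: cvg_cst.
apply: cvgD; first exact: cvg_cst.
apply: is_derive_continuous; apply: is_derive_int0.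
exact: picard_field_continuous.
Qed.

Lemma is_derive_picard k t m :
  is_derive t 1 (fun t => X k.+1 t m) (F (X k t) m).
Proof.
rewrite /= -[F _ _]add0r; apply: is_deriveD.
by apply: is_derive_int0; apply: picard_field_continuous; exact: picard_continuous.
Qed.

Lemma int0_0 (h : R -> R) : continuous h -> int0 0 h = 0.
Proof. by move=> ch; rewrite (@int0E R h 0)// subrr. Qed.

Lemma picard0 k m : X k 0 m = x0 m.
Proof.
case: k => //= k; rewrite int0_0 ?addr0//.
by apply: picard_field_continuous; exact: picard_continuous.
Qed.

Let lam := 4 * L.
Let lam0 : 0 <= lam. Proof. by rewrite mulr_ge0. Qed.
Let c0 : 0 <= c := l2_le_ge0 x0c.

Lemma is_derive_expR_scale (a b t : R) :
  is_derive t 1 (fun s => a * expR (b * s)) (a * b * expR (b * t)).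
Proof.
have E : is_derive t 1 (fun s : R => expR (b * s)) (expR (b * t) * b).
  apply: (@is_derive1_comp R expR (fun s => b * s) t).
  have := is_deriveZ b (is_derive_id t 1); rewrite scaler1; exact.
by have := is_deriveZ a E; rewrite /GRing.scale/= [_ * b]mulrC mulrA; exact.
Qed.

Lemma expR_lam_ge1 t : 1 <= expR (lam * `|t|).
Proof. by rewrite -expR0 ler_expR mulr_ge0. Qed.

(** In the weighted norm with weight exp (- 4 L |t|) the Picard map contracts by one half,
    so the iterates converge for all times at once. *)
Lemma picard_step k t : l2_le (fun m => X k.+1 t m - X k t m)
  (c * 2^-1 ^+ k.+1 * expR (lam * `|t|)).
Proof.
elim: k t => [|k IH] t.
  apply: (@l2_le_mean_value R (fun s m => X 1 s m - X 0 s m) (fun s m => F x0 m)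
    (fun s => c * 2^-1 ^+ 1 * expR (lam * s))
    (fun s => c * 2^-1 ^+ 1 * lam * expR (lam * s))).
  - move=> s m; rewrite -[F _ _]subr0; apply: is_deriveB.
      exact: is_derive_picard.
    exact: is_derive_cst.
  - by move=> m; rewrite !picard0 subrr.
  - by move=> s; exact: is_derive_expR_scale.
  - by rewrite mulr_ge0 ?expR_ge0// mulr_ge0.
  - move=> s _; apply: l2_leW (chain_field_bound x0c) _.
    have := expR_lam_ge1 s; move: (expR _) => E E1.
    have : 0 <= L * c by rewrite mulr_ge0.
    rewrite expr1 /lam; nra.
apply: (@l2_le_mean_value R (fun s m => X k.+2 s m - X k.+1 s m)
  (fun s m => F (X k.+1 s) m - F (X k s) m)
  (fun s => c * 2^-1 ^+ k.+2 * expR (lam * s))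
  (fun s => c * 2^-1 ^+ k.+2 * lam * expR (lam * s))).
- by move=> s m; apply: is_deriveB; exact: is_derive_picard.
- by move=> m; rewrite !picard0 subrr.
- by move=> s; exact: is_derive_expR_scale.
- by rewrite mulr_ge0 ?expR_ge0// mulr_ge0.
- move=> s _; apply: l2_leW (chain_field_lip (IH s)) _.
  by rewrite [2^-1 ^+ k.+2]exprS /lam le_eqVlt; apply/orP; left; apply/eqP; field.
Qed.

Lemma picard_dist k j t : l2_le (fun m => X (j + k)%N t m - X k t m)
  (c * (2^-1 ^+ k - 2^-1 ^+ (j + k)) * expR (lam * `|t|)).
Proof.
elim: j => [|j IH].
  rewrite add0n subrr mulr0 mul0r.
  have -> : (fun m => X k t m - X k t m) = (fun=> 0).
    by apply/funext => m; rewrite subrr.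
  exact: l2_le0.
have -> : (fun m => X (j.+1 + k) t m - X k t m) =
  (fun m => (X (j + k).+1 t m - X (j + k) t m) + (X (j + k) t m - X k t m)).
  by apply/funext => m; rewrite addSn; ring.
apply: l2_leW (l2_leD (picard_step (j + k) t) IH) _.
by rewrite addSn exprS; lra.
Qed.

Lemma cvg_geometric_cauchy (u : nat -> R) C :
  (forall k j, `|u (j + k)%N - u k| <= C * 2^-1 ^+ k) -> cvgn u.
Proof.
move=> H; have C0 : 0 <= C.
  by have := le_trans (normr_ge0 _) (H 0%N 0%N); rewrite expr0 mulr1.
apply/cauchy_cvgP; apply: cauchy_exP => e e0.
have g0 : C * 2^-1 ^+ k @[k --> \oo] --> 0.
  rewrite -[0](mulr0 C); apply: cvgM; first exact: cvg_cst.
  apply: cvg_expr.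
  by rewrite ger0_norm// invf_lt1// ltr1n.
have [N _ HN] : \forall k \near \oo, C * 2^-1 ^+ k < e.
  exact: (cvgr_lt 0 g0).
exists (u N); exists N => //= n Nn.
have {}HN := HN N (leqnn N).
rewrite /ball/= distrC; apply: le_lt_trans HN.
by have := H N (n - N)%N; rewrite subnK.
Qed.

Lemma picard_cvg t m : cvgn (fun k => X k t m).
Proof.
apply: (@cvg_geometric_cauchy _ (c * expR (lam * `|t|))) => k j.
apply: le_trans (l2_le_coord m (picard_dist k j t)) _.
rewrite mulrAC ler_wpM2l ?mulr_ge0 ?expR_ge0//.
by rewrite lerBlDr lerDl exprn_ge0.
Qed.

Definition flow t m : R := limn (fun k => X k t m).

Lemma flow_cvg t m : X k t m @[k --> \oo] --> flow t m.
Proof. exact: picard_cvg. Qed.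

Lemma flow_0 : flow 0 = x0.
Proof.
apply/funext => m; rewrite /flow; under eq_fun do rewrite picard0.
exact: lim_cst.
Qed.

Lemma picard_bound k t : l2_le (X k t) (2 * c * expR (lam * `|t|)).
Proof.
have -> : X k t = (fun m => x0 m + (X (k + 0)%N t m - X 0 t m)).
  by apply/funext => m; rewrite addn0 /= addrC subrK.
apply: l2_leW (l2_leD x0c (picard_dist 0 k t)) _.
have := expR_lam_ge1 t; move: (expR _) => E E1.
have : 0 <= 2^-1 ^+ (k + 0) :> R by rewrite exprn_ge0.
move: (2^-1 ^+ _) => z z0; rewrite expr0.
have : 0 <= c * E by rewrite mulr_ge0// (le_trans ler01).
have : 0 <= c * (E - 1) by rewrite mulr_ge0// subr_ge0.
nra.
Qed.

Lemma flow_bound t : l2_le (flow t) (2 * c * expR (lam * `|t|)).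
Proof. by apply: (@l2_le_lim _ (fun k => X k t)) => *; [exact: picard_bound|exact: flow_cvg]. Qed.

Let D T := 2 * L * (2 * c * expR (lam * (T + 1))).

Lemma field_picard_bound k t (T : R) : `|t| <= T + 1 -> l2_le (F (X k t)) (D T).
Proof.
move=> tT; apply: chain_field_bound; apply: l2_leW (picard_bound k t) _.
by rewrite ler_wpM2l ?mulr_ge0// ler_expR ler_wpM2l.
Qed.

Lemma is_derive_mulrl (a t : R) : is_derive t 1 (fun s => s * a) a.
Proof.
apply: (@is_derive_quadratic _ _ _ _ 0) => h _.
have -> : (t + h) * a - t * a - h * a = 0 by ring.
by rewrite normr0 mul0r.
Qed.

Lemma is_derive_shift_arg (f : R -> R) t s d : is_derive (t + s) 1 f d ->
  is_derive s 1 (fun s => f (t + s)) d.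
Proof.
move=> fd; have := @is_derive1_comp R f (fun s => t + s) s d 1 _ _.
rewrite mulr1 => H; apply: H.
apply: (@is_derive_quadratic _ _ _ _ 0) => h _.
have -> : t + (s + h) - (t + s) - h * 1 = 0 by ring.
by rewrite normr0 mul0r.
Qed.

(** A Lipschitz bound in time that does not depend on the number of iterations. *)
Lemma picard_lip k t h (T : R) : `|t| <= T -> `|h| <= 1 ->
  l2_le (fun m => X k (t + h) m - X k t m) (D T * `|h|).
Proof.
move=> tT h1; case: k => [|k].
  have -> : (fun m => X 0 (t + h) m - X 0 t m) = (fun=> 0).
    by apply/funext => m; rewrite subrr.
  apply: (l2_leW (@l2_le0 R)); rewrite mulr_ge0//.
  apply: l2_le_ge0 (@field_picard_bound 0 t T _).
  by rewrite (le_trans tT)// lerDl.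
apply: (@l2_le_mean_value R (fun s m => X k.+1 (t + s) m - X k.+1 t m)
  (fun s m => F (X k (t + s)) m) (fun s => D T * s) (fun=> D T)).
- move=> s m; rewrite -[F _ _]subr0; apply: is_deriveB.
  by apply: (@is_derive_shift_arg (fun r => X k.+1 r m)); exact: is_derive_picard.
- by move=> m; rewrite addr0 subrr.
- by move=> s; have := is_deriveZ (D T) (is_derive_id s 1); rewrite scaler1; exact.
- by rewrite mulr0.
- move=> s sh; apply: field_picard_bound.
  by rewrite (le_trans (ler_normD _ _))// lerD// (le_trans sh).
Qed.

(** A second-order bound that does not depend on k: letting k grow differentiates
    the limit directly, without passing to the limit under an integral. *)
Lemma picard_remainder k t h (T : R) : `|t| <= T -> `|h| <= 1 ->
  l2_le (fun m => X k.+1 (t + h) m - X k.+1 t m - h * F (X k t) m)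
    (2 * L * D T * h ^+ 2).
Proof.
move=> tT h1; rewrite -(real_normK (num_real h)) expr2 mulrA.
apply: (@l2_le_mean_value R
  (fun s m => X k.+1 (t + s) m - X k.+1 t m - s * F (X k t) m)
  (fun s m => F (X k (t + s)) m - F (X k t) m)
  (fun s => 2 * L * D T * `|h| * s) (fun=> 2 * L * D T * `|h|)).
- move=> s m; apply: is_deriveB; last first.
    exact: is_derive_mulrl.
  rewrite -[F _ _]subr0; apply: is_deriveB.
  by apply: (@is_derive_shift_arg (fun r => X k.+1 r m)); exact: is_derive_picard.
- by move=> m; rewrite addr0 subrr mul0r subrr.
- move=> s; have := is_deriveZ (2 * L * D T * `|h|) (is_derive_id s 1).
  by rewrite scaler1; exact.
- by rewrite mulr0.
- move=> s sh; rewrite -mulrA; apply: chain_field_lip.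
  apply: l2_leW (picard_lip k tT _) _; first exact: le_trans h1.
  rewrite ler_wpM2l//; apply: l2_le_ge0 (@field_picard_bound 0 t T _).
  by rewrite (le_trans tT)// lerDl.
Qed.

Lemma flow_remainder t h (T : R) : `|t| <= T -> `|h| <= 1 ->
  l2_le (fun m => flow (t + h) m - flow t m - h * F (flow t) m)
    (2 * L * D T * h ^+ 2).
Proof.
move=> tT h1.
apply: (@l2_le_lim _
  (fun k m => X k.+1 (t + h) m - X k.+1 t m - h * F (X k t) m)) => [k|m].
  exact: picard_remainder.
have S r : X k.+1 r m @[k --> \oo] --> flow r m.
  by rewrite (cvg_shiftS (fun k => X k r m)); exact: flow_cvg.
apply: cvgB; first exact: cvgB.
apply: cvgM; first exact: cvg_cst.
apply: cvgB.
  by apply: continuous_cvg; [exact: phi_continuous|exact: flow_cvg].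
by apply: continuous_cvg; [exact: phi_continuous|exact: flow_cvg].
Qed.

End Chain.

(** Global flow of a Lipschitz chain in l2, of class C^{1,1} in time. *)
Lemma chain_flow_exists (R : realType) (phi : int -> R -> R) (L : R) x0 c :
  0 <= L -> (forall m a b, `|phi m a - phi m b| <= L * `|a - b|) ->
  (forall m, phi m 0 = 0) -> l2_le x0 c ->
  exists X : R -> int -> R, [/\ X 0 = x0,
    forall T, exists B, forall t, `|t| <= T -> l2_le (X t) B &
    forall T, exists C, forall t h, `|t| <= T -> `|h| <= 1 ->
      l2_le (fun m => X (t + h) m - X t m - h * chain_field phi (X t) m)
        (C * h ^+ 2)].
Proof.
move=> L0 lip p0 xc; exists (flow phi x0); split.
- exact: flow_0 L0 lip x0.
- move=> T; exists (2 * c * expR (4 * L * T)) => t tT.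
  apply: l2_leW (flow_bound L0 lip p0 xc t) _.
  by rewrite ler_wpM2l ?mulr_ge0 ?(l2_le_ge0 xc)// ler_expR ler_wpM2l ?mulr_ge0.
- move=> T; eexists => t h tT h1; exact: (flow_remainder L0 lip p0 xc tT h1).
Qed.

(** * Conservation of energy along a chain *)

Section Energy.
Variable R : realType.

Lemma increment_le (f df : R -> R) (t D : R) :
  (forall x : R, is_derive x 1 f (df x)) ->
  (forall x, `|x| <= `|t| -> `|df x| <= D) -> f t - f 0 <= D * `|t|.
Proof.
move=> fd fD; have [t0|t0] := leP 0 t.
  have := @le_of_derive_le0 R (fun s => f s - s * D) (fun s => df s - D) 0 t t0.
  rewrite ger0_norm// mul0r => H; suff : f t - t * D <= f 0 - 0 by lra.
  apply: H => [x|x /andP[x0 xt]].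
    by apply: is_deriveB; first [exact: fd|exact: is_derive_mulrl].
  by rewrite subr_le0 (le_trans (ler_norm _))// fD// !ger0_norm// (le_trans x0).
have := @le_of_derive_le0 R (fun s => f (- s) - s * D) (fun s => - df (- s) - D) 0 (- t).
rewrite ltr0_norm// mul0r oppr0 opprK => H.
suff : f t - (- t) * D <= f 0 - 0 by lra.
rewrite subr0 -[f 0]addr0; apply: H => [|x|x /andP[x0 xt]]; first by rewrite oppr_ge0 ltW.
  by apply: is_deriveB; [exact: is_derive_comp_opp|exact: is_derive_mulrl].
rewrite subr_le0 (le_trans (ler_norm _))// normrN fD// normrN.
by rewrite (ger0_norm x0) (ltr0_norm t0).
Qed.

(** The energy flux through a weighted window is the flux through each bond times the
    variation of the weight. *)
Lemma sum_by_parts (w a : nat -> R) n :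
  \sum_(k < n) w k * (a k.+1 - a k) =
  \sum_(k < n) (w k - w k.+1) * a k.+1 + w n * a n - w 0%N * a 0%N.
Proof.
elim: n => [|n IH]; first by rewrite !big_ord0 add0r subrr.
by rewrite !big_ord_recr/= IH; ring.
Qed.

Definition sym_range (K : nat) : seq int :=
  [seq k%:Z - K%:Z | k <- iota 0 K.*2.+1].

Lemma sym_range_uniq K : uniq (sym_range K).
Proof. by rewrite map_inj_uniq ?iota_uniq// => a b /addIr []. Qed.

Lemma mem_sym_range K m : (m \in sym_range K) = (`|m| <= K)%N.
Proof.
apply/mapP/idP => [[k]|mK].
  rewrite mem_iota add0n => /andP[_ kK] ->; lia.
exists (absz (m + K%:Z)); first by rewrite mem_iota; lia.
lia.
Qed.

Lemma sum_sym_range (V : nmodType) K (f : int -> V) :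
  \sum_(m <- sym_range K) f m = \sum_(k < K.*2.+1) f (k%:Z - K%:Z).
Proof. rewrite big_map -(big_mkord xpredT (fun k : nat => f (k%:Z - K%:Z))).
by rewrite /index_iota subn0. Qed.

Lemma ler_sum_subseq (r s : seq int) (f : int -> R) : uniq r -> uniq s ->
  {subset s <= r} -> (forall m, 0 <= f m) ->
  \sum_(m <- s) f m <= \sum_(m <- r) f m.
Proof.
move=> ur us sr f0; rewrite [leRHS](bigID (mem s))/=.
rewrite -[X in _ <= X + _]big_filter.
rewrite [X in _ <= X + _](perm_big s); last first.
  apply: uniq_perm; rewrite ?filter_uniq// => m.
  by rewrite mem_filter; case: (boolP (m \in s)) => // /sr ->.
by rewrite lerDl sumr_ge0.
Qed.

(** A tent of height 1 and slope 1 / K: it vanishes at the ends of the window, and its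
    slope tends to 0 as K grows. *)
Definition hat_weight (K : nat) (m : int) : R :=
  Num.max 0 (1 - `|m|%N%:R / K%:R).

Lemma hat_weight_ge0 K m : 0 <= hat_weight K m.
Proof. by rewrite /hat_weight le_max lexx. Qed.

Lemma hat_weight_le1 K m : hat_weight K m <= 1.
Proof. by rewrite /hat_weight ge_max ler01 gerBl divr_ge0. Qed.

Lemma hat_weight_out K m : (0 < K)%N -> (K <= `|m|)%N -> hat_weight K m = 0.
Proof.
move=> K0 Km; apply/max_idPl; rewrite subr_le0 ler_pdivlMr ?ltr0n// mul1r ler_nat//.
Qed.

Lemma hat_weight_lip K m : (0 < K)%N ->
  `|hat_weight K m - hat_weight K (m + 1)| <= K%:R^-1.
Proof.
move=> K0; have maxl (a b : R) : `|Num.max 0 a - Num.max 0 b| <= `|a - b|.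
  have h1 := ler_norm (a - b); have h2 := ler_norm (b - a); rewrite distrC in h2.
  rewrite ler_norml; case: (leP 0 a) => ?; case: (leP 0 b) => ?;
    by apply/andP; split; lra.
apply: le_trans (maxl _ _) _.
have -> : (1 - `|m|%N%:R / K%:R) - (1 - (absz (m + 1))%:R / K%:R) =
    ((absz (m + 1))%:R - `|m|%N%:R) / K%:R :> R by ring.
rewrite normrM normfV [X in _ / X]ger0_norm//.
rewrite -[leRHS]mul1r ler_wpM2r ?invr_ge0//.
have : `|m|%N%:R <= (absz (m + 1)).+1%:R :> R by rewrite ler_nat; lia.
have : (absz (m + 1))%:R <= `|m|%N.+1%:R :> R by rewrite ler_nat; lia.
by rewrite -!natr1 => ? ?; rewrite ler_norml; apply/andP; split; lra.
Qed.

Lemma archimedean_le (A B M : R) :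
  (exists N, forall K : nat, (N < K)%N -> K%:R * (A - B) <= M) -> A <= B.
Proof.
move=> [N H]; rewrite leNgt -subr_gt0; apply/negP => d0.
pose K := maxn N.+1 (Num.Def.archi_bound `|M / (A - B)|).
have := H K; rewrite leq_max ltnSn => /(_ isT); apply/negP; rewrite -ltNge.
rewrite -ltr_pdivrMr//; apply: le_lt_trans (ler_norm _) _.
apply: lt_le_trans (archi_boundP (normr_ge0 _)) _.
by rewrite ler_nat leq_max leqnn orbT.
Qed.

Variables (phi Phi : int -> R -> R) (L al be : R).
Hypothesis L0 : 0 <= L.
Hypothesis phi_lip : forall m a b, `|phi m a - phi m b| <= L * `|a - b|.
Hypothesis phi0 : forall m, phi m 0 = 0.
Hypothesis dPhi : forall m (a : R), is_derive a 1 (Phi m) (phi m a).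
Hypothesis al0 : 0 <= al.
Hypothesis Phi_ge : forall m a, al * a ^+ 2 <= Phi m a.
Hypothesis Phi_le : forall m a, Phi m a <= be * a ^+ 2.
Variable X : R -> int -> R.
Hypothesis dX : forall (t : R) m, is_derive t 1 (fun s : R => X s m)
   (chain_field phi (X t) m).

(** The rate of change of the weighted energy is a sum over bonds of a current
    phi_m * phi_(m+1), summable by Cauchy-Schwarz, times a slope of size 1 / K. *)
Lemma weighted_flux_le K (x : int -> R) B : (0 < K)%N -> l2_le x B ->
  `|\sum_(m <- sym_range K) hat_weight K m * (phi m (x m) * chain_field phi x m)|
  <= (L * B) ^+ 2 / K%:R.
Proof.
move=> K0 xB; rewrite sum_sym_range.
have pB : l2_le (fun m => phi m (x m)) (L * B).
  by apply: (l2_le_lip xB) => // m; have := phi_lip m (x m) 0; rewrite phi0 !subr0.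
pose j m := phi (m - 1) (x (m - 1)) * phi m (x m).
pose a (k : nat) := j (k%:Z - K%:Z).
pose w (k : nat) := hat_weight K (k%:Z - K%:Z).
have shift (k : nat) : k.+1%:Z - K%:Z = k%:Z - K%:Z + 1 by lia.
under eq_bigr => k _.
  have -> : phi (k%:Z - K%:Z) (x (k%:Z - K%:Z)) * chain_field phi x (k%:Z - K%:Z) =
      a k.+1 - a k.
    by rewrite /a /j shift addrK /chain_field; ring.
  over.
rewrite (sum_by_parts w a) [w K.*2.+1]hat_weight_out//; last lia.
rewrite [w 0%N]hat_weight_out//; last lia.
rewrite !mul0r addr0 subr0.
apply: le_trans (ler_norm_sum _ _ _) _.
apply: (@le_trans _ _ (\sum_(k < K.*2.+1) K%:R^-1 * `|a k.+1|)).
  apply: ler_sum => k _; rewrite normrM ler_wpM2r// /w shift.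
  exact: hat_weight_lip.
rewrite -mulr_sumr mulrC ler_wpM2r ?invr_ge0//.
under eq_bigr => k _ do rewrite /a /j shift addrK normrM.
rewrite -(sum_sym_range K (fun m => `|phi m (x m)| * `|phi (m + 1) (x (m + 1))|)).
apply: le_trans (cauchy_schwarz _ _ _) _; rewrite expr2.
have nB y : l2_le y (L * B) -> norm_on (sym_range K) (fun m => `|y m|) <= L * B.
  move=> yB; apply: l2_le_norm_on (sym_range_uniq K).
  rewrite -[L * B]mul1r; apply: (l2_le_lip yB) => // m.
  by rewrite normr_id mul1r.
apply: ler_pM; rewrite ?norm_on_ge0//; first exact: nB.
exact: (nB _ (l2_le_comp pB (@addz_inj 1))).
Qed.

(** The total energy is conserved, because the weighted energies are conserved up to
    O (1 / K). Comparing the potentials with squares bounds the l2 norm for all times. *)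
Lemma energy_bound B c t : l2_le (X 0) c ->
  (forall s, `|s| <= `|t| -> l2_le (X s) B) ->
  forall s, uniq s -> al * \sum_(m <- s) X t m ^+ 2 <= be * c ^+ 2.
Proof.
move=> Xc XB s us.
have be0 : 0 <= be.
  by have := le_trans (Phi_ge 0 1) (Phi_le 0 1); rewrite expr1n !mulr1; apply: le_trans.
have Phi0 m a : 0 <= Phi m a by apply: le_trans (Phi_ge m a); rewrite mulr_ge0 ?sqr_ge0.
(* M bounds the sites of s, so the weight there is at least 1 - M / K. *)
pose A := al * \sum_(m <- s) X t m ^+ 2.
pose M := \max_(m <- s) `|m|%N.
apply: (@archimedean_le _ _ (M%:R * A + (L * B) ^+ 2 * `|t|)); exists M => K MK.
have K0 : (0 < K)%N by apply: leq_ltn_trans MK.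
have KR : 0 < K%:R :> R by rewrite ltr0n.
pose E (r : R) := \sum_(m <- sym_range K) hat_weight K m * Phi m (X r m).
have dE (r : R) : is_derive r 1 E
    (\sum_(m <- sym_range K) hat_weight K m * (phi m (X r m) * chain_field phi (X r) m)).
  exact: is_derive_sum_lin.
have Et : E t - E 0 <= (L * B) ^+ 2 / K%:R * `|t|.
  apply: increment_le dE _ => r rt; apply: weighted_flux_le => //; exact: XB.
have E0 : E 0 <= be * c ^+ 2.
  apply: (@le_trans _ _ (\sum_(m <- sym_range K) be * X 0 m ^+ 2)).
    apply: ler_sum => m _; apply: (@le_trans _ _ (Phi m (X 0 m))) => //.
    by rewrite ler_piMl// hat_weight_le1.
  rewrite -mulr_sumr ler_wpM2l//; case: Xc => _; apply; exact: sym_range_uniq.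
have sE : (1 - M%:R / K%:R) * A <= E t.
  apply: (@le_trans _ _ (\sum_(m <- s) hat_weight K m * Phi m (X t m))).
    rewrite /A mulrA mulr_sumr big_seq [leRHS]big_seq; apply: ler_sum => m ms.
    rewrite -mulrA; apply: ler_pM => //.
    - by rewrite subr_ge0 ler_pdivrMr// mul1r ler_nat ltnW.
    - by rewrite mulr_ge0 ?sqr_ge0.
    rewrite /hat_weight le_max; apply/orP; right.
    by rewrite lerB// ler_wpM2r ?invr_ge0 ?ler_nat// /M leq_bigmax_seq.
  apply: ler_sum_subseq => //; first exact: sym_range_uniq.
    by move=> m ms; rewrite mem_sym_range; apply: leq_trans (ltnW MK); rewrite /M leq_bigmax_seq.
  by move=> m; rewrite mulr_ge0 ?hat_weight_ge0.
have : (1 - M%:R / K%:R) * A <= be * c ^+ 2 + (L * B) ^+ 2 / K%:R * `|t| by lra.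
move/(ler_wpM2l (ltW KR)).
have -> : K%:R * ((1 - M%:R / K%:R) * A) = K%:R * A - M%:R * A by field; rewrite gt_eqF.
have -> : K%:R * (be * c ^+ 2 + (L * B) ^+ 2 / K%:R * `|t|) =
  K%:R * (be * c ^+ 2) + (L * B) ^+ 2 * `|t| by field; rewrite gt_eqF.
by rewrite -/A mulrBr; lra.
Qed.

End Energy.

(** * Square-integrable functions on the torus *)

Section SquareIntegrable.
Local Open Scope complex_scope.
Variable R : realType.
Local Notation leb := (@lebesgue_measure R).
Local Notation Re := complex.Re.
Local Notation Im := complex.Im.
Local Notation torus := (@torus R).
Local Notation normc := (@Normc.normc R).
Implicit Types (g h : R -> R[i]) (z w : R[i]) (c : R).

Lemma cReD z w : Re (z + w) = Re z + Re w. Proof. by case: z; case: w. Qed.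
Lemma cImD z w : Im (z + w) = Im z + Im w. Proof. by case: z; case: w. Qed.
Lemma cReN z : Re (- z) = - Re z. Proof. by case: z. Qed.
Lemma cImN z : Im (- z) = - Im z. Proof. by case: z. Qed.
Lemma cReM z w : Re (z * w) = Re z * Re w - Im z * Im w.
Proof. by case: z; case: w. Qed.
Lemma cImM z w : Im (z * w) = Re z * Im w + Im z * Re w.
Proof. by case: z; case: w. Qed.
Lemma Re_realM (a : R) z : Re (a%:C * z) = a * Re z.
Proof. by rewrite cReM /= mul0r subr0. Qed.

Lemma normc2E z : normc z ^+ 2 = Re z ^+ 2 + Im z ^+ 2.
Proof. by case: z => a b; rewrite /Normc.normc sqr_sqrtr// addr_ge0// sqr_ge0. Qed.

Lemma normc_ge0 z : 0 <= normc z.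
Proof. by case: z => a b; exact: sqrtr_ge0. Qed.

Lemma normr_Re_le z : `|Re z| <= normc z.
Proof.
rewrite -ler_sqr ?nnegrE ?normc_ge0// normc2E real_normK ?num_real//.
by rewrite lerDl sqr_ge0.
Qed.

Lemma normr_Im_le z : `|Im z| <= normc z.
Proof.
rewrite -ler_sqr ?nnegrE ?normc_ge0// normc2E real_normK ?num_real//.
by rewrite lerDr sqr_ge0.
Qed.

Lemma normc_real (a : R) : normc a%:C = `|a|.
Proof. by rewrite /Normc.normc/= expr0n addr0 sqrtr_sqr. Qed.

Lemma normcMr z w : normc (z * w) = normc z * normc w.
Proof. exact: Normc.normcM. Qed.

Lemma normcD_le z w : normc (z + w) <= normc z + normc w.
Proof. exact: le_normcD. Qed.

Lemma measurable_torus : measurable torus.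
Proof. exact: measurable_itv. Qed.

Definition cmeasurable g :=
  measurable_fun torus (fun x => Re (g x)) /\
  measurable_fun torus (fun x => Im (g x)).

Lemma cmeasurableD g h : cmeasurable g -> cmeasurable h -> cmeasurable (fun x => g x + h x).
Proof.
move=> [g1 g2] [h1 h2]; split; under eq_fun do rewrite ?cReD ?cImD.
  exact: measurable_funD.
exact: measurable_funD.
Qed.

Lemma cmeasurableN g : cmeasurable g -> cmeasurable (fun x => - g x).
Proof.
move=> [g1 g2]; split; under eq_fun do rewrite ?cReN ?cImN.
  exact: measurableT_comp.
exact: measurableT_comp.
Qed.

Lemma cmeasurableB g h : cmeasurable g -> cmeasurable h -> cmeasurable (fun x => g x - h x).
Proof. by move=> G H; apply: cmeasurableD => //; exact: cmeasurableN. Qed.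

Lemma cmeasurableM g h : cmeasurable g -> cmeasurable h -> cmeasurable (fun x => g x * h x).
Proof.
move=> [g1 g2] [h1 h2]; split; under eq_fun do rewrite ?cReM ?cImM.
  by apply: measurable_funB; exact: measurable_funM.
by apply: measurable_funD; exact: measurable_funM.
Qed.

Lemma cmeasurable_real (m : R -> R) : measurable_fun torus m -> cmeasurable (fun x => (m x)%:C).
Proof. by move=> mm; split => //=; exact: measurable_cst. Qed.

Lemma measurable_normc g : cmeasurable g -> measurable_fun torus (fun x => normc (g x)).
Proof.
move=> [g1 g2].
have -> : (fun x => normc (g x)) = (fun x => Num.sqrt (Re (g x) ^+ 2 + Im (g x) ^+ 2)).
  by apply/funext => x; case: (g x).
apply: measurableT_comp.
  by apply: continuous_measurable_fun; exact: sqrt_continuous.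
by apply: measurable_funD; exact: measurable_funX.
Qed.

Lemma measurable_normc2 g : cmeasurable g ->
  measurable_fun torus (fun x => (normc (g x) ^+ 2)%:E : \bar R).
Proof.
by move=> mg; apply/measurable_EFinP; apply: measurable_funX; exact: measurable_normc.
Qed.

(** The analogue of [l2_le] for functions on the torus; measurability is included
    because the integral of a nonmeasurable function carries no information. *)
Definition L2_le g c := [/\ 0 <= c, cmeasurable g & (sqL2norm g <= (c ^+ 2)%:E)%E].

Lemma sqL2norm_ge0 g : (0 <= sqL2norm g)%E.
Proof. by apply: integral_ge0 => x _; rewrite lee_fin sqr_ge0. Qed.

Lemma L2_le_in g c : L2_le g c -> in_L2 g.
Proof. by case=> _ [? ?] H; split=> //; apply: le_lt_trans H (ltry _). Qed.

Definition L2norm g : R := Num.sqrt (fine (sqL2norm g)).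

Lemma L2_le_norm g : in_L2 g -> L2_le g (L2norm g).
Proof.
move=> [g1 g2 goo]; split; [exact: sqrtr_ge0|by split|].
by rewrite sqr_sqrtr ?fine_ge0 ?sqL2norm_ge0// fineK// ge0_fin_numE// sqL2norm_ge0.
Qed.

Lemma L2_le_ge0 g c : L2_le g c -> 0 <= c. Proof. by case. Qed.
Lemma L2_le_meas g c : L2_le g c -> cmeasurable g. Proof. by case. Qed.

Lemma L2_leW g c d : L2_le g c -> c <= d -> L2_le g d.
Proof.
move=> [c0 mg H] cd; have d0 := le_trans c0 cd; split=> //.
by apply: le_trans H _; rewrite lee_fin ler_sqr ?nnegrE.
Qed.

(** Weighted arithmetic-geometric mean under the integral, with the weights that make
    both terms equal to a * b / 2. *)
Lemma L2_cauchy_schwarz_pos g h a b : 0 < a -> 0 < b -> L2_le g a -> L2_le h b ->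
  (\int[leb]_(x in torus) (normc (g x) * normc (h x))%:E <= (a * b)%:E)%E.
Proof.
move=> a0 b0 [_ mg Hg] [_ mh Hh].
(* l u^2 + k v^2 - u v is the square (b u - a v)^2 / (2 a b). *)
pose l := b / (2 * a); pose k := a / (2 * b).
have l0 : 0 <= l by rewrite divr_ge0 ?mulr_ge0 ?ltW.
have k0 : 0 <= k by rewrite divr_ge0 ?mulr_ge0 ?ltW.
apply: (@le_trans _ _ (\int[leb]_(x in torus)
   (l%:E * (normc (g x) ^+ 2)%:E + k%:E * (normc (h x) ^+ 2)%:E))%E).
  apply: ge0_le_integral => //.
  - exact: measurable_torus.
  - by move=> x _; rewrite lee_fin mulr_ge0 ?normc_ge0.
  - apply/measurable_EFinP; apply: measurable_funM; exact: measurable_normc.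
  - by apply: emeasurable_funD; apply: measurable_funeM; exact: measurable_normc2.
  - move=> x _; rewrite -!EFinM -EFinD lee_fin.
    have := sqr_ge0 (b * normc (g x) - a * normc (h x)).
    move: (normc (g x)) (normc (h x)) => u v H.
    rewrite -subr_ge0.
    have -> : l * u ^+ 2 + k * v ^+ 2 - u * v = (b * u - a * v) ^+ 2 / (2 * a * b).
      by rewrite /l /k; field; rewrite ?gt_eqF.
    by rewrite divr_ge0// !mulr_ge0 ?ltW.
rewrite ge0_integralD//; last first.
- by apply: measurable_funeM; exact: measurable_normc2.
- by move=> x _; rewrite -EFinM lee_fin mulr_ge0 ?sqr_ge0.
- by apply: measurable_funeM; exact: measurable_normc2.
- by move=> x _; rewrite -EFinM lee_fin mulr_ge0 ?sqr_ge0.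
- exact: measurable_torus.
rewrite !ge0_integralZl_EFin//; do ?[exact: measurable_torus|exact: measurable_normc2|
  by move=> x _; rewrite lee_fin sqr_ge0].
apply: (@le_trans _ _ (l%:E * (a ^+ 2)%:E + k%:E * (b ^+ 2)%:E)%E).
  by apply: leeD; apply: lee_wpmul2l; rewrite ?lee_fin.
rewrite -!EFinM -EFinD lee_fin le_eqVlt; apply/orP; left; apply/eqP.
by rewrite /l /k; field; rewrite ?gt_eqF.
Qed.

(** The degenerate bounds a = 0 or b = 0 are reached by letting the bounds decrease. *)
Lemma L2_cauchy_schwarz g h a b : L2_le g a -> L2_le h b ->
  (\int[leb]_(x in torus) (normc (g x) * normc (h x))%:E <= (a * b)%:E)%E.
Proof.
move=> Hg Hh; have a0 := L2_le_ge0 Hg; have b0 := L2_le_ge0 Hh.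
apply/lee_addgt0Pr => e e0.
pose d := Num.min 1 (e / (a + b + 1)).
have s0 : 0 < a + b + 1 by rewrite ltr_wpDl// addr_ge0.
have d0 : 0 < d by rewrite lt_min ltr01 divr_gt0.
have d1 : d <= 1 by rewrite ge_min lexx.
have de : d * (a + b + 1) <= e by rewrite -ler_pdivlMr// ge_min lexx orbT.
have := @L2_cauchy_schwarz_pos g h (a + d) (b + d).
rewrite !ltr_wpDl// => /(_ isT isT) H.
apply: le_trans (H _ _) _; [apply: L2_leW Hg _; lra|apply: L2_leW Hh _; lra|].
rewrite -EFinD lee_fin; nra.
Qed.

Lemma L2_leD g h a b : L2_le g a -> L2_le h b -> L2_le (fun x => g x + h x) (a + b).
Proof.
move=> Hg Hh; have a0 := L2_le_ge0 Hg; have b0 := L2_le_ge0 Hh.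
have mg := L2_le_meas Hg; have mh := L2_le_meas Hh.
split; [exact: addr_ge0|exact: cmeasurableD|].
have CS := L2_cauchy_schwarz Hg Hh.
have mgh : measurable_fun torus (fun x => (normc (g x) * normc (h x))%:E : \bar R).
  by apply/measurable_EFinP; apply: measurable_funM; exact: measurable_normc.
apply: (@le_trans _ _ (\int[leb]_(x in torus)
   ((normc (g x) ^+ 2)%:E + (2%:E * (normc (g x) * normc (h x))%:E
     + (normc (h x) ^+ 2)%:E)))%E).
  apply: ge0_le_integral => //.
  - exact: measurable_torus.
  - by move=> x _; rewrite lee_fin sqr_ge0.
  - by apply: measurable_normc2; exact: cmeasurableD.
  - apply: emeasurable_funD; first exact: measurable_normc2.
    by apply: emeasurable_funD; [apply: measurable_funeM|exact: measurable_normc2].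
  - move=> x _; rewrite -EFinM -!EFinD lee_fin.
    have -> : normc (g x) ^+ 2 + (2 * (normc (g x) * normc (h x)) + normc (h x) ^+ 2)
      = (normc (g x) + normc (h x)) ^+ 2 by ring.
    by rewrite ler_sqr ?nnegrE ?addr_ge0 ?normc_ge0// normcD_le.
have P1 x : (0 <= 2%:E * (normc (g x) * normc (h x))%:E)%E.
  by rewrite -EFinM lee_fin !mulr_ge0 ?normc_ge0.
rewrite ge0_integralD//; do ?[exact: measurable_torus|exact: measurable_normc2|
  by move=> x _; rewrite lee_fin sqr_ge0]; last first.
- by apply: emeasurable_funD; [apply: measurable_funeM|exact: measurable_normc2].
- by move=> x _; rewrite adde_ge0// lee_fin sqr_ge0.
rewrite ge0_integralD//; do ?[exact: measurable_torus|exact: measurable_normc2|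
  by move=> x _; rewrite lee_fin sqr_ge0]; last exact: measurable_funeM.
rewrite ge0_integralZl_EFin//; do ?[exact: measurable_torus]; last first.
  by move=> x _; rewrite lee_fin mulr_ge0 ?normc_ge0.
apply: (@le_trans _ _ ((a ^+ 2)%:E + (2%:E * (a * b)%:E + (b ^+ 2)%:E))%E).
  apply: leeD; first by case: Hg.
  by apply: leeD; [apply: lee_wpmul2l; rewrite ?lee_fin|case: Hh].
by rewrite -EFinM -!EFinD lee_fin; nra.
Qed.

Lemma integral0P (u : R -> R) : measurable_fun torus u ->
  (forall x, 0 <= u x) -> (forall x, torus x -> x != 0 -> u x = 0) ->
  (\int[leb]_(x in torus) (u x)%:E = 0)%E.
Proof.
move=> mu_ u0 ux.
rewrite -(@integral0 _ _ _ leb torus).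
apply: ge0_ae_eq_integral => //.
- exact: measurable_torus.
- exact/measurable_EFinP.
- by move=> x _; rewrite lee_fin.
exists [set 0]; split=> //; first exact: lebesgue_measure_set1.
move=> x /=; apply: contra_notP => /eqP x0 tx.
by rewrite ux.
Qed.

(** The point 0 is exempted because symbols that are inverse to |grad| are bounded, or
    inverses, only away from it. *)
Lemma L2_le_bounded (m g : R -> R[i]) B c : 0 <= B -> cmeasurable m -> L2_le g c ->
  (forall x, torus x -> x != 0 -> normc (m x) <= B) ->
  L2_le (fun x => m x * g x) (B * c).
Proof.
move=> B0 mm [c0 mg Hg] mB; split; [exact: mulr_ge0|exact: cmeasurableM|].
rewrite exprMn EFinM.
apply: (@le_trans _ _ ((B ^+ 2)%:E * sqL2norm g)%E); last first.
  by apply: lee_wpmul2l => //; rewrite lee_fin sqr_ge0.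
rewrite /sqL2norm -ge0_integralZl_EFin//; do ?[exact: measurable_torus|
  exact: measurable_normc2|by move=> x _; rewrite lee_fin sqr_ge0|exact: sqr_ge0].
pose e x : R := if x == 0 then normc (m x * g x) ^+ 2 else 0.
have me : measurable_fun torus e.
  apply: (measurable_fun_if measurable_torus).
  - apply: (measurable_fun_bool true).
    rewrite (_ : _ @^-1` _ = [set 0]); first exact: measurableI measurable_torus (measurable_set1 _).
    by apply/seteqP; split => x /=; [move/eqP|move=> ->; rewrite eqxx].
  - apply: measurable_funS (_ : measurable_fun torus _) => //; first exact: measurable_torus.
    by apply: measurable_funX; apply: measurable_normc; exact: cmeasurableM.
  - exact: measurable_cst.
have e0 x : 0 <= e x by rewrite /e; case: ifP => // _; exact: sqr_ge0.
have ie : (\int[leb]_(x in torus) (e x)%:E = 0)%E.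
  by apply: integral0P => // x _ /negbTE; rewrite /e => ->.
rewrite -[leRHS]add0e -ie -ge0_integralD//; do ?[exact: measurable_torus|
  exact/measurable_EFinP|
  by move=> x _; rewrite -EFinM lee_fin mulr_ge0 ?sqr_ge0|
  by apply: measurable_funeM; exact: measurable_normc2|
  by move=> x _; rewrite lee_fin].
apply: ge0_le_integral => //.
- exact: measurable_torus.
- by move=> x _; rewrite lee_fin sqr_ge0.
- by apply: measurable_normc2; exact: cmeasurableM.
- apply: emeasurable_funD; first exact/measurable_EFinP.
  by apply: measurable_funeM; exact: measurable_normc2.
move=> x tx; rewrite -EFinM -EFinD lee_fin /e; case: eqVneq => [_|x0].
  by rewrite lerDl mulr_ge0 ?sqr_ge0.
rewrite add0r normcMr exprMn ler_wpM2r ?sqr_ge0//.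
by rewrite ler_sqr ?nnegrE ?normc_ge0// mB.
Qed.

Lemma cmeasurable_cst z : cmeasurable (fun=> z).
Proof. by split; exact: measurable_cst. Qed.

Lemma L2_leZ z g c : L2_le g c -> L2_le (fun x => z * g x) (normc z * c).
Proof.
move=> H; apply: (@L2_le_bounded (fun=> z)) => //; exact: normc_ge0.
Qed.

Lemma L2_leN g c : L2_le g c -> L2_le (fun x => - g x) c.
Proof.
move=> /(@L2_leZ (-1)); rewrite normcN Normc.normc1 mul1r.
by under eq_fun do rewrite mulN1r.
Qed.

Lemma L2_leB g h a b : L2_le g a -> L2_le h b -> L2_le (fun x => g x - h x) (a + b).
Proof. by move=> G H; apply: L2_leD => //; exact: L2_leN. Qed.

Lemma L2_le_congr g h c : cmeasurable h -> L2_le g c ->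
  (forall x, torus x -> x != 0 -> g x = h x) -> L2_le h c.
Proof.
move=> mh Hg gh; have mg := L2_le_meas Hg.
have E : L2_le (fun x => h x - g x) 0.
  split=> //; first exact: cmeasurableB.
  rewrite expr0n /sqL2norm integral0P//.
  - by apply: measurable_funX; apply: measurable_normc; exact: cmeasurableB.
  - by move=> x; exact: sqr_ge0.
  - by move=> x tx x0; rewrite gh// subrr Normc.normc0 expr0n.
have := L2_leD Hg E; rewrite addr0.
by under eq_fun do rewrite addrC subrK.
Qed.

(** A function of norm 0 vanishes almost everywhere, hence so does its product with an
    unbounded multiplier such as 1 / |grad|. *)
Lemma L2_le_null_mul (m g : R -> R[i]) : cmeasurable m -> L2_le g 0 -> L2_le (fun x => m x * g x) 0.
Proof.
move=> mm [_ mg Hg]; split => //; first exact: cmeasurableM.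
have H0 : (\int[leb]_(x in torus) `|(normc (g x) ^+ 2)%:E| = 0)%E.
  under eq_integral => x _ do rewrite abse_EFin ger0_norm ?sqr_ge0//.
  by apply/eqP; rewrite eq_le -/(sqL2norm g) sqL2norm_ge0 andbT; move: Hg; rewrite expr0n.
have ae := (@ae_eq_integral_abs _ _ _ leb _ measurable_torus _ (measurable_normc2 mg)).1 H0.
rewrite expr0n /sqL2norm.
rewrite (_ : integral _ _ _ = 0)%E//.
rewrite -(@integral0 _ _ _ leb torus).
apply: ge0_ae_eq_integral => //.
- exact: measurable_torus.
- by apply: measurable_normc2; exact: cmeasurableM.
- by move=> x _; rewrite lee_fin sqr_ge0.
apply: filterS ae => x /= + tx => /(_ tx) [].
by rewrite normcMr exprMn => ->; rewrite mulr0.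
Qed.

End SquareIntegrable.

(** * Completeness of L2 of the torus *)

Section Completeness.
Local Open Scope complex_scope.
Variable R : realType.
Local Notation leb := (@lebesgue_measure R).
Local Notation Re := complex.Re.
Local Notation Im := complex.Im.
Local Notation torus := (@torus R).
Local Notation normc := (@Normc.normc R).

(** Absolute convergence of the telescoping series. *)
Lemma cvg_of_summable_increments (u v : nat -> R) :
  (forall k, `|u k.+1 - u k| <= v k) -> (\sum_(k <oo) (v k)%:E < +oo)%E -> cvgn u.
Proof.
move=> uv vS.
have v0 k : 0 <= v k by apply: le_trans (uv k).
have S0 : (0 <= \sum_(k <oo) (v k)%:E)%E by apply: nneseries_ge0 => k _ _; rewrite lee_fin.
have cs : cvgn (series (fun k => u k.+1 - u k)).
  apply: normed_cvg; apply: nondecreasing_is_cvgn.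
    by apply: nondecreasing_series => k _ _ /=.
  exists (fine (\sum_(k <oo) (v k)%:E)) => _ [n _ <-].
  rewrite -lee_fin fineK ?ge0_fin_numE//.
  apply: (@le_trans _ _ (\sum_(0 <= k < n) (v k)%:E)%E).
    by rewrite sumEFin lee_fin /series/=; apply: ler_sum.
  by apply: nneseries_lim_ge => k _ _; rewrite lee_fin.
have -> : u = (fun n => u 0%N + series (fun k => u k.+1 - u k) n).
  by apply/funext => n; rewrite /series/= telescope_sumr// addrC subrK.
by apply: is_cvgD => //; exact: is_cvg_cst.
Qed.

Lemma cvg_sqr (u : nat -> R) (l : R) :
  u n @[n --> \oo] --> l -> u n ^+ 2 @[n --> \oo] --> l ^+ 2.
Proof. by move=> ul; rewrite expr2; under eq_fun do rewrite expr2; exact: cvgM. Qed.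

Lemma normc_one : normc (1 : R[i]) = 1.
Proof. by rewrite (normc_real 1) normr1. Qed.

Lemma lebesgue_torus : leb torus = (pi + pi)%:E.
Proof.
have := @lebesgue_measure_itv R `[(- pi), pi[%R.
by rewrite /= lte_fin gtrN ?pi_gt0// opprK.
Qed.

Lemma L2_one : exists a : R, L2_le (fun=> 1 : R[i]) a.
Proof.
exists (L2norm (fun=> 1 : R[i])); apply: L2_le_norm; split; [exact: measurable_cst|exact: measurable_cst|].
rewrite /sqL2norm integral_cst; last exact: measurable_torus.
rewrite -[X in (_ * X)%E]/(leb torus) lebesgue_torus.
by rewrite -EFinM ltry.
Qed.

Lemma L2_telescope (g : nat -> R -> R[i]) (C : R) :
  (forall k, cmeasurable (g k)) ->
  (forall k, L2_le (fun x => g k.+1 x - g k x) (C * 2^-1 ^+ k)) ->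
  forall j k, L2_le (fun x => g (j + k)%N x - g k x)
    (2 * C * (2^-1 ^+ k - 2^-1 ^+ (j + k))).
Proof.
move=> mg H j k; elim: j => [|j IH].
  rewrite add0n subrr mulr0; split=> //; first exact: cmeasurableB.
  rewrite expr0n /sqL2norm integral0_eq// => x _.
  by rewrite subrr Normc.normc0 expr0n.
have := L2_leD (H (j + k)%N) IH.
under eq_fun do rewrite addrA subrK -addSn.
move=> /L2_leW; apply; rewrite [2^-1 ^+ (j.+1 + k)]exprS; lra.
Qed.

(** Riesz-Fischer for a rapidly Cauchy sequence: the sum of the increments is integrable,
    hence finite almost everywhere, so the sequence converges there; Fatou's lemma
    estimates the distance to the limit. *)
Theorem L2_complete (g : nat -> R -> R[i]) (C : R) :
  (forall k, cmeasurable (g k)) ->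
  (forall k, L2_le (fun x => g k.+1 x - g k x) (C * 2^-1 ^+ k)) ->
  exists h, forall k, L2_le (fun x => h x - g k x) (2 * C * 2^-1 ^+ k).
Proof.
move=> mg H.
have C0 : 0 <= C by have /L2_le_ge0 := H 0%N; rewrite expr0 mulr1.
pose v k x := normc (g k.+1 x - g k x).
have mv k : measurable_fun torus (v k) by apply: measurable_normc; exact: cmeasurableB.
have v0 k x : 0 <= v k x by exact: normc_ge0.
(* S dominates all the increments; it is finite almost everywhere. *)
pose S x := (\sum_(k <oo) (v k x)%:E)%E.
have S0 x : (0 <= S x)%E by apply: nneseries_ge0 => k _ _; rewrite lee_fin.
have mS : measurable_fun torus S.
  apply: (@ge0_emeasurable_sum _ _ _ torus (fun k x => (v k x)%:E) xpredT) => [k x _ _|k _].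
    by rewrite lee_fin.
  exact/measurable_EFinP.
have [a Ha] := L2_one; have a0 := L2_le_ge0 Ha.
have iS : (\int[leb]_(x in torus) S x <= (a * C * 2)%:E)%E.
  rewrite /S integral_nneseries//; last first.
  - by move=> k x _; rewrite lee_fin.
  - by move=> k; apply/measurable_EFinP; exact: mv.
  - exact: measurable_torus.
  apply: lime_le; first by apply: is_cvg_nneseries => k _ _; apply: integral_ge0 => x _; rewrite lee_fin.
  apply: nearW => n.
  apply: (@le_trans _ _ (\sum_(0 <= k < n) (a * (C * 2^-1 ^+ k))%:E)%E).
    apply: lee_sum => k _; apply: le_trans; last exact: L2_cauchy_schwarz Ha (H k).
    rewrite le_eqVlt; apply/orP; left; apply/eqP; apply: eq_integral => x _.
    by rewrite normc_one mul1r.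
  rewrite sumEFin lee_fin.
  have -> : \sum_(0 <= k < n) a * (C * 2^-1 ^+ k) = a * C * 2 * (1 - 2^-1 ^+ n).
    elim: n => [|n IH]; first by rewrite big_nil expr0 subrr mulr0.
    by rewrite big_nat_recr//= IH exprS; field.
  by rewrite ler_piMr ?mulr_ge0// gerBl exprn_ge0.
have intS : leb.-integrable torus S.
  apply/integrableP; split=> //.
  under eq_integral do rewrite gee0_abs//.
  exact: le_lt_trans iS (ltry _).
have aeS : {ae leb, forall x, torus x -> S x \is a fin_num}.
  by apply: (integrable_ae _ intS); exact: measurable_torus.
pose E := torus `&` [set x | (S x < +oo)%E].
have mE : measurable E by apply: emeasurable_fun_infty_o => //; exact: measurable_torus.
pose e x : R := \1_E x.
have me : cmeasurable (fun x => (e x)%:C) by apply: cmeasurable_real; exact: measurable_indic.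
have en x : normc (e x)%:C <= 1.
  by rewrite normc_real /e indicE; case: (x \in E); rewrite ?normr1// normr0 ler01.
(* Cutting off to E makes the sequence converge at every point. *)
pose G k x := (e x)%:C * g k x.
have mG k : cmeasurable (G k) by exact: cmeasurableM.
have GE x : x \notin E -> forall k, G k x = 0.
  by move=> xE k; rewrite /G /e indicE (negbTE xE) mul0r.
have GE1 x : x \in E -> forall k, G k x = g k x.
  by move=> xE k; rewrite /G /e indicE xE mul1r.
have ES x : x \in E -> (\sum_(k <oo) (v k x)%:E < +oo)%E.
  by rewrite inE => -[].
have cRe x : cvgn (fun k => Re (G k x)).
  have [xE|xE] := boolP (x \in E); last first.
    by under eq_fun do rewrite GE//; exact: is_cvg_cst.
  under eq_fun do rewrite GE1//.
  apply: (@cvg_of_summable_increments _ (v^~ x)); last exact: ES.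
  by move=> k; rewrite -cReN -cReD normr_Re_le.
have cIm x : cvgn (fun k => Im (G k x)).
  have [xE|xE] := boolP (x \in E); last first.
    by under eq_fun do rewrite GE//; exact: is_cvg_cst.
  under eq_fun do rewrite GE1//.
  apply: (@cvg_of_summable_increments _ (v^~ x)); last exact: ES.
  by move=> k; rewrite -cImN -cImD normr_Im_le.
pose h x := limn (fun k => Re (G k x)) +i* limn (fun k => Im (G k x)).
have mh : cmeasurable h.
  split.
    apply: (@measurable_fun_cvg _ _ _ torus (fun k x => Re (G k x))) => [k|x _].
      by have [] := mG k.
    exact: cRe.
  apply: (@measurable_fun_cvg _ _ _ torus (fun k x => Im (G k x))) => [k|x _].
    by have [] := mG k.
  exact: cIm.
exists h => k.
have Gjk j : L2_le (fun x => G (j + k)%N x - G k x) (2 * C * 2^-1 ^+ k).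
  have Hj : L2_le (fun x => g (j + k)%N x - g k x) (2 * C * 2^-1 ^+ k).
    apply: L2_leW (L2_telescope mg H j k) _.
    by rewrite ler_wpM2l ?mulr_ge0// gerBl exprn_ge0.
  have := L2_le_bounded ler01 me Hj (fun x _ _ => en x).
  by rewrite mul1r; under eq_fun do rewrite mulrBr.
have HG : L2_le (fun x => h x - G k x) (2 * C * 2^-1 ^+ k).
  split; [by rewrite !mulr_ge0|exact: cmeasurableB|].
  pose f j x : \bar R := (normc (G (j + k)%N x - G k x) ^+ 2)%:E.
  have fh x : f ^~ x @ \oo --> (normc (h x - G k x) ^+ 2)%:E.
    apply: cvg_EFin; first exact: nearW.
    rewrite /f /= normc2E; under eq_fun do rewrite /= normc2E.
    rewrite !(cReD, cImD, cReN, cImN).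
    under eq_fun do rewrite !(cReD, cImD, cReN, cImN).
    apply: cvgD; apply: cvg_sqr; apply: cvgB; try exact: cvg_cst.
      by rewrite (cvg_shiftn k (fun j => Re (G j x))); exact: cRe.
    by rewrite (cvg_shiftn k (fun j => Im (G j x))); exact: cIm.
  have -> : sqL2norm (fun x => h x - G k x) =
      (\int[leb]_(x in torus) limn_einf (f^~ x))%E.
    by apply: eq_integral => x _; have [-> _] := cvg_limn_einf_sup (fh x).
  apply: le_trans (fatou _ _ _ _) _.
  - exact: measurable_torus.
  - by move=> j; apply: measurable_normc2; exact: cmeasurableB.
  - by move=> j x _; rewrite lee_fin sqr_ge0.
  rewrite limn_einf_lim; apply: lime_le; first exact: is_cvg_einfs.
  apply: nearW => j; apply: (@le_trans _ _ (sqL2norm (fun x => G (j + k)%N x - G k x))).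
    by apply: ereal_inf_lbound; exists j => //=.
  by case: (Gjk j).
have e1 : L2_le (fun x => (e x)%:C - 1) 0.
  split=> //; first by apply: cmeasurableB => //; exact: cmeasurable_cst.
  rewrite expr0n /sqL2norm (_ : integral _ _ _ = 0)%E//.
  rewrite -(@integral0 _ _ _ leb torus); apply: ge0_ae_eq_integral => //.
  - exact: measurable_torus.
  - by apply: measurable_normc2; apply: cmeasurableB => //; exact: cmeasurable_cst.
  - by move=> x _; rewrite lee_fin sqr_ge0.
  apply: (@filterS _ _ (ae_filter_ringOfSetsType leb) _ _ _ aeS) => x /= + tx => /(_ tx) Sx.
  have xE : x \in E.
    by rewrite inE; split=> //=; rewrite -ge0_fin_numE.
  by rewrite /e indicE xE !subrr expr0n addr0 sqrtr0 expr0n.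
have := L2_leD HG (L2_le_null_mul (mg k) e1); rewrite addr0.
suff -> : (fun x => h x - G k x + g k x * ((e x)%:C - 1)) = (fun x => h x - g k x) by [].
by apply/funext => x; rewrite /G; ring.
Qed.

End Completeness.

(** * Trigonometric polynomials and Fourier coefficients *)

Section FourierCoefficients.
Local Open Scope complex_scope.
Variable R : realType.
Local Notation leb := (@lebesgue_measure R).
Local Notation Re := complex.Re.
Local Notation Im := complex.Im.
Local Notation torus := (@torus R).
Local Notation normc := (@Normc.normc R).
Implicit Types (f a : int -> R) (g h : R -> R[i]) (s : seq int).

Lemma expiD (x y : R) : expi (x + y) = expi x * expi y.
Proof.
rewrite /expi cosD sinD; apply/eqP; rewrite eq_complex/=.
by apply/andP; split; apply/eqP; ring.
Qed.

Lemma normc_expi (x : R) : normc (expi x) = 1.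
Proof. by rewrite /expi /Normc.normc cos2Dsin2 sqrtr1. Qed.

Lemma measurable_continuous (u : R -> R) : continuous u -> measurable_fun torus u.
Proof.
move=> cu; apply: (@measurable_funS _ _ _ _ setT) => //.
exact: continuous_measurable_fun.
Qed.

Lemma continuous_mulr (c : R) : continuous (fun x : R => x * c).
Proof. by move=> x; apply: cvgM; [exact: cvg_id|exact: cvg_cst]. Qed.

Lemma continuous_cosM (c : R) : continuous (fun x : R => cos (x * c)).
Proof.
move=> x; apply: (@continuous_comp _ _ _ (fun x : R => x * c) cos).
  exact: continuous_mulr.
exact: continuous_cos.
Qed.

Lemma continuous_sinM (c : R) : continuous (fun x : R => sin (x * c)).
Proof.
move=> x; apply: (@continuous_comp _ _ _ (fun x : R => x * c) sin).
  exact: continuous_mulr.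
exact: continuous_sin.
Qed.

Lemma cmeasurable_expi (c : R) : cmeasurable (fun x => expi (x * c)).
Proof.
split; apply: measurable_continuous; first exact: continuous_cosM.
exact: continuous_sinM.
Qed.

(** All explicit integrals below are integrals of trigonometric polynomials. *)
Lemma integral_torus_FTC (u U : R -> R) : continuous u ->
  (forall x : R, is_derive x 1 U (u x)) ->
  (\int[leb]_(x in torus) (u x)%:E = (U pi - U (- pi))%:E)%E.
Proof.
move=> cu dU.
have pi0 : 0 <= (pi : R) by exact: pi_ge0.
have iu : leb.-integrable `[- pi, pi] (EFin \o u).
  apply: continuous_compact_integrable; first exact: segment_compact.
  exact: continuous_subspaceT.
rewrite /Defs.torus integral_itv_bndo_bndc; last first.
  by apply/measurable_EFinP; exact: measurable_continuous.
have fi := integrable_fin_num _ iu.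
rewrite -[LHS]fineK; last exact: fi.
congr (_%:E).
have := @int0E R u (- pi) pi cu; rewrite oppr_le0 pi0 (le_trans _ pi0) ?oppr_le0//.
move=> /(_ isT isT).
have := @int0E R u (- pi) (- pi) cu; rewrite oppr_le0 pi0 lexx.
move=> /(_ isT isT).
have E := int0_unique _ cu dU.
have := E pi; have := E (- pi).
rewrite set_itv1 Rintegral_set1 /Rintegral/=; lra.
Qed.

Lemma L2_le_pair g h (a b : R) : L2_le g a -> L2_le h b ->
  leb.-integrable torus (EFin \o (fun x => Re (g x * h x))) /\
  `|\int[leb]_(x in torus) Re (g x * h x)| <= a * b.
Proof.
move=> Hg Hh; have mg := L2_le_meas Hg; have mh := L2_le_meas Hh.
have mR : measurable_fun torus (fun x => Re (g x * h x)) by case: (cmeasurableM mg mh).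
have CS : (\int[leb]_(x in torus) `|(Re (g x * h x))%:E| <= (a * b)%:E)%E.
  apply: le_trans; last exact: L2_cauchy_schwarz Hg Hh.
  apply: ge0_le_integral => //.
  - exact: measurable_torus.
  - by apply: measurableT_comp => //; exact/measurable_EFinP.
  - by apply/measurable_EFinP; apply: measurable_funM; exact: measurable_normc.
  - by move=> x _; rewrite abse_EFin lee_fin -normcMr normr_Re_le.
have I : leb.-integrable torus (EFin \o (fun x => Re (g x * h x))).
  apply/integrableP; split; first exact/measurable_EFinP.
  exact: le_lt_trans CS (ltry _).
split => //.
apply: le_trans (le_normr_Rintegral _ I) _; first exact: measurable_torus.
rewrite /Rintegral -lee_fin fineK//.
rewrite ge0_fin_numE; last by apply: integral_ge0 => x _; rewrite lee_fin.
exact: le_lt_trans CS (ltry _).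
Qed.

(** Only the real part of the Fourier coefficient is kept. The multipliers in the equation
    are real and act on real sequences, and all identities used here are real-linear. *)
Definition coef g (n : int) : R :=
  (2 * pi)^-1 * \int[leb]_(x in torus) Re (g x * expi (x * n%:~R)).

Lemma multiplierE m f : multiplier m f = coef (fun x => (m x)%:C * dft f x).
Proof. by []. Qed.

Definition sqrt2pi : R := Num.sqrt (2 * pi).

Lemma sqrt2pi_gt0 : 0 < sqrt2pi.
Proof. by rewrite sqrtr_gt0 mulr_gt0// pi_gt0. Qed.

Lemma sqr_sqrt2pi : sqrt2pi ^+ 2 = 2 * pi.
Proof. by rewrite sqr_sqrtr// mulr_ge0// pi_ge0. Qed.

Definition trig (sg : R) s a (x : R) : R[i] :=
  \sum_(n <- s) (a n)%:C * expi (x * (sg * n%:~R)).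

Lemma Re_trig sg s a x : Re (trig sg s a x) = \sum_(n <- s) a n * cos (x * (sg * n%:~R)).
Proof.
rewrite /trig; elim: s => [|n s IH]; first by rewrite !big_nil.
by rewrite !big_cons cReD IH Re_realM.
Qed.

Lemma Im_trig sg s a x : Im (trig sg s a x) = \sum_(n <- s) a n * sin (x * (sg * n%:~R)).
Proof.
rewrite /trig; elim: s => [|n s IH]; first by rewrite !big_nil.
by rewrite !big_cons cImD IH cImM /= mul0r addr0.
Qed.

Lemma continuous_sum s (u : int -> R -> R) : (forall n, continuous (u n)) ->
  continuous (fun x => \sum_(n <- s) u n x).
Proof.
move=> cu; elim: s => [|n s IH] x.
  by under eq_fun do rewrite big_nil; exact: cvg_cst.
under eq_fun do rewrite big_cons.
by apply: cvgD; [exact: cu|exact: IH].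
Qed.

Lemma continuous_Re_trig sg s a : continuous (fun x => Re (trig sg s a x)).
Proof.
under eq_fun do rewrite Re_trig; apply: continuous_sum => n x.
by apply: cvgM; [exact: cvg_cst|exact: continuous_cosM].
Qed.

Lemma continuous_Im_trig sg s a : continuous (fun x => Im (trig sg s a x)).
Proof.
under eq_fun do rewrite Im_trig; apply: continuous_sum => n x.
by apply: cvgM; [exact: cvg_cst|exact: continuous_sinM].
Qed.

Lemma cmeasurable_trig sg s a : cmeasurable (trig sg s a).
Proof.
split; apply: measurable_continuous; first exact: continuous_Re_trig.
exact: continuous_Im_trig.
Qed.

Lemma sin_intpi (d : int) : sin (pi * d%:~R) = 0 :> R.
Proof.
have nat_case (k : nat) : sin (pi * k%:R) = 0 :> R.
  elim: k => [|k IH]; first by rewrite mulr0 sin0.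
  by rewrite -natr1 mulrDr mulr1 sinDpi IH oppr0.
by case: d => k; rewrite ?NegzE ?mulrNz ?mulrN ?sinN -?pmulrn nat_case ?oppr0.
Qed.

(** A primitive of cos (d x) vanishing at 0, with the case d = 0 singled out. *)
Definition cos_primitive (d : int) (x : R) : R :=
  if d == 0 then x else sin (x * d%:~R) / d%:~R.

Lemma is_derive_cos_primitive (d : int) (x : R) :
  is_derive x 1 (cos_primitive d) (cos (x * d%:~R)).
Proof.
rewrite /cos_primitive; have [->|d0] := eqVneq d 0.
  by rewrite mulr0 cos0; exact: is_derive_id.
have d0R : d%:~R != 0 :> R by rewrite intr_eq0.
have D1 : is_derive x 1 (fun y : R => y * d%:~R) d%:~R by exact: is_derive_mulrl.
have D2 := @is_derive1_comp R sin (fun y => y * d%:~R) x _ _ (is_derive_sin _) D1.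
have := is_deriveZ (d%:~R^-1) D2; rewrite /GRing.scale/= [_^-1 * _]mulrC mulfK//.
suff -> : (fun y : R => sin (y * d%:~R) / d%:~R) =
  d%:~R^-1 \*: (sin \o (fun y => y * d%:~R)) by [].
by apply/funext => y /=; rewrite mulrC.
Qed.

Lemma cos_primitive_diff (d : int) :
  cos_primitive d pi - cos_primitive d (- pi) = if d == 0 then 2 * pi else 0.
Proof.
rewrite /cos_primitive; case: eqP => _; first by rewrite opprK -mulr2n mulr_natl.
by rewrite mulNr sinN sin_intpi oppr0 mul0r subrr.
Qed.

Lemma sum_uniq_pick s (n : int) (u : int -> R) : uniq s -> n \in s ->
  \sum_(m <- s) (if n - m == 0 then u m else 0) = u n.
Proof.
move=> us ns; rewrite (bigD1_seq n)//= subrr eqxx big1 ?addr0// => m mn.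
by rewrite subr_eq0 eq_sym (negbTE mn).
Qed.

(** Orthogonality of the exponentials: the square modulus is a double sum of
    a_n a_m cos ((n - m) x), which has an explicit primitive. *)
Lemma trig_norm sg s a : sg ^+ 2 = 1 -> uniq s ->
  sqL2norm (trig sg s a) = (2 * pi * \sum_(n <- s) a n ^+ 2)%:E.
Proof.
move=> sg1 us; rewrite /sqL2norm.
pose u x := \sum_(n <- s) a n * \sum_(m <- s) a m * cos (x * (n - m)%:~R).
pose U x := \sum_(n <- s) a n * \sum_(m <- s) a m * cos_primitive (n - m) x.
have E x : normc (trig sg s a x) ^+ 2 = u x.
  rewrite normc2E Re_trig Im_trig !expr2 !mulr_suml -big_split/=.
  apply: eq_bigr => n _; rewrite -!mulrA -mulrDr; congr (_ * _).
  rewrite !mulr_sumr -big_split/=; apply: eq_bigr => m _.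
  have -> : cos (x * (n - m)%:~R) =
    cos (x * (sg * n%:~R) - x * (sg * m%:~R)) :> R.
    have [->|->] : sg = 1 \/ sg = -1.
      have /eqP : (sg - 1) * (sg + 1) = 0 by rewrite -subr_sqr sg1 expr1n subrr.
      by rewrite mulf_eq0 subr_eq0 addr_eq0 => /orP[] /eqP; [left|right].
      by rewrite !mul1r intrB mulrBr.
    by rewrite -[LHS]cosN intrB; congr cos; ring.
  by rewrite cosB; ring.
under eq_integral do rewrite E.
have cu : continuous u.
  apply: continuous_sum => n x; apply: cvgM; first exact: cvg_cst.
  apply: continuous_sum => m {}x; apply: cvgM; first exact: cvg_cst.
  exact: continuous_cosM.
have dU (x : R) : is_derive x 1 U (u x).
  apply: is_derive_sum_lin => n; apply: is_derive_sum_lin => m.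
  exact: is_derive_cos_primitive.
rewrite (integral_torus_FTC cu dU).
congr (_%:E); rewrite /U -sumrB mulr_sumr big_seq [RHS]big_seq.
apply: eq_bigr => n ns; rewrite -mulrBr -sumrB.
rewrite (eq_bigr (fun m => if n - m == 0 then 2 * pi * a m else 0)); last first.
  move=> m _; rewrite -mulrBr cos_primitive_diff.
  by case: ifP => _; rewrite ?mulr0// mulrC.
by rewrite sum_uniq_pick//; ring.
Qed.

Lemma L2_le_trig sg s a : sg ^+ 2 = 1 -> uniq s ->
  L2_le (trig sg s a) (sqrt2pi * norm_on s a).
Proof.
move=> sg1 us; split; first by rewrite mulr_ge0 ?norm_on_ge0// ltW// sqrt2pi_gt0.
  exact: cmeasurable_trig.
by rewrite trig_norm// exprMn sqr_sqrt2pi sqr_norm_on.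
Qed.

Lemma L2_le_expi (n : int) : L2_le (fun x => expi (x * n%:~R)) sqrt2pi.
Proof.
have := @L2_le_trig 1 [:: n] (fun=> 1) (expr1n _ _) isT.
rewrite /norm_on big_seq1 expr1n sqrtr1 mulr1.
suff -> : trig 1 [:: n] (fun=> 1) = (fun x => expi (x * n%:~R)) by [].
by apply/funext => x; rewrite /trig big_seq1 !mul1r.
Qed.

Lemma coef_integrable g c (n : int) : L2_le g c ->
  leb.-integrable torus (EFin \o (fun x => Re (g x * expi (x * n%:~R)))).
Proof. by move=> H; have [] := L2_le_pair H (L2_le_expi n). Qed.

Lemma coefD g h c d n : L2_le g c -> L2_le h d ->
  coef (fun x => g x + h x) n = coef g n + coef h n.
Proof.
move=> Hg Hh; rewrite /coef -mulrDr -RintegralD; last 3 first.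
- exact: measurable_torus.
- by have := coef_integrable n Hg.
- by have := coef_integrable n Hh.
congr (_ * _); apply: eq_Rintegral => x _.
by rewrite mulrDl cReD.
Qed.

Lemma coefZ g c (k : R) n : L2_le g c -> coef (fun x => k%:C * g x) n = k * coef g n.
Proof.
move=> Hg; rewrite /coef mulrCA; congr (_ * _); rewrite -RintegralZl; last 2 first.
- exact: measurable_torus.
- by have := coef_integrable n Hg.
by apply: eq_Rintegral => x _; rewrite -mulrA Re_realM.
Qed.

Lemma coefB g h c d n : L2_le g c -> L2_le h d ->
  coef (fun x => g x - h x) n = coef g n - coef h n.
Proof.
move=> Hg Hh; have := coefD n Hg (L2_leZ (-1)%:C Hh).
rewrite (coefZ (-1) n Hh) mulN1r => <-; apply: (congr1 (fun w => coef w n)).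
by apply/funext => x; rewrite rmorphN1 mulN1r.
Qed.

Lemma coef_trig g c s a : L2_le g c -> uniq s ->
  \sum_(n <- s) a n * coef g n =
  (2 * pi)^-1 * \int[leb]_(x in torus) Re (g x * trig 1 s a x).
Proof.
move=> Hg; elim: s => [|m s IH].
  move=> _; rewrite big_nil /Rintegral integral0_eq ?mulr0// => x _.
  by rewrite /trig big_nil mulr0.
rewrite cons_uniq => /andP[_ us]; rewrite big_cons IH//.
rewrite -(coefZ (a m) m Hg) /coef -mulrDr -RintegralD; last 3 first.
- exact: measurable_torus.
- by have := coef_integrable m (L2_leZ (a m)%:C Hg).
- by have [] := L2_le_pair Hg (L2_le_trig a (expr1n _ 2) us).
congr (_ * _); apply: eq_Rintegral => x _.
by rewrite /trig big_cons mul1r mulrDr cReD; congr (Re _ + _); ring.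
Qed.

(** By duality: a finite combination of coefficients is the pairing of g with a
    trigonometric polynomial of known norm. *)
Lemma bessel g c : L2_le g c -> l2_le (coef g) (sqrt2pi^-1 * c).
Proof.
move=> Hg; have c0 := L2_le_ge0 Hg; have p0 := sqrt2pi_gt0.
apply: l2_le_dual; first by rewrite mulr_ge0// invr_ge0 ltW.
move=> s a us; rewrite (coef_trig a Hg us).
have [_ H] := L2_le_pair Hg (L2_le_trig a (expr1n _ 2) us).
have := le_trans (ler_norm _) H => {}H.
have P : 0 < (2 * pi : R)^-1 by rewrite invr_gt0 mulr_gt0// pi_gt0.
apply: le_trans (ler_wpM2l (ltW P) H) _.
rewrite -sqr_sqrt2pi le_eqVlt; apply/orP; left; apply/eqP; field.
by rewrite gt_eqF.
Qed.

End FourierCoefficients.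

(** * The Fourier transform of a square-summable sequence *)

Section FourierTransform.
Local Open Scope complex_scope.
Variable R : realType.
Local Notation leb := (@lebesgue_measure R).
Local Notation Re := complex.Re.
Local Notation Im := complex.Im.
Local Notation torus := (@torus R).
Local Notation normc := (@Normc.normc R).
Local Notation sqrt2pi := (sqrt2pi R).
Implicit Types (f : int -> R) (g h : R -> R[i]).

Lemma sum_sym_range_widen (V : nmodType) (F : int -> V) N M : (N <= M)%N ->
  \sum_(m <- sym_range M) (if (`|m| <= N)%N then F m else 0) =
  \sum_(m <- sym_range N) F m.
Proof.
move=> NM; rewrite -big_mkcond -big_filter; apply: perm_big.
apply: uniq_perm; rewrite ?filter_uniq ?sym_range_uniq// => m.
rewrite mem_filter !mem_sym_range; case: leqP => //= mN.
exact: leq_trans NM.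
Qed.

Lemma dft_partial_trig f N : dft_partial f N = trig (-1) (sym_range N) f.
Proof.
apply/funext => x; rewrite /trig sum_sym_range /dft_partial.
by apply: eq_bigr => k _; rewrite mulN1r mulrN.
Qed.

Lemma cmeasurable_dft_partial f N : cmeasurable (dft_partial f N).
Proof. by rewrite dft_partial_trig; exact: cmeasurable_trig. Qed.

Lemma L2_le_dft_partial f c N : l2_le f c -> L2_le (dft_partial f N) (sqrt2pi * c).
Proof.
move=> fc; rewrite dft_partial_trig.
apply: L2_leW (L2_le_trig _ _ (sym_range_uniq N)) _; first by rewrite sqrrN expr1n.
apply: ler_wpM2l; first by rewrite ltW// sqrt2pi_gt0.
by apply: l2_le_norm_on => //; exact: sym_range_uniq.
Qed.

Local Notation S f N := (\sum_(m <- sym_range N) f m ^+ 2).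

Lemma dft_partial_diff f N M e : (N <= M)%N -> 0 <= e -> S f M - S f N <= e ^+ 2 ->
  L2_le (fun x => dft_partial f M x - dft_partial f N x) (sqrt2pi * e).
Proof.
move=> NM e0 He.
(* The difference of two partial sums is again a trigonometric polynomial. *)
pose f' m := if (`|m| <= N)%N then 0 else f m.
have -> : (fun x => dft_partial f M x - dft_partial f N x) = trig (-1) (sym_range M) f'.
  apply/funext => x; rewrite !dft_partial_trig /trig -(sum_sym_range_widen _ NM) -sumrB.
  apply: eq_bigr => m _; rewrite /f'; case: ifP => _; last by rewrite subr0.
  by rewrite subrr mul0r.
apply: L2_leW (L2_le_trig _ _ (sym_range_uniq M)) _; first by rewrite sqrrN expr1n.
apply: ler_wpM2l; first by rewrite ltW// sqrt2pi_gt0.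
rewrite -ler_sqr ?nnegrE ?norm_on_ge0// sqr_norm_on.
apply: le_trans He; rewrite -(sum_sym_range_widen _ NM) -sumrB.
rewrite le_eqVlt; apply/orP; left; apply/eqP; apply: eq_bigr => m _.
by rewrite /f'; case: ifP => _; rewrite ?subr0// expr0n subrr.
Qed.

(** Bounded nondecreasing partial sums are Cauchy. *)
Lemma sum_tail_small f c e : l2_le f c -> 0 < e ->
  exists N, forall M, (N <= M)%N -> S f M - S f N <= e.
Proof.
move=> [c0 fc] e0.
have nd : nondecreasing_seq (fun N => S f N).
  move=> N M NM; apply: ler_sum_subseq; rewrite ?sym_range_uniq//.
    by move=> m; rewrite !mem_sym_range => /leq_trans; apply.
  by move=> m; exact: sqr_ge0.
have cv : cvgn (fun N => S f N).
  apply: nondecreasing_is_cvgn nd _; exists (c ^+ 2) => _ [N _ <-].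
  by apply: fc; exact: sym_range_uniq.
have [N _ HN] := (@cvgrPdist_le _ _ _ _ _ _ _).1 cv e e0.
exists N => M NM.
have := HN N (leqnn N); rewrite /= => /(le_trans (ler_norm _)).
by apply: le_trans; rewrite lerD2r; exact: nondecreasing_cvgn_le.
Qed.

Lemma is_dftP f g : is_dft f g <-> in_L2 g /\
  forall e : R, 0 < e -> exists N0, forall N, (N0 <= N)%N ->
    L2_le (fun x => dft_partial f N x - g x) e.
Proof.
split=> -[gL H]; split=> //; have mg := L2_le_meas (L2_le_norm gL).
  move=> e e0; have [F1 F2] := (@fine_cvgP _ _ _ _ _ _).1 H.
  have e20 : 0 < e ^+ 2 by rewrite exprn_gt0.
  have [N1 _ H1] := F1; have [N2 _ H2] := (@cvgrPdist_le _ _ _ _ _ _ _).1 F2 _ e20.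
  exists (maxn N1 N2) => N; rewrite geq_max => /andP[N1N N2N].
  split; [exact: ltW|apply: cmeasurableB => //; exact: cmeasurable_dft_partial|].
  rewrite -[leLHS]fineK; last exact: H1.
  rewrite lee_fin; have := H2 N N2N; rewrite /= sub0r normrN.
  by apply: le_trans; exact: ler_norm.
apply/fine_cvgP; split.
  have [N0 HN] := H 1 ltr01; exists N0 => // N /= /HN [_ _ E].
  rewrite ge0_fin_numE; last exact: sqL2norm_ge0.
  exact: le_lt_trans E (ltry _).
apply/cvgrPdist_le => e e0.
have s0 : 0 < Num.sqrt e by rewrite sqrtr_gt0.
have [N0 HN] := H _ s0; exists N0 => // N /= /HN [_ _ E].
rewrite sub0r normrN ger0_norm; last by apply: fine_ge0; exact: sqL2norm_ge0.
rewrite -lee_fin fineK; last first.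
  rewrite ge0_fin_numE; last exact: sqL2norm_ge0.
  exact: le_lt_trans E (ltry _).
by move: E; rewrite (sqr_sqrtr (ltW e0)).
Qed.

Lemma half_pow_small (A e : R) : 0 <= A -> 0 < e -> exists k, A * 2^-1 ^+ k <= e.
Proof.
move=> A0 e0.
have cv : A * 2^-1 ^+ k @[k --> \oo] --> 0.
  rewrite -[0](mulr0 A); apply: cvgM; first exact: cvg_cst.
  by apply: cvg_expr; rewrite ger0_norm// invf_lt1// ltr1n.
have [N _ HN] := (@cvgrPdist_le _ _ _ _ _ _ _).1 cv e e0.
exists N; have := HN N (leqnn N); rewrite /= sub0r normrN.
by apply: le_trans; exact: ler_norm.
Qed.

(** Along windows N_k whose tails are at most 4^(-k) the partial sums are rapidly Cauchy;
    the tails then control all other partial sums. *)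
Theorem dft_exists f : in_l2 f -> exists g, is_dft f g.
Proof.
move=> /l2_le_norm fc.
have T k : exists N, forall M, (N <= M)%N -> S f M - S f N <= (2^-1 ^+ k) ^+ 2.
  by apply: sum_tail_small fc _; rewrite !exprn_gt0.
have [N0 HN0] := choice T.
(* The windows are made nondecreasing in k by adding up the chosen ones. *)
pose N k := (\sum_(i < k.+1) N0 i)%N.
have N0N k : (N0 k <= N k)%N by rewrite /N big_ord_recr leq_addl.
have NS k : (N k <= N k.+1)%N by rewrite /N [leqRHS]big_ord_recr leq_addr.
have mono k M : (N k <= M)%N -> S f M - S f (N k) <= (2^-1 ^+ k) ^+ 2.
  move=> NM; apply: le_trans (HN0 k M (leq_trans (N0N k) NM)).
  rewrite lerD2l lerN2; apply: ler_sum_subseq; rewrite ?sym_range_uniq//.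
    by move=> m; rewrite !mem_sym_range => /leq_trans; apply.
  by move=> m; exact: sqr_ge0.
have D k M : (N k <= M)%N ->
    L2_le (fun x => dft_partial f M x - dft_partial f (N k) x) (sqrt2pi * 2^-1 ^+ k).
  by move=> NM; apply: dft_partial_diff => //; exact: mono.
have [h Hh] := @L2_complete R (fun k => dft_partial f (N k)) sqrt2pi
  (fun k => cmeasurable_dft_partial _ _) (fun k => D k _ (NS k)).
exists h; apply/is_dftP; split.
  have := L2_leD (Hh 0%N) (L2_le_dft_partial (N 0%N) fc).
  by under eq_fun do rewrite subrK; exact: L2_le_in.
have p0 := ltW (sqrt2pi_gt0 R).
move=> e e0; have [k Hk] := half_pow_small (mulr_ge0 (ler0n R 3) p0) e0.
exists (N k) => M NM.
have := L2_leD (D k M NM) (L2_leN (Hh k)).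
under eq_fun do rewrite opprB addrA subrK.
by move/L2_leW; apply; apply: le_trans Hk; lra.
Qed.

Lemma dftP f : in_l2 f -> is_dft f (dft f).
Proof. by move=> /dft_exists fg; exact: (@xgetPex _ (fun=> 0) _ fg). Qed.

Lemma L2_le_addgt0 g c : 0 <= c -> cmeasurable g ->
  (forall e, 0 < e -> L2_le g (c + e)) -> L2_le g c.
Proof.
move=> c0 mg H; split=> //; apply/lee_addgt0Pr => e e0.
pose d := Num.min 1 (e / (2 * c + 1)).
have s0 : 0 < 2 * c + 1 by rewrite ltr_wpDl// mulr_ge0.
have d0 : 0 < d by rewrite lt_min ltr01 divr_gt0.
have d1 : d <= 1 by rewrite ge_min lexx.
have de : d * (2 * c + 1) <= e by rewrite -ler_pdivlMr// ge_min lexx orbT.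
have [_ _ Hd] := H d d0; apply: le_trans Hd _.
rewrite -EFinD lee_fin; nra.
Qed.

(** The easy half of Plancherel's identity. *)
Lemma is_dft_L2_le f g c : is_dft f g -> l2_le f c -> L2_le g (sqrt2pi * c).
Proof.
move=> /is_dftP[gL H] fc; apply: L2_le_addgt0.
- by rewrite mulr_ge0 ?(l2_le_ge0 fc)// ltW// sqrt2pi_gt0.
- exact: L2_le_meas (L2_le_norm gL).
move=> e e0; have [N HN] := H e e0.
have := L2_leB (L2_le_dft_partial N fc) (HN N (leqnn N)).
by under eq_fun do rewrite opprB addrC subrK.
Qed.

Lemma is_dft_unique f g h : is_dft f g -> is_dft f h -> L2_le (fun x => g x - h x) 0.
Proof.
move=> /is_dftP[gL G] /is_dftP[hL H]; apply: L2_le_addgt0 => //.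
  by apply: cmeasurableB; [exact: L2_le_meas (L2_le_norm gL)|exact: L2_le_meas (L2_le_norm hL)].
move=> e e0; have e20 : 0 < e / 2 by rewrite divr_gt0.
have [N HN] := G _ e20; have [M HM] := H _ e20.
have := L2_leB (HM _ (leq_maxr N M)) (HN _ (leq_maxl N M)).
rewrite add0r -splitr.
suff -> : (fun x => dft_partial f (maxn N M) x - h x - (dft_partial f (maxn N M) x - g x))
  = (fun x => g x - h x) by [].
by apply/funext => x; ring.
Qed.

Lemma is_dft_lin f f' g g' (a b : R) : is_dft f g -> is_dft f' g' ->
  is_dft (fun n => a * f n + b * f' n) (fun x => a%:C * g x + b%:C * g' x).
Proof.
move=> /is_dftP[gL G] /is_dftP[gL' G']; apply/is_dftP; split.
  apply: (@L2_le_in _ _ (normc a%:C * L2norm g + normc b%:C * L2norm g')).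
  by apply: L2_leD; apply: L2_leZ; exact: L2_le_norm.
move=> e e0; pose d := e / (`|a| + `|b| + 1).
have s0 : 0 < `|a| + `|b| + 1 by rewrite ltr_wpDl// addr_ge0.
have d0 : 0 < d by rewrite divr_gt0.
have [N HN] := G _ d0; have [M HM] := G' _ d0.
exists (maxn N M) => K; rewrite geq_max => /andP[NK MK].
have := L2_leD (L2_leZ a%:C (HN _ NK)) (L2_leZ b%:C (HM _ MK)).
rewrite !normc_real.
suff -> : (fun x => a%:C * (dft_partial f K x - g x) + b%:C * (dft_partial f' K x - g' x))
  = (fun x => dft_partial (fun n => a * f n + b * f' n) K x - (a%:C * g x + b%:C * g' x)).
  move/L2_leW; apply.
  have : d * (`|a| + `|b| + 1) = e by rewrite /d divfK// gt_eqF.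
  by move=> <-; nra.
apply/funext => x.
have -> : dft_partial (fun n => a * f n + b * f' n) K x =
    a%:C * dft_partial f K x + b%:C * dft_partial f' K x.
  rewrite /dft_partial !mulr_sumr -big_split/=; apply: eq_bigr => k _.
  by rewrite rmorphD !rmorphM; ring.
by ring.
Qed.

Lemma L2_le_small_single (z : R) (n : int) :
  L2_le (fun x => z%:C * expi (x * n%:~R)) (sqrt2pi * `|z|).
Proof.
by rewrite mulrC -normc_real; apply: L2_leZ; exact: L2_le_expi.
Qed.

Lemma l2_le_vanish f c e : l2_le f c -> 0 < e ->
  exists N, forall n, (N <= `|n|)%N -> `|f n| <= e.
Proof.
move=> fc e0; have e20 : 0 < e ^+ 2 by rewrite exprn_gt0.
have [N HN] := sum_tail_small fc e20.
exists N.+1 => n Nn.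
rewrite -ler_sqr ?nnegrE ?(ltW e0)// real_normK ?num_real//.
have NM : (N <= `|n|)%N by apply: leq_trans Nn.
apply: le_trans (HN _ NM).
rewrite -(sum_sym_range_widen _ NM) -sumrB.
apply: le_trans (_ : \sum_(m <- [:: n]) (f m ^+ 2 - (if (`|m| <= N)%N then f m ^+ 2 else 0)) <= _).
  by rewrite big_seq1 leqNgt Nn subr0.
apply: ler_sum_subseq; rewrite ?sym_range_uniq//.
  by move=> m; rewrite inE => /eqP->; rewrite mem_sym_range.
by move=> m; case: ifP; rewrite ?subrr ?subr0 ?sqr_ge0.
Qed.

Lemma expi0 : expi 0 = 1 :> R[i].
Proof. by rewrite /expi cos0 sin0. Qed.

Lemma expiN_mul (x : R) : expi x * expi (- x) = 1.
Proof. by rewrite -expiD subrr expi0. Qed.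

Lemma dft_partial_shift f N x :
  dft_partial (fun n => f (n + 1)) N x =
  expi x * (dft_partial f N x
    + ((f (N%:Z + 1))%:C * expi (x * (- (N%:Z + 1))%:~R)
       - (f (- N%:Z))%:C * expi (x * (N%:Z)%:~R))).
Proof.
pose u (k : nat) := (f (k%:Z - N%:Z))%:C * expi (- (x * (k%:Z - N%:Z)%:~R)).
have -> : dft_partial f N x = \sum_(k < N.*2.+1) u k by [].
have -> : dft_partial (fun n => f (n + 1)) N x = expi x * \sum_(k < N.*2.+1) u k.+1.
  rewrite /dft_partial mulr_sumr; apply: eq_bigr => k _; rewrite /u mulrCA; congr (_ * _).
    by congr ((f _)%:C); lia.
  have -> : k.+1%:Z - N%:Z = (k%:Z - N%:Z) + 1 by lia.
  by rewrite -expiD; congr expi; rewrite intrD; ring.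
have -> : (f (N%:Z + 1))%:C * expi (x * (- (N%:Z + 1))%:~R) = u N.*2.+1.
  rewrite /u; congr (_%:C * expi _); first by congr f; lia.
  have -> : (N.*2.+1)%:Z - N%:Z = N%:Z + 1 by lia.
  by rewrite mulrNz mulrN.
have -> : (f (- N%:Z))%:C * expi (x * (N%:Z)%:~R) = u 0%N.
  by rewrite /u sub0r mulrNz mulrN opprK.
congr (_ * _).
have : \sum_(k < N.*2.+2) u k = \sum_(k < N.*2.+1) u k + u N.*2.+1 by rewrite big_ord_recr.
rewrite big_ord_recl /= => E.
by apply: (addrI (u 0%N)); rewrite E; ring.
Qed.

Lemma cmeasurable_expi1 : cmeasurable (fun x : R => expi x).
Proof.
have := @cmeasurable_expi R 1; suff -> : (fun x : R => expi (x * 1)) = (fun x => expi x) by [].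
by apply/funext => x; rewrite mulr1.
Qed.

Lemma cmeasurable_expiN1 : cmeasurable (fun x : R => expi (- x)).
Proof.
have := @cmeasurable_expi R (-1); suff -> : (fun x : R => expi (x * -1)) = (fun x => expi (- x)) by [].
by apply/funext => x; rewrite mulrN1.
Qed.

(** Shifting the sequence multiplies the partial sums by a phase up to two boundary
    terms, which tend to 0 because f does. *)
Lemma is_dft_shift f g c : l2_le f c -> is_dft f g ->
  is_dft (fun n => f (n + 1)) (fun x => expi x * g x).
Proof.
move=> fc /is_dftP[gL G]; apply/is_dftP.
have Be h d : L2_le h d -> L2_le (fun x => expi x * h x) d.
  move=> Hh; rewrite -[d]mul1r; apply: L2_le_bounded => //; first exact: cmeasurable_expi1.
  by move=> x _ _; rewrite normc_expi.
split; first exact: (L2_le_in (Be _ _ (L2_le_norm gL))).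
move=> e e0.
(* One d for the partial sum, and sqrt2pi * d for each boundary term. *)
pose d := e / (1 + 2 * sqrt2pi).
have s0 : 0 < 1 + 2 * sqrt2pi by rewrite ltr_wpDr// mulr_ge0// ltW// sqrt2pi_gt0.
have d0 : 0 < d by rewrite divr_gt0.
have [N HN] := G _ d0; have [M HM] := l2_le_vanish fc d0.
exists (maxn N M) => K; rewrite geq_max => /andP[NK MK].
have H1 := L2_le_small_single (f (K%:Z + 1)) (- (K%:Z + 1)).
have H2 := L2_le_small_single (f (- K%:Z)) K%:Z.
have -> : (fun x => dft_partial (fun n => f (n + 1)) K x - expi x * g x) =
  (fun x => expi x * ((dft_partial f K x - g x)
    + ((f (K%:Z + 1))%:C * expi (x * (- (K%:Z + 1))%:~R)
       - (f (- K%:Z))%:C * expi (x * (K%:Z)%:~R)))).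
  by apply/funext => x; rewrite dft_partial_shift; ring.
apply: L2_leW (Be _ _ (L2_leD (HN K NK) (L2_leB H1 H2))) _.
have f1 : `|f (K%:Z + 1)| <= d by apply: HM; lia.
have f2 : `|f (- K%:Z)| <= d by apply: HM; lia.
have : d * (1 + 2 * sqrt2pi) = e by rewrite /d divfK// gt_eqF.
by move=> <-; have := sqrt2pi_gt0 R; nra.
Qed.

Lemma coef_null g n : L2_le g 0 -> coef g n = 0.
Proof.
move=> /bessel/(l2_le_coord n); rewrite mulr0 normr_le0 => /eqP.
exact.
Qed.

(** Fourier coefficients do not see functions of norm 0, so the representative chosen by
    [dft] is irrelevant. *)
Lemma coef_congr g h c d : L2_le g c -> L2_le h d -> L2_le (fun x => g x - h x) 0 ->
  coef g = coef h.
Proof.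
move=> Hg Hh gh; apply/funext => n; apply/eqP; rewrite -subr_eq0.
by rewrite -(coefB n Hg Hh) coef_null.
Qed.

Lemma coef_dft_partial f N n : (`|n| <= N)%N -> coef (dft_partial f N) n = f n.
Proof.
move=> nN; rewrite /coef.
pose u x := \sum_(m <- sym_range N) f m * cos (x * (n - m)%:~R).
pose U x := \sum_(m <- sym_range N) f m * cos_primitive (n - m) x.
have E x : Re (dft_partial f N x * expi (x * n%:~R)) = u x.
  rewrite cReM dft_partial_trig Re_trig Im_trig /u !mulr_suml -sumrB.
  apply: eq_bigr => m _; rewrite -!mulrA -mulrBr; congr (_ * _) => /=.
  by rewrite -cosD; congr cos; rewrite intrB; ring.
rewrite (_ : \int[leb]_(x in torus) _ = U pi - U (- pi)).
  rewrite /U -sumrB (eq_bigr (fun m => if n - m == 0 then f m * (2 * pi) else 0)).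
    rewrite (sum_uniq_pick (fun m => f m * (2 * pi)) (sym_range_uniq N)).
      by rewrite mulrC mulfK// mulf_neq0 ?pnatr_eq0// gt_eqF// pi_gt0.
    by rewrite mem_sym_range.
  by move=> m _; rewrite -mulrBr cos_primitive_diff; case: ifP => _; rewrite ?mulr0.
have -> : \int[leb]_(x in torus) Re (dft_partial f N x * expi (x * n%:~R)) =
    \int[leb]_(x in torus) u x by apply: eq_Rintegral => x _; exact: E.
have cu : continuous u.
  apply: continuous_sum => m x; apply: cvgM; first exact: cvg_cst.
  exact: continuous_cosM.
have dU (x : R) : is_derive x 1 U (u x).
  by apply: is_derive_sum_lin => m; exact: is_derive_cos_primitive.
by rewrite /Rintegral (integral_torus_FTC cu dU).
Qed.

(** Fourier inversion: a partial sum has the right coefficients, and coefficients are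
    continuous by Bessel's inequality. *)
Lemma coef_dft f g : is_dft f g -> coef g = f.
Proof.
move=> /is_dftP[gL H]; apply/funext => n; apply/eqP; rewrite -subr_eq0 -normr_le0.
apply/ler_addgt0Pr => e e0; rewrite add0r.
have d0 : 0 < sqrt2pi * e by rewrite mulr_gt0// sqrt2pi_gt0.
have [N HN] := H _ d0; pose M := maxn N `|n|.
have HM := HN M (leq_maxl _ _).
have [c0 mD _] := HM.
have gn := L2_le_norm gL.
have HD : L2_le (dft_partial f M) (sqrt2pi * e + L2norm g).
  by have := L2_leD HM gn; under eq_fun do rewrite subrK.
rewrite -(@coef_dft_partial f M n) ?leq_maxr// distrC -(coefB n HD gn).
have := l2_le_coord n (bessel HM).
by rewrite mulKf// gt_eqF// sqrt2pi_gt0.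
Qed.

End FourierTransform.

(** * Fourier multipliers with bounded symbol *)

Section Multipliers.
Local Open Scope complex_scope.
Variable R : realType.
Local Notation leb := (@lebesgue_measure R).
Local Notation Re := complex.Re.
Local Notation Im := complex.Im.
Local Notation torus := (@torus R).
Local Notation normc := (@Normc.normc R).
Local Notation sqrt2pi := (sqrt2pi R).
Implicit Types (f : int -> R) (m : R -> R) (B C c : R).

(** Bounded away from x = 0, where the inverse symbols take a conventional value. *)
Definition bounded_symbol m B := [/\ 0 <= B, measurable_fun torus m
  & forall x, torus x -> x != 0 -> `|m x| <= B].

Lemma bounded_symbol_cmeasurable m B : bounded_symbol m B -> cmeasurable (fun x => (m x)%:C).
Proof. by case=> _ mm _; exact: cmeasurable_real. Qed.

Lemma bounded_symbol_mul m B (g : R -> R[i]) c : bounded_symbol m B -> L2_le g c ->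
  L2_le (fun x => (m x)%:C * g x) (B * c).
Proof.
move=> Hm Hg; have [B0 mm mB] := Hm.
apply: (L2_le_bounded B0 (bounded_symbol_cmeasurable Hm) Hg) => x tx x0.
by rewrite normc_real mB.
Qed.

Lemma bounded_symbol_lin m1 m2 B1 B2 (a b : R) : bounded_symbol m1 B1 -> bounded_symbol m2 B2 ->
  bounded_symbol (fun x => a * m1 x + b * m2 x) (`|a| * B1 + `|b| * B2).
Proof.
move=> [B10 mm1 H1] [B20 mm2 H2]; split.
- by rewrite addr_ge0// mulr_ge0.
- by apply: measurable_funD; apply: measurable_funM => //; exact: measurable_cst.
- move=> x tx x0; apply: le_trans (ler_normD _ _) _; rewrite !normrM.
  by apply: lerD; apply: ler_wpM2l => //; [exact: H1|exact: H2].
Qed.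

Lemma dft_L2_le f c : l2_le f c -> L2_le (dft f) (sqrt2pi * c).
Proof. by move=> fc; exact: (is_dft_L2_le (dftP (l2_le_in fc)) fc). Qed.

(** Plancherel for the transform, then Bessel for the coefficients. *)
Lemma multiplier_bound m B f c : bounded_symbol m B -> l2_le f c -> l2_le (multiplier m f) (B * c).
Proof.
move=> Hm fc; rewrite multiplierE.
apply: l2_leW (bessel (bounded_symbol_mul Hm (dft_L2_le fc))) _.
by rewrite mulrCA mulKf// gt_eqF// sqrt2pi_gt0.
Qed.

Lemma multiplier_coord m B f c n : bounded_symbol m B -> l2_le f c -> `|multiplier m f n| <= B * c.
Proof. by move=> Hm fc; exact: l2_le_coord (multiplier_bound Hm fc). Qed.

Lemma multiplier_linl m1 m2 B1 B2 (a b : R) f c n : bounded_symbol m1 B1 -> bounded_symbol m2 B2 -> l2_le f c ->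
  multiplier (fun x => a * m1 x + b * m2 x) f n =
  a * multiplier m1 f n + b * multiplier m2 f n.
Proof.
move=> H1 H2 /dft_L2_le fc; rewrite !multiplierE.
have F1 := bounded_symbol_mul H1 fc; have F2 := bounded_symbol_mul H2 fc.
rewrite -(coefZ a n F1) -(coefZ b n F2) -(coefD n (L2_leZ a%:C F1) (L2_leZ b%:C F2)).
apply: (congr1 (fun g => coef g n)); apply/funext => x.
by rewrite rmorphD !rmorphM; ring.
Qed.

Lemma is_dft_congr f (g h : R -> R[i]) : is_dft f g -> L2_le (fun x => g x - h x) 0 -> is_dft f h.
Proof.
move=> /is_dftP[gL G] gh; apply/is_dftP; split.
  have := L2_leB (L2_le_norm gL) gh.
  by under eq_fun do rewrite opprB addrC subrK; exact: L2_le_in.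
move=> e /G[N HN]; exists N => M /HN H.
have := L2_leD H gh; rewrite addr0.
by under eq_fun do rewrite addrA subrK.
Qed.

Lemma multiplier_is_dft m B f g c d : bounded_symbol m B -> l2_le f c -> is_dft f g -> L2_le g d ->
  multiplier m f = coef (fun x => (m x)%:C * g x).
Proof.
move=> Hm fc fg gd; rewrite multiplierE.
apply: (coef_congr (bounded_symbol_mul Hm (dft_L2_le fc)) (bounded_symbol_mul Hm gd)).
have := bounded_symbol_mul Hm (is_dft_unique (dftP (l2_le_in fc)) fg); rewrite mulr0.
by under eq_fun do rewrite mulrBr.
Qed.

Lemma multiplier_linr m B (a b : R) f f' c c' n : bounded_symbol m B -> l2_le f c -> l2_le f' c' ->
  multiplier m (fun k => a * f k + b * f' k) n =
  a * multiplier m f n + b * multiplier m f' n.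
Proof.
move=> Hm fc fc'; have F := dft_L2_le fc; have F' := dft_L2_le fc'.
have fl : l2_le (fun k => a * f k + b * f' k) (`|a| * c + `|b| * c').
  by apply: l2_leD; exact: l2_leZ.
rewrite (multiplier_is_dft Hm fl (is_dft_lin a b (dftP (l2_le_in fc)) (dftP (l2_le_in fc')))
  (L2_leD (L2_leZ a%:C F) (L2_leZ b%:C F'))).
have F1 := bounded_symbol_mul Hm F; have F2 := bounded_symbol_mul Hm F'.
rewrite !multiplierE -(coefZ a n F1) -(coefZ b n F2) -(coefD n (L2_leZ a%:C F1) (L2_leZ b%:C F2)).
apply: (congr1 (fun g => coef g n)); apply/funext => x.
move: (m x)%:C a%:C b%:C (dft f x) (dft f' x) => u v w y z.
by ring.
Qed.

Lemma multiplierPl m1 m2 B1 B2 (b : R) f c n : bounded_symbol m1 B1 -> bounded_symbol m2 B2 -> l2_le f c ->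
  multiplier (fun x => m1 x + b * m2 x) f n =
  multiplier m1 f n + b * multiplier m2 f n.
Proof.
move=> H1 H2 fc; have E := multiplier_linl 1 b n H1 H2 fc.
rewrite -[X in _ = X + _](mul1r (multiplier m1 f n)) -E.
by apply: (congr1 (fun m => multiplier m f n)); apply/funext => x; rewrite mul1r.
Qed.

Lemma multiplierPr m B (b : R) f f' c c' n : bounded_symbol m B -> l2_le f c -> l2_le f' c' ->
  multiplier m (fun k => f k + b * f' k) n =
  multiplier m f n + b * multiplier m f' n.
Proof.
move=> Hm fc fc'; have E := multiplier_linr 1 b n Hm fc fc'.
rewrite -[X in _ = X + _](mul1r (multiplier m f n)) -E.
by apply: (congr1 (fun g => multiplier m g n)); apply/funext => x; rewrite mul1r.
Qed.

Lemma multiplierDl m1 m2 B1 B2 f c n : bounded_symbol m1 B1 -> bounded_symbol m2 B2 -> l2_le f c ->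
  multiplier (fun x => m1 x + m2 x) f n = multiplier m1 f n + multiplier m2 f n.
Proof.
move=> H1 H2 fc; have E := multiplierPl 1 n H1 H2 fc.
rewrite -[X in _ = _ + X](mul1r (multiplier m2 f n)) -E.
by apply: (congr1 (fun m => multiplier m f n)); apply/funext => x; rewrite mul1r.
Qed.

Lemma multiplierDr m B f f' c c' n : bounded_symbol m B -> l2_le f c -> l2_le f' c' ->
  multiplier m (fun k => f k + f' k) n = multiplier m f n + multiplier m f' n.
Proof.
move=> Hm fc fc'; have E := multiplierPr 1 n Hm fc fc'.
rewrite -[X in _ = _ + X](mul1r (multiplier m f' n)) -E.
by apply: (congr1 (fun g => multiplier m g n)); apply/funext => x; rewrite mul1r.
Qed.

Lemma bounded_symbolPl m1 m2 B1 B2 (b : R) : bounded_symbol m1 B1 -> bounded_symbol m2 B2 ->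
  bounded_symbol (fun x => m1 x + b * m2 x) (B1 + `|b| * B2).
Proof.
move=> H1 H2; have := bounded_symbol_lin 1 b H1 H2; rewrite normr1 mul1r.
by under eq_fun do rewrite mul1r.
Qed.

Lemma l2_lePl f f' c c' (b : R) : l2_le f c -> l2_le f' c' ->
  l2_le (fun k => f k + b * f' k) (c + `|b| * c').
Proof. by move=> fc fc'; apply: l2_leD => //; exact: l2_leZ. Qed.

Definition neg_lap f (n : int) : R := 2 * f n - f (n + 1) - f (n - 1).

Lemma absgrad_ge0 (x : R) : 0 <= absgrad x.
Proof. by rewrite /absgrad mulr_ge0. Qed.

Lemma absgrad_le2 (x : R) : absgrad x <= 2.
Proof. by rewrite /absgrad -[leRHS]mulr1 ler_wpM2l// sin_max. Qed.

Lemma sqr_absgrad (x : R) : absgrad x ^+ 2 = 2 - 2 * cos x.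
Proof.
rewrite /absgrad exprMn real_normK ?num_real//.
have {2}-> : x = x / 2 *+ 2 by rewrite -mulr_natr divfK.
by rewrite cos_mulr2n cos2sin2; ring.
Qed.

Lemma is_dft_shiftN f g c : l2_le f c -> is_dft f g ->
  is_dft (fun n => f (n - 1)) (fun x => expi (- x) * g x).
Proof.
move=> fc fg; have fc' : l2_le (fun n => f (n - 1)) c by exact: (l2_le_comp fc (@addz_inj (-1))).
have D := dftP (l2_le_in fc').
have := is_dft_shift fc' D; under eq_fun do rewrite addrK.
move=> D'; have U := is_dft_unique D' fg.
apply: is_dft_congr D _.
have := L2_le_null_mul (@cmeasurable_expiN1 R) U.
suff -> : (fun x => expi (- x) * (expi x * dft (fun n => f (n - 1)) x - g x)) =
  (fun x => dft (fun n => f (n - 1)) x - expi (- x) * g x) by [].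
by apply/funext => x; rewrite mulrBr mulrA [expi (- x) * expi x]mulrC expiN_mul mul1r.
Qed.

Lemma is_dft_neg_lap f g c : l2_le f c -> is_dft f g ->
  is_dft (neg_lap f) (fun x => (absgrad x ^+ 2)%:C * g x).
Proof.
move=> fc fg.
have D1 := is_dft_shift fc fg; have D2 := is_dft_shiftN fc fg.
have D3 := is_dft_lin 1 (-1) (is_dft_lin 2 (-1) fg D1) D2.
have -> : neg_lap f = (fun n => 1 * (2 * f n + -1 * f (n + 1)) + -1 * f (n - 1)).
  by apply/funext => n; rewrite /neg_lap; ring.
suff -> : (fun x => (absgrad x ^+ 2)%:C * g x) =
   (fun x => 1%:C * (2%:C * g x + (-1)%:C * (expi x * g x)) + (-1)%:C * (expi (- x) * g x)) by [].
apply/funext => x; rewrite rmorphN1 !mulN1r mul1r.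
have -> : 2%:C * g x - expi x * g x - expi (- x) * g x =
  (2%:C - expi x - expi (- x)) * g x by ring.
congr (_ * _); rewrite sqr_absgrad; apply/eqP; rewrite eq_complex/= cosN sinN.
by apply/andP; split; apply/eqP; ring.
Qed.

Lemma neg_lap_l2_le f c : l2_le f c -> l2_le (neg_lap f) (4 * c).
Proof.
move=> fc; have f1 : l2_le (fun n => f (n + 1)) c := l2_le_comp fc (@addz_inj 1).
have f2 : l2_le (fun n => f (n - 1)) c := l2_le_comp fc (@addz_inj (-1)).
apply: l2_leW (l2_leB (l2_leB (l2_leZ 2 fc) f1) f2) _.
by rewrite ger0_norm//; lra.
Qed.

Lemma continuous_absgrad : continuous (@absgrad R).
Proof.
move=> x; apply: cvgM; first exact: cvg_cst.
apply: (@continuous_comp _ _ _ (fun x : R => sin (x / 2)) Num.norm).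
  exact: continuous_sinM.
exact: norm_continuous.
Qed.

Lemma measurable_absgrad : measurable_fun torus (@absgrad R).
Proof. by apply: measurable_continuous; exact: continuous_absgrad. Qed.

Lemma sqr_absgrad_bounded_symbol : bounded_symbol (fun x => absgrad x ^+ 2) 4.
Proof.
split=> //; first by apply: measurable_funX; exact: measurable_absgrad.
move=> x _ _; rewrite ger0_norm ?sqr_ge0//.
by have := absgrad_ge0 x; have := absgrad_le2 x; nra.
Qed.

(** The square of the symbol of |grad| is the trigonometric polynomial 2 - 2 cos x, that
    is, a finite difference. *)
Lemma multiplier_neg_lap m B f c : bounded_symbol m B -> l2_le f c ->
  multiplier (fun x => m x * absgrad x ^+ 2) f = multiplier m (neg_lap f).
Proof.
move=> Hm fc; have D := dftP (l2_le_in fc).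
rewrite (multiplier_is_dft Hm (neg_lap_l2_le fc) (is_dft_neg_lap fc D)
  (bounded_symbol_mul sqr_absgrad_bounded_symbol (dft_L2_le fc))).
rewrite multiplierE; apply: (congr1 (fun g => coef g)); apply/funext => x.
by rewrite rmorphM mulrA.
Qed.

End Multipliers.

(** * The wave propagators and their time derivatives *)

Section Propagators.
Local Open Scope complex_scope.
Variable R : realType.
Local Notation torus := (@torus R).
Implicit Types (f : int -> R) (m : R -> R) (B C c s t h : R).

Lemma increment_norm_le (f df : R -> R) t D :
  (forall x : R, is_derive x 1 f (df x)) ->
  (forall x, `|x| <= `|t| -> `|df x| <= D) -> `|f t - f 0| <= D * `|t|.
Proof.
move=> fd fD; rewrite ler_norml lerNl opprB (increment_le fd fD) andbT.
have := @increment_le R (fun x => - f x) (fun x => - df x) t D.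
rewrite opprK addrC; by apply => x xt; rewrite normrN fD.
Qed.

Lemma is_derive_sin_add (u x : R) : is_derive x 1 (fun v => sin (u + v)) (cos (u + x)).
Proof. by apply: (@is_derive_shift_arg R sin). Qed.

Lemma is_derive_cos_add (u x : R) : is_derive x 1 (fun v => cos (u + v)) (- sin (u + x)).
Proof. by apply: (@is_derive_shift_arg R cos). Qed.

Lemma sin_lip (u v : R) : `|sin (u + v) - sin u| <= `|v|.
Proof.
have := @increment_norm_le (fun v => sin (u + v)) (fun v => cos (u + v)) v 1.
rewrite addr0 mul1r; apply => [x|x _]; first exact: is_derive_sin_add.
exact: cos_max.
Qed.

Lemma cos_lip (u v : R) : `|cos (u + v) - cos u| <= `|v|.
Proof.
have := @increment_norm_le (fun v => cos (u + v)) (fun v => - sin (u + v)) v 1.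
rewrite addr0 mul1r; apply => [x|x _]; first exact: is_derive_cos_add.
by rewrite normrN sin_max.
Qed.

Lemma sin_taylor (u v : R) : `|sin (u + v) - sin u - v * cos u| <= v ^+ 2.
Proof.
have -> : sin (u + v) - sin u - v * cos u =
  (sin (u + v) - v * cos u) - (sin (u + 0) - 0 * cos u) by rewrite addr0; ring.
rewrite -(real_normK (num_real v)) expr2.
apply: (@increment_norm_le (fun v => sin (u + v) - v * cos u)
  (fun v => cos (u + v) - cos u)) => [x|x xv].
  by apply: is_deriveB; first [exact: is_derive_sin_add|exact: is_derive_mulrl].
exact: le_trans (cos_lip _ _) xv.
Qed.

Lemma cos_taylor (u v : R) : `|cos (u + v) - cos u + v * sin u| <= v ^+ 2.
Proof.
have -> : cos (u + v) - cos u + v * sin u =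
  (cos (u + v) - v * (- sin u)) - (cos (u + 0) - 0 * (- sin u)) by rewrite addr0; ring.
rewrite -(real_normK (num_real v)) expr2.
apply: (@increment_norm_le (fun v => cos (u + v) - v * (- sin u))
  (fun v => - sin (u + v) - (- sin u))) => [x|x xv].
  by apply: is_deriveB; first [exact: is_derive_cos_add|exact: is_derive_mulrl].
by rewrite -opprB normrN opprK addrC; exact: le_trans (sin_lip _ _) xv.
Qed.

(** The symbols of cos (t |grad|), sin (t |grad|) / |grad| and sin (t |grad|) |grad|. *)
Definition symC t x : R := cos (t * absgrad x).
Definition symS t x : R := sin (t * absgrad x) / absgrad x.
Definition symK t x : R := sin (t * absgrad x) * absgrad x.

Lemma measurable_trig_absgrad (u : R -> R) t : continuous u ->
  measurable_fun torus (fun x => u (t * absgrad x)).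
Proof.
move=> cu; apply: measurable_continuous => x.
apply: (@continuous_comp _ _ _ (fun x : R => t * absgrad x) u); last exact: cu.
by apply: cvgM; [exact: cvg_cst|exact: continuous_absgrad].
Qed.

Lemma absgrad_gt0 (x : R) : torus x -> x != 0 -> 0 < absgrad x.
Proof.
rewrite /Defs.torus /= in_itv/= => /andP[x1 x2] x0.
rewrite /absgrad mulr_gt0// normr_gt0.
have [xp|xn] := ltP 0 x.
  rewrite gt_eqF// sin_gt0_pi// divr_gt0//= ltr_pdivrMr//.
  by apply: lt_le_trans x2 _; rewrite ler_peMr ?pi_ge0// ler1n.
have {xn x0}xn : x < 0 by rewrite lt_neqAle x0.
rewrite -oppr_eq0 -sinN gt_eqF// sin_gt0_pi//; apply/andP; split; first lra.
by have := pi_gt0 R; move: x1; lra.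
Qed.

Lemma measurable_absgrad_inv : measurable_fun torus (@absgrad_inv R).
Proof.
have -> : @absgrad_inv R = (fun x => absgrad x `^ (-1)).
  by apply/funext => x; rewrite powR_inv1// absgrad_ge0.
apply: (@measurableT_comp _ _ _ _ _ _ (fun a => a `^ (-1)) _ (@absgrad R)).
  exact: measurable_powR.
exact: measurable_absgrad.
Qed.

Lemma symC_bounded_symbol t : bounded_symbol (symC t) 1.
Proof.
split=> //; first by apply: measurable_trig_absgrad; exact: continuous_cos.
by move=> x _ _; exact: cos_max.
Qed.

Lemma symS_meas t : measurable_fun torus (symS t).
Proof.
apply: measurable_funM; last exact: measurable_absgrad_inv.
by apply: measurable_trig_absgrad; exact: continuous_sin.
Qed.

Lemma symK_meas t : measurable_fun torus (symK t).
Proof.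
apply: measurable_funM; last exact: measurable_absgrad.
by apply: measurable_trig_absgrad; exact: continuous_sin.
Qed.

Lemma symS_bounded_symbol t : bounded_symbol (symS t) `|t|.
Proof.
split=> //; first exact: symS_meas.
move=> x tx x0; have a0 := absgrad_gt0 tx x0.
rewrite /symS normrM normfV (gtr0_norm a0) ler_pdivrMr//.
have := sin_lip 0 (t * absgrad x).
by rewrite add0r sin0 subr0 normrM (gtr0_norm a0).
Qed.

Lemma symK_bounded_symbol t : bounded_symbol (symK t) 2.
Proof.
split=> //; first exact: symK_meas.
move=> x _ _; rewrite normrM (ger0_norm (absgrad_ge0 x)).
have := absgrad_ge0 x; have := absgrad_le2 x; have := sin_max (t * absgrad x).
by have := normr_ge0 (sin (t * absgrad x)); nra.
Qed.

(** The symbol of |grad| is at most 2, so the Taylor remainders of the propagators in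
    time are O (h^2) uniformly in frequency, hence in operator norm. *)
Lemma symC_taylor s h :
  bounded_symbol (fun x => symC (s + h) x - symC s x - h * (- symK s x)) (4 * h ^+ 2).
Proof.
split; first by rewrite mulr_ge0 ?sqr_ge0.
  apply: measurable_funB.
    by apply: measurable_funB; [have [] := symC_bounded_symbol (s + h)|have [] := symC_bounded_symbol s].
  apply: measurable_funM; first exact: measurable_cst.
  by apply: measurableT_comp => //; exact: symK_meas.
move=> x _ _; 
have -> : symC (s + h) x - symC s x - h * (- symK s x) =
    cos (s * absgrad x + h * absgrad x) - cos (s * absgrad x)
    + h * absgrad x * sin (s * absgrad x).
  by rewrite /symC /symK mulrDl; ring.
apply: le_trans (cos_taylor _ _) _; rewrite exprMn mulrC ler_wpM2r ?sqr_ge0//.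
by have := absgrad_ge0 x; have := absgrad_le2 x; nra.
Qed.

Lemma symS_taylor s h :
  bounded_symbol (fun x => symS (s + h) x - symS s x - h * symC s x) (4 * h ^+ 2).
Proof.
split; first by rewrite mulr_ge0 ?sqr_ge0.
  apply: measurable_funB; first by apply: measurable_funB; exact: symS_meas.
  by apply: measurable_funM; [exact: measurable_cst|have [] := symC_bounded_symbol s].
move=> x tx x0; have a0 := absgrad_gt0 tx x0.
have -> : symS (s + h) x - symS s x - h * symC s x =
  (sin (s * absgrad x + h * absgrad x) - sin (s * absgrad x)
    - h * absgrad x * cos (s * absgrad x)) / absgrad x.
  by rewrite /symS /symC mulrDl; field; rewrite gt_eqF.
rewrite normrM normfV (gtr0_norm a0) ler_pdivrMr//.
apply: le_trans (sin_taylor _ _) _; rewrite exprMn.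
have := absgrad_le2 x; move: a0; move: (absgrad x) => a a0 a2.
have : 0 <= h ^+ 2 * (a * (4 - a)) by rewrite mulr_ge0 ?sqr_ge0// mulr_ge0// ?ltW//; lra.
by lra.
Qed.

Lemma symK_lip s h : bounded_symbol (fun x => symK (s + h) x - symK s x) (4 * `|h|).
Proof.
split; first by rewrite mulr_ge0.
  by apply: measurable_funB; exact: symK_meas.
move=> x _ _.
have -> : symK (s + h) x - symK s x =
    (sin (s * absgrad x + h * absgrad x) - sin (s * absgrad x)) * absgrad x.
  by rewrite /symK mulrDl; ring.
rewrite normrM (ger0_norm (absgrad_ge0 x)).
have := sin_lip (s * absgrad x) (h * absgrad x).
rewrite normrM (ger0_norm (absgrad_ge0 x)).
have := absgrad_ge0 x; have := absgrad_le2 x; have := normr_ge0 h.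
move: (absgrad x) `|h| => a k k0 a2 a0 H.
apply: le_trans (ler_wpM2r a0 H) _.
have : 0 <= k * (4 - a * a) by rewrite mulr_ge0//; nra.
by lra.
Qed.

Lemma product_remainder (a1 a2 a3 p q r h : R) :
  a1 + (p + h * q + a2 + h * (r + a3)) - p - h * (r + q) = a1 + a2 + h * a3.
Proof. by ring. Qed.

(** Product rule for a time-dependent multiplier applied to a moving sequence: all the
    remainders are quadratic in h by the operator bound. *)
Lemma is_derive_multiplier (M : R -> R -> R) (m' : R -> R) (F : R -> int -> R)
    (f' : int -> R) s B B' C c c' D n :
  bounded_symbol (M s) B -> bounded_symbol m' B' ->
  (forall h, bounded_symbol (fun x => M (s + h) x - M s x - h * m' x) (C * h ^+ 2)) ->
  l2_le (F s) c -> l2_le f' c' ->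
  (forall h, `|h| <= 1 -> l2_le (fun k => F (s + h) k - F s k - h * f' k) (D * h ^+ 2)) ->
  is_derive s 1 (fun r => multiplier (M r) (F r) n)
    (multiplier m' (F s) n + multiplier (M s) f' n).
Proof.
move=> HM Hm' HC Fc fc HD.
have B0 : 0 <= B by case: HM.
have B'0 : 0 <= B' by case: Hm'.
have C0 : 0 <= C by have [] := HC 1; rewrite expr1n mulr1.
have D0 : 0 <= D by have := l2_le_ge0 (HD 1 _); rewrite normr1 expr1n mulr1 lexx; exact.
have c0 := l2_le_ge0 Fc; have c'0 := l2_le_ge0 fc.
apply: (@is_derive_quadratic _ _ _ _ (C * (c + (c' + D)) + B * D + B' * (c' + D))) => h h1.
have hh : h ^+ 2 <= `|h|.
  by rewrite -(real_normK (num_real h)) expr2 ler_piMl.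
have h0 := normr_ge0 h.
(* M_h F_h is expanded as (remainder of M) F_h + M_s F_h + h m' F_h, and F_h is then
   expanded in the last two terms. *)
have dF : l2_le (fun k => F (s + h) k - F s k) (`|h| * (c' + D)).
  have := l2_leD (l2_leZ h fc) (HD h h1); under eq_fun do rewrite addrC subrK.
  by move/l2_leW; apply; rewrite mulrDr lerD2l mulrC ler_wpM2r.
have Fh : l2_le (F (s + h)) (c + (c' + D)).
  have := l2_leD Fc dF; under eq_fun do rewrite addrC subrK.
  move/l2_leW; apply; rewrite lerD2l ler_piMl// addr_ge0//.
have rd : l2_le (fun k => F (s + h) k - F s k - h * f' k) (D * h ^+ 2) by exact: HD.
have e1 : multiplier (M (s + h)) (F (s + h)) n =
    multiplier (fun x => M (s + h) x - M s x - h * m' x) (F (s + h)) n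
    + (multiplier (M s) (F (s + h)) n + h * multiplier m' (F (s + h)) n).
  rewrite -(multiplierPl h n HM Hm' Fh) -(multiplierDl n (HC h) (bounded_symbolPl h HM Hm') Fh).
  apply: (congr1 (fun m => multiplier m (F (s + h)) n)).
  by apply/funext => x; ring.
have e2 : multiplier (M s) (F (s + h)) n =
    multiplier (M s) (F s) n + h * multiplier (M s) f' n
    + multiplier (M s) (fun k => F (s + h) k - F s k - h * f' k) n.
  rewrite -(multiplierPr h n HM Fc fc) -(multiplierDr n HM (l2_lePl h Fc fc) rd).
  apply: (congr1 (fun f => multiplier (M s) f n)).
  by apply/funext => k; ring.
have e3 : multiplier m' (F (s + h)) n =
    multiplier m' (F s) n + multiplier m' (fun k => F (s + h) k - F s k) n.
  rewrite -(multiplierDr n Hm' Fc dF).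
  apply: (congr1 (fun f => multiplier m' f n)).
  by apply/funext => k; ring.
have b1 := multiplier_coord n (HC h) Fh.
have b2 := multiplier_coord n HM rd.
have b3 := multiplier_coord n Hm' dF.
rewrite e1 e2 e3.
set a1 := multiplier _ _ n in b1 *.
set a2 := multiplier _ (fun k => F (s + h) k - F s k - h * f' k) n in b2 *.
set a3 := multiplier _ (fun k => F (s + h) k - F s k) n in b3 *.
rewrite (product_remainder a1 a2 a3).
apply: le_trans (ler_normD _ _) _; apply: le_trans (lerD (ler_normD _ _) (lexx _)) _.
have b4 : `|h * a3| <= B' * (c' + D) * h ^+ 2.
  rewrite normrM; apply: le_trans (ler_wpM2l h0 b3) _.
  by rewrite -(real_normK (num_real h)) le_eqVlt; apply/orP; left; apply/eqP; ring.
apply: le_trans (lerD (lerD b1 b2) b4) _.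
by rewrite le_eqVlt; apply/orP; left; apply/eqP; ring.
Qed.

Definition l2_curve (w : R -> int -> R) : Prop :=
  forall s, in_l2 (w s) /\
    forall e : R, 0 < e -> \forall s' \near s, l2_le (fun k => w s' k - w s k) e.

(** The kernel is Lipschitz in time in operator norm and the curve is norm continuous. *)
Lemma continuous_multiplierK (w : R -> int -> R) t n : l2_curve w ->
  continuous (fun s => multiplier (symK (t - s)) (w s) n).
Proof.
move=> cw s; apply/cvgrPdist_le => e e0.
have [/l2_le_norm wl ws] := cw s; set c := l2norm (w s) in wl.
have c0 := l2_le_ge0 wl.
pose d := e / (2 + 4 * c).
have s0 : 0 < 2 + 4 * c by rewrite ltr_wpDr// mulr_ge0.
have d0 : 0 < d by rewrite divr_gt0.
near=> s'.
have H1 : l2_le (fun k => w s' k - w s k) d by near: s'; exact: ws.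
have H2 : `|s - s'| <= d.
  by near: s'; apply: cvgr_dist_le; [exact: cvg_id|].
have E1 : multiplier (symK (t - s')) (w s') n =
  multiplier (symK (t - s')) (w s) n + multiplier (symK (t - s')) (fun k => w s' k - w s k) n.
  rewrite -(multiplierDr n (symK_bounded_symbol (t - s')) wl H1).
  apply: (congr1 (fun f => multiplier (symK (t - s')) f n)).
  by apply/funext => k; ring.
have Kl := symK_lip (t - s) (s - s').
have ts : t - s + (s - s') = t - s' by ring.
rewrite ts in Kl.
have E2 : multiplier (symK (t - s')) (w s) n = multiplier (symK (t - s)) (w s) n
  + multiplier (fun x => symK (t - s') x - symK (t - s) x) (w s) n.
  rewrite -(multiplierDl n (symK_bounded_symbol (t - s)) Kl wl).
  apply: (congr1 (fun m => multiplier m (w s) n)).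
  by apply/funext => x; ring.
rewrite E1 E2; set a := multiplier _ _ n; set b := multiplier _ _ n; set b' := multiplier _ _ n.
have -> : a - (a + b + b') = - (b + b') by ring.
rewrite normrN; apply: le_trans (ler_normD _ _) _.
have b1 := multiplier_coord n Kl wl.
have b2 := multiplier_coord n (symK_bounded_symbol (t - s')) H1.
apply: le_trans (lerD b1 b2) _.
have : d * (2 + 4 * c) = e by rewrite /d divfK// gt_eqF.
move=> <-; have : 4 * `|s - s'| * c <= 4 * d * c by rewrite ler_wpM2r// ler_wpM2l.
have -> : d * (2 + 4 * c) = 4 * d * c + 2 * d by ring.
by rewrite lerD2r.
Unshelve. all: by end_near. Qed.

End Propagators.

(** * From r_t to the momentum and back *)

Section HalfDerivative.
Local Open Scope complex_scope.
Variable R : realType.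
Local Notation leb := (@lebesgue_measure R).
Local Notation torus := (@torus R).
Local Notation normc := (@Normc.normc R).
Local Notation sqrt2pi := (sqrt2pi R).
Local Notation absgrad_inv := (@absgrad_inv R).
Implicit Types (f : int -> R) (m : R -> R) (B C c : R) (g : R -> R[i]).

Lemma coef_expi g n : coef (fun x => expi x * g x) n = coef g (n + 1).
Proof.
rewrite /coef; congr (_ * _); apply: eq_Rintegral => x _.
have -> : expi (x * (n + 1)%:~R) = expi x * expi (x * n%:~R).
  by rewrite -expiD; congr expi; rewrite intrD; ring.
by rewrite [expi x * g x]mulrC -mulrA.
Qed.

Lemma coef_expiN g n : coef (fun x => expi (- x) * g x) n = coef g (n - 1).
Proof.
rewrite /coef; congr (_ * _); apply: eq_Rintegral => x _.
have -> : expi (x * (n - 1)%:~R) = expi (- x) * expi (x * n%:~R).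
  by rewrite -expiD; congr expi; rewrite intrB; ring.
by rewrite [expi (- x) * g x]mulrC -mulrA.
Qed.

Lemma L2_le_phase (u g : R -> R[i]) c : cmeasurable u -> (forall x, normc (u x) = 1) ->
  L2_le g c -> L2_le (fun x => u x * g x) c.
Proof.
move=> mu u1 gc; rewrite -[c]mul1r; apply: L2_le_bounded => //.
by move=> x _ _; rewrite u1.
Qed.

Lemma L2_le_expiM g c : L2_le g c -> L2_le (fun x => expi x * g x) c.
Proof. by apply: L2_le_phase; [exact: cmeasurable_expi1|move=> x; exact: normc_expi]. Qed.

Lemma L2_le_expiNM g c : L2_le g c -> L2_le (fun x => expi (- x) * g x) c.
Proof. by apply: L2_le_phase; [exact: cmeasurable_expiN1|move=> x; exact: normc_expi]. Qed.

(** A symbol acts on Fourier coefficients if the coefficients of m g depend on those of g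
    only. Trigonometric polynomials do, and so do their uniform limits. This gives
    |grad| |grad|^(-1) = 1 on coefficients without the completeness of the
    trigonometric system. *)
Definition coef_determined m : Prop := (exists B, bounded_symbol m B) /\
  forall g g' c c', L2_le g c -> L2_le g' c' -> coef g = coef g' ->
    coef (fun x => (m x)%:C * g x) = coef (fun x => (m x)%:C * g' x).

Lemma coef_determined_cst (a : R) : coef_determined (fun=> a).
Proof.
split; first by exists `|a|; split=> //; exact: measurable_cst.
move=> g g' c c' gc gc' E; apply/funext => n.
by rewrite (coefZ a n gc) (coefZ a n gc') E.
Qed.

(** Multiplication by cos x averages two neighbouring coefficients. *)
Lemma coef_determined_cos : coef_determined cos.
Proof.
split.
  exists 1; split=> //; last by move=> x _ _; exact: cos_max.
  by apply: measurable_continuous; exact: continuous_cos.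
have E g c n : L2_le g c -> coef (fun x => (cos x)%:C * g x) n =
    2^-1 * (coef g (n + 1) + coef g (n - 1)).
  move=> gc; rewrite -coef_expi -coef_expiN.
  have G := L2_le_expiM gc; have G' := L2_le_expiNM gc.
  rewrite -(coefD n G G') -(coefZ 2^-1 n (L2_leD G G')).
  apply: (congr1 (fun w => coef w n)); apply/funext => x.
  rewrite -mulrDl mulrA; congr (_ * _).
  apply/eqP; rewrite eq_complex/= cosN sinN subrr mulr0 mul0r.
  by apply/andP; split; apply/eqP; [field|ring].
by move=> g g' c c' gc gc' H; apply/funext => n; rewrite (E _ _ _ gc) (E _ _ _ gc') H.
Qed.

Lemma coef_determinedM m m' : coef_determined m -> coef_determined m' ->
  coef_determined (fun x => m x * m' x).
Proof.
move=> [[B Hm] H] [[B' Hm'] H']; split.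
  have [B0 mm mB] := Hm; have [B0' mm' mB'] := Hm'.
  exists (B * B'); split; [exact: mulr_ge0|exact: measurable_funM|].
  by move=> x tx x0; rewrite normrM; apply: ler_pM => //; [exact: mB|exact: mB'].
move=> g g' c c' gc gc' E.
have := H _ _ _ _ (bounded_symbol_mul Hm' gc) (bounded_symbol_mul Hm' gc') (H' _ _ _ _ gc gc' E).
have S h : (fun x => (m x * m' x)%:C * h x) = (fun x => (m x)%:C * ((m' x)%:C * h x)).
  by apply/funext => x; rewrite rmorphM mulrA.
by rewrite !S.
Qed.

Lemma coef_determinedD m m' : coef_determined m -> coef_determined m' ->
  coef_determined (fun x => m x + m' x).
Proof.
move=> [[B Hm] H] [[B' Hm'] H']; split.
  exists (B + `|1| * B'); have := bounded_symbolPl 1 Hm Hm'.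
  by under eq_fun do rewrite mul1r.
move=> g g' c c' gc gc' E.
have S h d n : L2_le h d -> coef (fun x => (m x + m' x)%:C * h x) n =
    coef (fun x => (m x)%:C * h x) n + coef (fun x => (m' x)%:C * h x) n.
  move=> hd; rewrite -(coefD n (bounded_symbol_mul Hm hd) (bounded_symbol_mul Hm' hd)).
  by apply: (congr1 (fun w => coef w n)); apply/funext => x; rewrite rmorphD mulrDl.
apply/funext => n; rewrite (S _ _ _ gc) (S _ _ _ gc').
by rewrite (H _ _ _ _ gc gc' E) (H' _ _ _ _ gc gc' E).
Qed.

Lemma coef_determined_lim m B (u : nat -> R -> R) :
  bounded_symbol m B -> (forall k, coef_determined (u k)) ->
  (forall e : R, 0 < e -> exists k, bounded_symbol (fun x => m x - u k x) e) ->
  coef_determined m.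
Proof.
move=> Hm Hu Hlim; split; first by exists B.
move=> g g' c c' gc gc' E; apply/funext => n.
apply/eqP; rewrite -subr_eq0 -normr_le0; apply/ler_addgt0Pr => e e0; rewrite add0r.
have s0 := sqrt2pi_gt0 R.
have c0 := L2_le_ge0 gc; have c0' := L2_le_ge0 gc'.
have cc : 0 < c + c' + 1 by rewrite ltr_wpDl// addr_ge0.
(* The factor sqrt2pi is undone by Bessel's inequality. *)
pose d := e * sqrt2pi / (c + c' + 1).
have d0 : 0 < d by rewrite divr_gt0// mulr_gt0.
have [k Hk] := Hlim d d0; have [[Bk Hbk] Hck] := Hu k.
have S h a : L2_le h a -> coef (fun x => (m x)%:C * h x) n =
    coef (fun x => (m x - u k x)%:C * h x) n + coef (fun x => (u k x)%:C * h x) n.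
  move=> ha; rewrite -(coefD n (bounded_symbol_mul Hk ha) (bounded_symbol_mul Hbk ha)).
  apply: (congr1 (fun w => coef w n)); apply/funext => x.
  by rewrite -mulrDl -rmorphD subrK.
rewrite (S _ _ gc) (S _ _ gc') (Hck _ _ _ _ gc gc' E) opprD addrACA subrr addr0.
apply: le_trans (ler_normB _ _) _.
apply: le_trans (lerD (l2_le_coord n (bessel (bounded_symbol_mul Hk gc)))
                     (l2_le_coord n (bessel (bounded_symbol_mul Hk gc')))) _.
have -> : sqrt2pi^-1 * (d * c) + sqrt2pi^-1 * (d * c') = sqrt2pi^-1 * d * (c + c') by ring.
have -> : sqrt2pi^-1 * d = e / (c + c' + 1) by rewrite /d; field; rewrite !gt_eqF.
rewrite mulrAC ler_pdivrMr// ler_wpM2l ?(ltW e0)//.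
by rewrite lerDl.
Qed.

Lemma sqr_half_sin (x : R) : `|sin (x / 2)| ^+ 2 = (1 - cos x) / 2.
Proof.
have := sqr_absgrad x; rewrite /absgrad exprMn => E.
by apply: (mulfI (_ : 2 ^+ 2 != 0 :> R)); rewrite ?expf_neq0 ?pnatr_eq0// E; field.
Qed.

(** The classical iteration for the square root of z = (1 - cos x) / 2 = sin (x / 2)^2; its
    terms are polynomials in cos x. *)
Fixpoint sqrt_iter k (x : R) : R :=
  if k is k'.+1
  then sqrt_iter k' x + 2^-1 * ((1 - cos x) / 2 - sqrt_iter k' x ^+ 2)
  else 0.

(** The last inequality makes the error at most 2 / k, uniformly in x. *)
Lemma sqrt_iter_bounds k x : let u := `|sin (x / 2)| in
  [/\ 0 <= sqrt_iter k x, sqrt_iter k x <= u & (u - sqrt_iter k x) * (2 + k%:R * u) <= 2 * u].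
Proof.
move=> u; have u0 : 0 <= u by exact: normr_ge0.
have u1 : u <= 1 by exact: sin_max.
elim: k => [|k [m0 mu IH]] /=; first by split=> //; rewrite mul0r addr0 subr0 mulrC.
rewrite -sqr_half_sin -/u.
have uu : 0 <= u ^+ 2 - sqrt_iter k x ^+ 2 by rewrite subr_ge0 ler_sqr.
move: (sqrt_iter k x) m0 mu IH uu => a a0 au IH uu.
split; [by rewrite addr_ge0// mulr_ge0|nra|].
apply: le_trans IH.
have -> : u - (a + 2^-1 * (u ^+ 2 - a ^+ 2)) = (u - a) * (1 - 2^-1 * (u + a)) by field.
rewrite -mulrA; apply: ler_wpM2l; first by rewrite subr_ge0.
have k0 : 0 <= k%:R :> R by rewrite ler0n.
rewrite -[k.+1%:R]natr1; move: (k%:R) k0 => K K0.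
have h1 : 0 <= 2^-1 * (u + a) by rewrite mulr_ge0// addr_ge0.
have h2 : 1 - 2^-1 * (u + a) <= 1 - 2^-1 * u by lra.
have h3 : 0 <= 2 + (K + 1) * u by rewrite addr_ge0// mulr_ge0// addr_ge0.
apply: (le_trans (ler_wpM2r h3 h2)).
have : 0 <= (K + 1) * u ^+ 2 by rewrite mulr_ge0 ?sqr_ge0// addr_ge0.
by lra.
Qed.

Lemma sqrt_iter_determined k : coef_determined (sqrt_iter k).
Proof.
elim: k => [|k IH]; first exact: coef_determined_cst.
have -> : sqrt_iter k.+1 = (fun x => sqrt_iter k x + 2^-1 *
    ((2^-1 + (- 2^-1) * cos x) + (-1) * (sqrt_iter k x * sqrt_iter k x))).
  by apply/funext => x /=; field.
apply: coef_determinedD => //; apply: coef_determinedM; first exact: coef_determined_cst.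
apply: coef_determinedD.
  apply: coef_determinedD; first exact: coef_determined_cst.
  by apply: coef_determinedM; [exact: coef_determined_cst|exact: coef_determined_cos].
apply: coef_determinedM; first exact: coef_determined_cst.
exact: coef_determinedM.
Qed.

Lemma absgrad_bounded_symbol : bounded_symbol (@absgrad R) 2.
Proof.
split=> //; first exact: measurable_absgrad.
by move=> x _ _; rewrite ger0_norm ?absgrad_ge0// absgrad_le2.
Qed.

Lemma absgrad_determined : coef_determined (@absgrad R).
Proof.
apply: (@coef_determined_lim _ 2 (fun k x => 2 * sqrt_iter k x)).
- exact: absgrad_bounded_symbol.
- move=> k; apply: coef_determinedM; first exact: coef_determined_cst.
  exact: sqrt_iter_determined.
move=> e e0.
have [k ke] : exists k : nat, 4 / e <= k.+1%:R.
  exists (Num.Def.archi_bound (4 / e)).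
  apply: le_trans (ltW (archi_boundP _)) _; first by rewrite divr_ge0// ltW.
  by rewrite ler_nat.
exists k.+1; split; first exact: ltW.
  apply: measurable_funB; first exact: measurable_absgrad.
  apply: measurable_funM; first exact: measurable_cst.
  by have [[B [_ mB _]] _] := sqrt_iter_determined k.+1.
move=> x _ _; have [m0 mu H] := sqrt_iter_bounds k.+1 x.
rewrite /absgrad -mulrBr normrM (ger0_norm (ler0n R 2)) ger0_norm ?subr_ge0//.
move: mu H m0; move: (sqrt_iter k.+1 x) `|sin (x / 2)| (normr_ge0 (sin (x / 2))) => a u u0 au H a0.
have {}ke : 4 <= e * k.+1%:R by move: ke; rewrite ler_pdivrMr// mulrC.
have [u00|un0] := eqVneq u 0.
  have -> : a = 0 by apply/eqP; rewrite eq_le a0 andbT -u00.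
  by rewrite u00 subrr mulr0 ltW.
have up : 0 < u by rewrite lt_neqAle eq_sym un0.
have ua : 0 <= u - a by rewrite subr_ge0.
have H2 : (u - a) * k.+1%:R <= 2.
  rewrite -(ler_pM2r up); apply: le_trans H; rewrite -mulrA; apply: ler_wpM2l => //.
  by rewrite lerDr.
have k0 : 0 < k.+1%:R :> R by rewrite ltr0n.
rewrite -(ler_pM2r k0); apply: le_trans ke.
by lra.
Qed.

Lemma absgrad_mulV (x : R) : torus x -> x != 0 -> absgrad x * absgrad_inv x = 1.
Proof. by move=> tx x0; rewrite /Defs.absgrad_inv mulfV// gt_eqF// absgrad_gt0. Qed.

Lemma cmeasurable_absgrad_inv : cmeasurable (fun x => (absgrad_inv x)%:C).
Proof. by apply: cmeasurable_real; exact: measurable_absgrad_inv. Qed.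

Lemma sqr_normc_expi_sub1 (x : R) : normc (expi x - 1) ^+ 2 = absgrad x ^+ 2.
Proof.
rewrite normc2E sqr_absgrad /= subr0.
have := cos2Dsin2 x; nra.
Qed.

Lemma normc_expi_sub1 (x : R) : normc (expi x - 1) = absgrad x.
Proof.
apply/eqP; rewrite -(@eqrXn2 _ 2) ?normc_ge0 ?absgrad_ge0//.
by apply/eqP; exact: sqr_normc_expi_sub1.
Qed.

Lemma absgradN (x : R) : absgrad (- x) = absgrad x.
Proof. by rewrite /absgrad mulNr sinN normrN. Qed.

(** The function (exp (i e x) - 1) / |exp (i x) - 1| is a phase: passing from |grad| to the
    forward difference costs nothing in norm. *)
Lemma L2_le_halfphase (e : R) g c : (e = 1 \/ e = -1) -> L2_le g c ->
  L2_le (fun x => (absgrad_inv x)%:C * (expi (x * e) - 1) * g x) c.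
Proof.
move=> e1 gc; rewrite -[c]mul1r; apply: L2_le_bounded => //.
  apply: cmeasurableM; first exact: cmeasurable_absgrad_inv.
  by apply: cmeasurableB; [exact: cmeasurable_expi|exact: cmeasurable_cst].
move=> x tx x0; rewrite normcMr normc_real normc_expi_sub1.
have -> : absgrad (x * e) = absgrad x.
  by case: e1 => ->; rewrite ?mulr1// mulrN1 absgradN.
rewrite ger0_norm; last by rewrite invr_ge0 absgrad_ge0.
by rewrite mulrC absgrad_mulV.
Qed.

Lemma L2_le_zero : L2_le (fun=> 0 : R[i]) 0.
Proof.
split=> //; rewrite expr0n /sqL2norm integral0_eq// => x _.
by rewrite Normc.normc0 expr0n.
Qed.

Lemma coef_eq_off0 g h (c d : R) : L2_le g c -> L2_le h d ->
  (forall x, torus x -> x != 0 -> g x = h x) -> coef g = coef h.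
Proof.
move=> gc hd gh; apply: (coef_congr gc hd); apply: L2_le_congr L2_le_zero _.
  by apply: cmeasurableB; [exact: L2_le_meas gc|exact: L2_le_meas hd].
by move=> x tx x0; rewrite gh// subrr.
Qed.

Lemma expi_sub1_mul (x : R) : (expi x - 1) * (expi (- x) - 1) = (absgrad x ^+ 2)%:C.
Proof.
rewrite sqr_absgrad; apply/eqP; rewrite eq_complex/= cosN sinN.
by have := cos2Dsin2 x => E; apply/andP; split; apply/eqP; [lra|ring].
Qed.

(** If w = |grad|^(-1) f, then |grad| w = f, and p is obtained from w by multiplication
    with the phase |grad| / (exp (i x) - 1), so that p is no larger than w and its forward
    difference is f. *)
Theorem momentum_exists f : in_dom_absgrad_inv f -> exists p,
  (forall n, f n = p (n + 1) - p n) /\ l2_le p (l2norm (multiplier absgrad_inv f)).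
Proof.
move=> [fl gl]; have fc := l2_le_norm fl; have gc := L2_le_norm gl.
pose g x := (absgrad_inv x)%:C * dft f x.
pose w := multiplier absgrad_inv f.
have gc' : L2_le g (L2norm g) by exact: gc.
have wE : w = coef g by [].
have wl2 : in_l2 w by exact: l2_le_in (bessel gc').
have wc := l2_le_norm wl2.
have Dw := dftP wl2; have Fw := dft_L2_le wc.
have cw : coef (dft w) = coef g by rewrite (coef_dft Dw).
have E : coef (fun x => (absgrad x)%:C * dft w x) = f.
    rewrite (absgrad_determined.2 _ _ _ _ Fw gc' cw) -(coef_dft (dftP fl)).
  apply: (coef_eq_off0 (bounded_symbol_mul absgrad_bounded_symbol gc') (dft_L2_le fc)) => x tx x0.
  by rewrite /g mulrA -rmorphM (absgrad_mulV tx x0) mul1r.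
pose h x := (absgrad_inv x)%:C * (expi (x * -1) - 1) * dft w x.
have hc : L2_le h (sqrt2pi * l2norm w) by apply: L2_le_halfphase => //; right.
exists (coef h); split; last first.
  by have := bessel hc; rewrite mulKf// gt_eqF// sqrt2pi_gt0.
move=> n; rewrite -E -coef_expi -(coefB n (L2_le_expiM hc) hc).
apply: (congr1 (fun u => u n)).
apply: (coef_eq_off0 (bounded_symbol_mul absgrad_bounded_symbol Fw) (L2_leB (L2_le_expiM hc) hc)) => x tx x0.
rewrite /h mulrN1; move: (absgrad_mulV tx x0) (expi_sub1_mul x).
move: (absgrad x) (absgrad_inv x) (expi x) (expi (- x)) (dft w x) => a b z z' D ab zz.
have -> : z * (b%:C * (z' - 1) * D) - b%:C * (z' - 1) * D = b%:C * ((z - 1) * (z' - 1)) * D by ring.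
by rewrite zz -rmorphM expr2 mulrA [b * a]mulrC ab mul1r.
Qed.

(** Dividing (exp (i x) - 1) by |grad| leaves a phase, so |grad|^(-1) of a forward
    difference is no larger than the sequence itself. *)
Theorem difference_in_domain p c : l2_le p c ->
  in_dom_absgrad_inv (fun n => p (n + 1) - p n) /\
  l2_le (multiplier absgrad_inv (fun n => p (n + 1) - p n)) c.
Proof.
move=> pc; set f := fun n : int => p (n + 1) - p n.
have fc : l2_le f (c + c) by apply: l2_leB => //; exact: (l2_le_comp pc (@addz_inj 1)).
have fl := l2_le_in fc; have Dp := dftP (l2_le_in pc).
have D := is_dft_lin 1 (-1) (is_dft_shift pc Dp) Dp.
have fE : (fun n => 1 * p (n + 1) + -1 * p n) = f.
  by apply/funext => n; rewrite mul1r mulN1r.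
rewrite fE in D.
have U := L2_le_null_mul cmeasurable_absgrad_inv (is_dft_unique (dftP fl) D).
have H := @L2_le_halfphase 1 _ _ (or_introl erefl) (dft_L2_le pc).
have G : L2_le (fun x => (absgrad_inv x)%:C * dft f x) (sqrt2pi * c).
  have := L2_leD U H; rewrite add0r.
  suff -> : (fun x => (absgrad_inv x)%:C * (dft f x - (1%:C * (expi x * dft p x) + (-1)%:C * dft p x))
     + (absgrad_inv x)%:C * (expi (x * 1) - 1) * dft p x) =
     (fun x => (absgrad_inv x)%:C * dft f x) by [].
  apply/funext => x; rewrite rmorphN1 mulN1r mul1r mulr1.
  move: (absgrad_inv x)%:C (expi x) (dft f x) (dft p x) => a z u v.
  by ring.
split; first by split=> //; exact: L2_le_in G.
by rewrite multiplierE; have := bessel G; rewrite mulKf// gt_eqF// sqrt2pi_gt0.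
Qed.

End HalfDerivative.

(** * The nonlinearity and its truncation *)

Section Nonlinearity.
Variable R : realType.
Implicit Types (f df : R -> R) (a b t D : R).

(** Mean value inequality on a segment, with a bound on the derivative there only. *)
Lemma lipschitz_of_derive f df lo hi D a b :
  (forall x : R, is_derive x 1 f (df x)) ->
  (forall x, lo <= x <= hi -> `|df x| <= D) ->
  lo <= a <= hi -> lo <= b <= hi -> `|f a - f b| <= D * `|a - b|.
Proof.
move=> fd fD; wlog ab : a b / a <= b => [H Ha Hb|].
  by have [ab|/ltW ba] := leP a b; [exact: H|rewrite distrC [`|a - b|]distrC; exact: H].
move=> /andP[la ah] /andP[lb bh].
rewrite distrC [`|a - b|]distrC ler_norml [`|b - a|]ger0_norm ?subr_ge0//.
have db x : a <= x <= b -> `|df x| <= D.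
  by move=> /andP[ax xb]; apply: fD; rewrite (le_trans la ax) (le_trans xb bh).
have := @le_of_derive_le0 R (fun x => f x - x * D) (fun x => df x - D) a b ab.
have := @le_of_derive_le0 R (fun x => - f x - x * D) (fun x => - df x - D) a b ab.
move=> H1 H2; have {}H1 : - f b - b * D <= - f a - a * D.
  apply: H1 => x; first by apply: is_deriveB; first exact: is_derive_mulrl.
  by move/db; rewrite ler_norml => /andP[? _]; lra.
have {}H2 : f b - b * D <= f a - a * D.
  apply: H2 => x; first by apply: is_deriveB; first exact: is_derive_mulrl.
  by move/db; rewrite ler_norml => /andP[_ ?]; lra.
by apply/andP; split; lra.
Qed.

Definition clamp (rho x : R) : R := Num.max (- rho) (Num.min x rho).

Lemma clamp_itv rho x : 0 <= rho -> - rho <= clamp rho x <= rho.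
Proof.
move=> r0; rewrite /clamp le_max lexx /= ge_max ge_min lexx orbT andbT.
by rewrite (le_trans _ r0)// oppr_le0.
Qed.

Lemma clamp_id rho x : `|x| <= rho -> clamp rho x = x.
Proof. by rewrite ler_norml /clamp => /andP[h1 h2]; rewrite (min_idPl h2) (max_idPr h1). Qed.

Lemma max_lip (c a b : R) : `|Num.max c a - Num.max c b| <= `|a - b|.
Proof.
have h1 := ler_norm (a - b); have h2 := ler_norm (b - a); rewrite distrC in h2.
rewrite ler_norml; case: (leP c a) => ?; case: (leP c b) => ?;
  by apply/andP; split; lra.
Qed.

Lemma min_lip (c a b : R) : `|Num.min a c - Num.min b c| <= `|a - b|.
Proof.
have h1 := ler_norm (a - b); have h2 := ler_norm (b - a); rewrite distrC in h2.
rewrite ler_norml; case: (leP a c) => ?; case: (leP b c) => ?;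
  by apply/andP; split; lra.
Qed.

Lemma clamp_lip rho a b : `|clamp rho a - clamp rho b| <= `|a - b|.
Proof. exact: le_trans (max_lip _ _ _) (min_lip _ _ _). Qed.

Lemma clamp_continuous rho : continuous (clamp rho).
Proof.
move=> x; apply/cvgrPdist_le => e e0; near=> y.
apply: le_trans (clamp_lip _ _ _) _.
by near: y; apply: cvgr_dist_le; [exact: cvg_id|].
Unshelve. all: by end_near. Qed.

Lemma clamp0 rho : 0 <= rho -> clamp rho 0 = 0.
Proof. by move=> r0; apply: clamp_id; rewrite normr0. Qed.

Variables (V : R -> R).
Hypothesis V_C5 : C_k 5 V.
Hypothesis V'0 : V^`() 0 = 0.
Hypothesis V''0 : V^`(2) 0 = 1.

Lemma is_derive_V j (x : R) : (j < 5)%N -> is_derive x 1 (V^`(j)) (V^`(j.+1) x).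
Proof.
move=> j5; have [H _] := V_C5; split; first exact: H.
by rewrite derive1nS derive1E.
Qed.

Lemma continuous_V j : (j < 5)%N -> continuous (V^`(j)).
Proof. by move=> j5 x; apply: is_derive_continuous; exact: is_derive_V. Qed.

Lemma bounded_V j lo hi : (j < 5)%N -> exists B, forall x, lo <= x <= hi -> `|V^`(j) x| <= B.
Proof.
move=> j5; have [lh|hl] := leP lo hi; last first.
  by exists 0 => x /andP[h1 h2]; have := le_lt_trans (le_trans h1 h2) hl; rewrite ltxx.
have cf : {within `[lo, hi], continuous (fun x => `|V^`(j) x|)}.
  apply: continuous_subspaceT => x.
  by apply: (@continuous_comp _ _ _ (V^`(j)) Num.norm); [exact: continuous_V|exact: norm_continuous].
have [c _ Hc] := EVT_max lh cf.
by exists `|V^`(j) c| => x xI; apply: Hc; rewrite in_itv.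
Qed.

(** The constant max (1, sup |V'''|) of the smallness assumption. *)
Definition third_bound : R :=
  Num.max 1 (sup [set `|V^`(3) x| | x in [set x : R | `|x| <= 1]]).
Local Notation M := third_bound.

Lemma third_bound_ge1 : 1 <= M.
Proof. by rewrite le_max lexx. Qed.

Lemma third_boundP x : `|x| <= 1 -> `|V^`(3) x| <= M.
Proof.
move=> x1; rewrite le_max; apply/orP; right.
apply: ub_le_sup; last by exists x.
have [B HB] := @bounded_V 3 (-1) 1 isT.
by exists B => _ [y /= y1 <-]; apply: HB; rewrite -ler_norml.
Qed.

(** The nonlinear part of the force; it vanishes to second order at 0. *)
Definition anharm (x : R) : R := (V^`()%classic) x - x.

Lemma is_derive_anharm (x : R) : is_derive x 1 anharm ((V^`(2)%classic) x - 1).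
Proof.
by apply: is_deriveB; exact: (@is_derive_V 1 x isT).
Qed.

Lemma anharm0 : anharm 0 = 0.
Proof. by rewrite /anharm V'0 subr0. Qed.

Lemma second_derive_close (x : R) : `|x| <= 1 -> `|(V^`(2)%classic) x - 1| <= M * `|x|.
Proof.
move=> x1; rewrite -V''0; apply: increment_norm_le => y; first exact: (@is_derive_V 2 y isT).
by move=> yx; apply: third_boundP; exact: le_trans x1.
Qed.

(** On [-rho, rho] the derivative V'' - 1 is at most third_bound V * rho. *)
Lemma anharm_lip rho a b : 0 <= rho -> rho <= 1 -> - rho <= a <= rho -> - rho <= b <= rho ->
  `|anharm a - anharm b| <= M * rho * `|a - b|.
Proof.
move=> r0 r1; apply: lipschitz_of_derive => x; first exact: is_derive_anharm.
rewrite -ler_norml => xr; apply: le_trans (second_derive_close _) _.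
  exact: le_trans r1.
by rewrite ler_wpM2l// (le_trans ler01)// third_bound_ge1.
Qed.

(** Twice the smallness threshold: the bound that the solution will turn out to satisfy.
    At this level the nonlinear part of the force is Lipschitz with constant 1 / 10. *)
Definition cutoff : R := (10 * M)^-1.
Local Notation rho := cutoff.

Lemma third_bound_gt0 : 0 < M. Proof. exact: lt_le_trans ltr01 third_bound_ge1. Qed.

Lemma cutoff_gt0 : 0 < rho.
Proof. by rewrite invr_gt0 mulr_gt0// third_bound_gt0. Qed.

Lemma cutoff_le1 : rho <= 1.
Proof. by rewrite invf_le1 ?mulr_gt0 ?third_bound_gt0//; have := third_bound_ge1; lra. Qed.

Lemma M_cutoff : M * rho = 10^-1.
Proof. by rewrite /cutoff; field; rewrite gt_eqF// third_bound_gt0. Qed.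

Definition trunc_anharm x : R := anharm (clamp rho x).

Lemma trunc_anharm_lip a b : `|trunc_anharm a - trunc_anharm b| <= 10^-1 * `|a - b|.
Proof.
have r0 := ltW cutoff_gt0.
apply: (le_trans (anharm_lip r0 cutoff_le1 (clamp_itv _ r0) (clamp_itv _ r0))).
by rewrite M_cutoff ler_wpM2l ?invr_ge0// clamp_lip.
Qed.

Lemma trunc_anharm_0 : trunc_anharm 0 = 0.
Proof. by rewrite /trunc_anharm clamp0 ?anharm0// ltW// cutoff_gt0. Qed.

Lemma trunc_anharm_le a : `|trunc_anharm a| <= 10^-1 * `|a|.
Proof. by have := trunc_anharm_lip a 0; rewrite trunc_anharm_0 !subr0. Qed.

Lemma trunc_anharm_continuous : continuous trunc_anharm.
Proof.
move=> x; apply: (@continuous_comp _ _ _ (clamp rho) anharm); first exact: clamp_continuous.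
by apply: is_derive_continuous; exact: is_derive_anharm.
Qed.

(** The force is made globally Lipschitz by freezing its nonlinear part outside the
    cutoff; the linear part is kept, so the potential stays quadratically coercive on
    the whole line. *)
Definition trunc_force x : R := x + trunc_anharm x.
Definition trunc_potential x : R := 2^-1 * x ^+ 2 + int0 x trunc_anharm.

Lemma trunc_force_lip a b : `|trunc_force a - trunc_force b| <= 2 * `|a - b|.
Proof.
have -> : trunc_force a - trunc_force b = (a - b) + (trunc_anharm a - trunc_anharm b).
  by rewrite /trunc_force; ring.
apply: le_trans (ler_normD _ _) _; have := trunc_anharm_lip a b.
by have := normr_ge0 (a - b); lra.
Qed.

Lemma trunc_force_0 : trunc_force 0 = 0.
Proof. by rewrite /trunc_force trunc_anharm_0 addr0. Qed.

Lemma is_derive_half_sqr (x : R) : is_derive x 1 (fun a : R => 2^-1 * a ^+ 2) x.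
Proof.
apply: (@is_derive_quadratic _ _ _ _ 2^-1) => h _.
have -> : 2^-1 * (x + h) ^+ 2 - 2^-1 * x ^+ 2 - h * x = 2^-1 * h ^+ 2 by field.
by rewrite ger0_norm// mulr_ge0// ?sqr_ge0// invr_ge0.
Qed.

Lemma is_derive_trunc_potential (x : R) : is_derive x 1 trunc_potential (trunc_force x).
Proof.
apply: is_deriveD; first exact: is_derive_half_sqr.
by apply: is_derive_int0; exact: trunc_anharm_continuous.
Qed.

(** The frozen nonlinear part is at most |x| / 10, and its integral at most x^2 / 10. *)
Lemma trunc_potential_close x : `|trunc_potential x - 2^-1 * x ^+ 2| <= 10^-1 * x ^+ 2.
Proof.
rewrite /trunc_potential addrC addKr.
have := @increment_norm_le R (fun a => int0 a trunc_anharm) trunc_anharm x (10^-1 * `|x|).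
rewrite int0_0 ?subr0; last exact: trunc_anharm_continuous.
rewrite -(real_normK (num_real x)) expr2 mulrA; apply => [y|y yx].
  by apply: is_derive_int0; exact: trunc_anharm_continuous.
apply: le_trans (trunc_anharm_le y) _.
by rewrite ler_wpM2l// invr_ge0.
Qed.

Lemma trunc_potential_ge x : 2 / 5 * x ^+ 2 <= trunc_potential x.
Proof. by have := trunc_potential_close x; rewrite ler_norml => /andP[]; lra. Qed.

Lemma trunc_potential_le x : trunc_potential x <= 3 / 5 * x ^+ 2.
Proof. by have := trunc_potential_close x; rewrite ler_norml => /andP[]; lra. Qed.

Lemma trunc_force_id (x : R) : `|x| <= rho -> trunc_force x = (V^`()%classic) x.
Proof.
by move=> xr; rewrite /trunc_force /trunc_anharm clamp_id// /anharm addrC subrK.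
Qed.

End Nonlinearity.

(** * The truncated system as a chain *)

Section FPUFlow.
Variable R : realType.
Implicit Types (p r : int -> R) (t h : R).

(** Momenta at the even sites, relative displacements at the odd ones. *)
Definition interleave p r (m : int) : R :=
  if (m %% 2)%Z == 0 then p (m %/ 2)%Z else r (m %/ 2)%Z.

Lemma modz2_even (n : int) : ((2 * n) %% 2)%Z == 0. Proof. lia. Qed.
Lemma modz2_odd (n : int) : ((2 * n + 1) %% 2)%Z == 0 = false. Proof. lia. Qed.
Lemma divz2_even (n : int) : ((2 * n) %/ 2)%Z = n. Proof. lia. Qed.
Lemma divz2_odd (n : int) : ((2 * n + 1) %/ 2)%Z = n. Proof. lia. Qed.

Lemma interleave_even p r n : interleave p r (2 * n) = p n.
Proof. by rewrite /interleave modz2_even divz2_even. Qed.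

Lemma interleave_odd p r n : interleave p r (2 * n + 1) = r n.
Proof. by rewrite /interleave modz2_odd divz2_odd. Qed.

Lemma interleave_l2_le p r P Q : l2_le p P -> l2_le r Q ->
  l2_le (interleave p r) (Num.sqrt (P ^+ 2 + Q ^+ 2)).
Proof.
move=> [P0 Hp] [Q0 Hr]; split; first exact: sqrtr_ge0.
move=> s us; rewrite sqr_sqrtr ?addr_ge0 ?sqr_ge0//.
pose ev (m : int) := (m %% 2)%Z == 0.
rewrite (bigID ev)/=; apply: lerD.
  rewrite (eq_bigr (fun m : int => p (m %/ 2)%Z ^+ 2)); last first.
    by move=> m; rewrite /ev /interleave => ->.
  rewrite -big_filter -(big_map (fun m : int => (m %/ 2)%Z) xpredT (fun n => p n ^+ 2)).
  apply: Hp; rewrite map_inj_in_uniq ?filter_uniq// => a b.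
  by rewrite !mem_filter /ev => /andP[ea _] /andP[eb _]; lia.
rewrite (eq_bigr (fun m : int => r (m %/ 2)%Z ^+ 2)); last first.
  by move=> m; rewrite /ev /interleave => /negbTE ->.
rewrite -big_filter -(big_map (fun m : int => (m %/ 2)%Z) xpredT (fun n => r n ^+ 2)).
apply: Hr; rewrite map_inj_in_uniq ?filter_uniq// => a b.
by rewrite !mem_filter /ev => /andP[ea _] /andP[eb _]; lia.
Qed.

Lemma l2norm_sqr_le r K : 0 <= K ->
  (forall s, uniq s -> \sum_(n <- s) r n ^+ 2 <= K) -> in_l2 r /\ l2norm r ^+ 2 <= K.
Proof.
move=> K0 H; have rK : l2_le r (Num.sqrt K).
  by split; [exact: sqrtr_ge0|rewrite sqr_sqrtr].
split; first exact: l2_le_in rK.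
have h := l2_le_norm_le rK; have n0 : 0 <= l2norm r by exact: sqrtr_ge0.
by rewrite -[leRHS](sqr_sqrtr K0) ler_sqr ?nnegrE ?sqrtr_ge0.
Qed.

(** The sums of squares over even and odd sites are bounded jointly, not only separately;
    this is what keeps the constant below 2 in the final estimate. *)
Lemma split_norms (x : int -> R) K :
  (forall s, uniq s -> \sum_(m <- s) x m ^+ 2 <= K) ->
  let p n := x (2 * n) in let r n := x (2 * n + 1) in
  [/\ in_l2 p, in_l2 r & l2norm p ^+ 2 + l2norm r ^+ 2 <= K].
Proof.
move=> H p r.
have K0 : 0 <= K by have := H [::] isT; rewrite big_nil.
have PR (s s' : seq int) : uniq s -> uniq s' ->
    \sum_(n <- s) p n ^+ 2 + \sum_(n <- s') r n ^+ 2 <= K.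
  move=> us us'.
  rewrite -(big_map (fun n : int => 2 * n) xpredT (fun m => x m ^+ 2)).
  rewrite -(big_map (fun n : int => 2 * n + 1) xpredT (fun m => x m ^+ 2)) -big_cat.
  apply: H; rewrite cat_uniq !map_inj_uniq ?us ?us'/= ?andbT; [|by move=> ? ?; lia|by move=> ? ?; lia].
  by apply/hasPn => m /mapP[n _ ->]; apply/mapP => -[n' _]; lia.
have p0 s : 0 <= \sum_(n <- s) p n ^+ 2 by apply: sumr_ge0 => *; exact: sqr_ge0.
have r0 s : 0 <= \sum_(n <- s) r n ^+ 2 by apply: sumr_ge0 => *; exact: sqr_ge0.
have Hp s : uniq s -> \sum_(n <- s) p n ^+ 2 <= K.
  by move=> us; have := PR s [::] us isT; rewrite big_nil addr0.
have Hr s : uniq s -> \sum_(n <- s) r n ^+ 2 <= K.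
  by move=> us; have := PR [::] s isT us; rewrite big_nil add0r.
have [pl _] := l2norm_sqr_le K0 Hp; have [rl rK] := l2norm_sqr_le K0 Hr.
split=> //.
have Hr2 s : uniq s -> l2norm r ^+ 2 <= K - \sum_(n <- s) p n ^+ 2.
  move=> us; apply: (l2norm_sqr_le _ _).2; first by rewrite subr_ge0 Hp.
  by move=> s' us'; rewrite lerBrDl PR.
rewrite -lerBrDr; apply: (l2norm_sqr_le _ _).2; first by rewrite subr_ge0.
by move=> s us; have := Hr2 s us; rewrite !lerBrDr addrC.
Qed.

(** Energy gives |r|^2 + |p|^2 <= 3 / 2 (|r0|^2 + |p0|^2), so (|r| + |p|)^2 is at most
    3 (|r0|^2 + |p0|^2), which is less than the square of 2 (|r0| + |p0|). *)
Theorem fpu_flow_exists (W U : R -> R) (r0 p0 : int -> R) Q P :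
  (forall a b, `|W a - W b| <= 2 * `|a - b|) -> W 0 = 0 ->
  (forall a : R, is_derive a 1 U (W a)) ->
  (forall a, 2 / 5 * a ^+ 2 <= U a) -> (forall a, U a <= 3 / 5 * a ^+ 2) ->
  l2_le r0 Q -> l2_le p0 P ->
  exists r p : R -> int -> R, [/\ r 0 = r0, p 0 = p0,
    forall t, [/\ in_l2 (r t), in_l2 (p t) & l2norm (r t) + l2norm (p t) <= 2 * (Q + P)] &
    forall t, exists C, forall h, `|h| <= 1 ->
      l2_le (fun n => r (t + h) n - r t n - h * (p t (n + 1) - p t n)) (C * h ^+ 2) /\
      l2_le (fun n => p (t + h) n - p t n - h * (W (r t n) - W (r t (n - 1)))) (C * h ^+ 2)].
Proof.
move=> Wl W0 dU Ug Ul r0Q p0P.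
(* The momenta feel a linear force, the displacements the force W. *)
pose phi (m : int) a := if (m %% 2)%Z == 0 then a else W a.
pose Phi (m : int) a := if (m %% 2)%Z == 0 then 2^-1 * a ^+ 2 else U a.
have phi_lip m a b : `|phi m a - phi m b| <= 2 * `|a - b|.
  by rewrite /phi; case: ifP => // _; have := normr_ge0 (a - b); lra.
have phi0 m : phi m 0 = 0 by rewrite /phi; case: ifP.
have dPhi m (a : R) : is_derive a 1 (Phi m) (phi m a).
  by rewrite /Phi /phi; case: ifP => // _; exact: is_derive_half_sqr.
have Phi_ge m a : 2 / 5 * a ^+ 2 <= Phi m a.
  by rewrite /Phi; case: ifP => // _; have := sqr_ge0 a; lra.
have Phi_le m a : Phi m a <= 3 / 5 * a ^+ 2.
  by rewrite /Phi; case: ifP => // _; have := sqr_ge0 a; lra.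
have x0c := interleave_l2_le p0P r0Q; set x0 := interleave p0 r0 in x0c.
set c := Num.sqrt _ in x0c.
have L20 : 0 <= 2 :> R by [].
have [X [X0 XB XC]] := chain_flow_exists L20 phi_lip phi0 x0c.
have dX (t : R) m : is_derive t 1 (fun s : R => X s m) (chain_field phi (X t) m).
  have [C HC] := XC `|t|.
  apply: (@is_derive_quadratic _ _ _ _ C) => h h1.
  exact: l2_le_coord m (HC t h (lexx _) h1).
have E t s : uniq s -> \sum_(m <- s) X t m ^+ 2 <= 3 / 2 * c ^+ 2.
  move=> us; have [B HB] := XB `|t|.
  have X0c : l2_le (X 0) c by rewrite X0.
  have al0 : 0 <= 2 / 5 :> R by rewrite divr_ge0.
  have := energy_bound L20 phi_lip phi0 dPhi al0 Phi_ge Phi_le dX X0c HB us.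
  by lra.
exists (fun t n => X t (2 * n + 1)), (fun t n => X t (2 * n)); split.
- by apply/funext => n; rewrite X0 /x0 interleave_odd.
- by apply/funext => n; rewrite X0 /x0 interleave_even.
- move=> t; have [pl rl H] := split_norms (E t); split=> //.
  move: H; rewrite /c sqr_sqrtr ?addr_ge0 ?sqr_ge0//.
  have a0 : 0 <= l2norm (fun n => X t (2 * n + 1)) by exact: sqrtr_ge0.
  have b0 : 0 <= l2norm (fun n => X t (2 * n)) by exact: sqrtr_ge0.
  have Q0 := l2_le_ge0 r0Q; have P0 := l2_le_ge0 p0P.
  move: a0 b0; move: (l2norm _) (l2norm _) => a b a0 b0 H.
  rewrite -ler_sqr ?nnegrE ?mulr_ge0 ?addr_ge0//.
  have := sqr_ge0 (a - b); have : 0 <= Q * P by exact: mulr_ge0.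
  have := sqr_ge0 Q; have := sqr_ge0 P.
  rewrite !expr2 in H *; nra.
move=> t; have [C HC] := XC `|t|; exists C => h h1.
have H := HC t h (lexx _) h1; split.
  have i1 : injective (fun n : int => 2 * n + 1) by move=> a b; lia.
  have := l2_le_comp H i1.
  suff -> : (fun m => X (t + h) m - X t m - h * chain_field phi (X t) m) \o
    (fun n : int => 2 * n + 1) = (fun n => X (t + h) (2 * n + 1) - X t (2 * n + 1) -
      h * (X t (2 * (n + 1)) - X t (2 * n))) by [].
  apply/funext => n /=; rewrite /chain_field addrK.
  have -> : 2 * n + 1 + 1 = 2 * (n + 1) by lia.
  by rewrite /phi !modz2_even.
have i2 : injective (fun n : int => 2 * n) by move=> a b; lia.
have := l2_le_comp H i2.
suff -> : (fun m => X (t + h) m - X t m - h * chain_field phi (X t) m) \o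
  (fun n : int => 2 * n) = (fun n => X (t + h) (2 * n) - X t (2 * n) -
    h * (W (X t (2 * n + 1)) - W (X t (2 * (n - 1) + 1)))) by [].
apply/funext => n /=; rewrite /chain_field.
have -> : 2 * n - 1 = 2 * (n - 1) + 1 by lia.
by rewrite /phi !modz2_odd.
Qed.

End FPUFlow.

(** * The Duhamel formula *)

Section DuhamelFormula.
Variable R : realType.

Lemma multiplier_one (f : int -> R) (m : R -> R) c : l2_le f c -> (forall x, m x = 1) ->
  multiplier m f = f.
Proof.
move=> fc m1; rewrite multiplierE -[RHS](coef_dft (dftP (l2_le_in fc))).
by apply: (congr1 (fun g => coef g)); apply/funext => x; rewrite m1 mul1r.
Qed.

Lemma multiplier_null (f : int -> R) (m : R -> R) c n : bounded_symbol m 0 -> l2_le f c ->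
  multiplier m f n = 0.
Proof.
by move=> Hm fc; apply/eqP; rewrite -normr_le0; have := multiplier_coord n Hm fc; rewrite mul0r.
Qed.

Lemma bounded_symbolN (m : R -> R) B : bounded_symbol m B -> bounded_symbol (fun x => - m x) B.
Proof.
move=> [B0 mm mB]; split=> //; first exact: measurableT_comp.
by move=> x tx x0; rewrite normrN mB.
Qed.

Lemma multiplierNl (m : R -> R) B (f : int -> R) c n : bounded_symbol m B -> l2_le f c ->
  multiplier (fun x => - m x) f n = - multiplier m f n.
Proof.
move=> Hm fc; have := multiplierDl n Hm (bounded_symbolN Hm) fc.
rewrite (_ : multiplier (fun x => m x + - m x) f n = 0).
  by move/eqP; rewrite eq_sym addrC addr_eq0 => /eqP.
apply: (@multiplier_null _ _ c) => //.
split=> //; last by move=> x _ _; rewrite subrr normr0.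
by under eq_fun do rewrite subrr; exact: measurable_cst.
Qed.

Lemma multiplierNr (m : R -> R) B (f : int -> R) c n : bounded_symbol m B -> l2_le f c ->
  multiplier m (fun k => - f k) n = - multiplier m f n.
Proof.
move=> Hm fc; have := multiplierDr n Hm fc (l2_leN fc).
rewrite (_ : multiplier m (fun k => f k + - f k) n = 0).
  by move/eqP; rewrite eq_sym addrC addr_eq0 => /eqP.
apply/eqP; rewrite -normr_le0.
have -> : (fun k => f k - f k) = (fun=> 0) by apply/funext => k; rewrite subrr.
by have := multiplier_coord n Hm (@l2_le0 R); rewrite mulr0.
Qed.

Lemma symS_absgrad2 t (x : R) : symS t x * absgrad x ^+ 2 = symK t x.
Proof.
rewrite /symS /symK; have [->|a0] := eqVneq (absgrad x) 0.
  by rewrite expr0n !mulr0.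
by field.
Qed.

(** The function s |-> cos ((t - s) |grad|) r(s) + sin ((t - s) |grad|) / |grad| q(s) joins
    the free evolution of the data, at s = 0, to r(t), at s = t. If q = r' and q' is
    - |grad|^2 (r + w), its derivative is the integrand of the Duhamel term. *)
Theorem duhamel_formula (r q w : R -> int -> R) t n :
  (forall s, in_l2 (r s)) -> (forall s, in_l2 (q s)) -> l2_curve w ->
  (forall s, exists C, forall h, `|h| <= 1 ->
     l2_le (fun k => r (s + h) k - r s k - h * q s k) (C * h ^+ 2)) ->
  (forall s, exists C, forall h, `|h| <= 1 ->
     l2_le (fun k => q (s + h) k - q s k - h * - neg_lap (fun j => r s j + w s j) k)
       (C * h ^+ 2)) ->
  r t n = multiplier (symC t) (r 0) n + multiplier (symS t) (q 0) n
    - int0 t (fun s => multiplier (symK (t - s)) (w s) n).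
Proof.
move=> rl ql cw Hr Hq.
pose K s := multiplier (symK (t - s)) (w s) n.
pose Phi s := multiplier (symC (t - s)) (r s) n + multiplier (symS (t - s)) (q s) n.
have dPhi (s : R) : is_derive s 1 Phi (- K s).
  have rs := l2_le_norm (rl s); have qs := l2_le_norm (ql s).
  have ws := l2_le_norm (cw s).1.
  have rw := l2_leD rs ws; have lap := neg_lap_l2_le rw.
  have shift h : t - (s + h) = t - s + - h by ring.
  have HC h : bounded_symbol (fun x => symC (t - (s + h)) x - symC (t - s) x - h * symK (t - s) x)
      (4 * h ^+ 2).
    have := symC_taylor (t - s) (- h); rewrite sqrrN shift.
    by under eq_fun do rewrite mulrNN.
  have HS h : bounded_symbol (fun x => symS (t - (s + h)) x - symS (t - s) x - h * - symC (t - s) x)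
      (4 * h ^+ 2).
    have := symS_taylor (t - s) (- h); rewrite sqrrN shift.
    by under eq_fun do rewrite mulNr -mulrN.
  have [Cr HCr] := Hr s; have [Cq HCq] := Hq s.
  have D1 := @is_derive_multiplier R (fun s => symC (t - s)) _ r (q s) s _ _ _ _ _ _ n
    (symC_bounded_symbol (t - s)) (symK_bounded_symbol (t - s)) HC rs qs HCr.
  have D2 := @is_derive_multiplier R (fun s => symS (t - s)) _ q _ s _ _ _ _ _ _ n
    (symS_bounded_symbol (t - s)) (bounded_symbolN (symC_bounded_symbol (t - s))) HS qs
    (l2_leN lap) HCq.
  suff <- : multiplier (symK (t - s)) (r s) n + multiplier (symC (t - s)) (q s) n +
    (multiplier (fun x => - symC (t - s) x) (q s) n +
     multiplier (symS (t - s)) (fun k => - neg_lap (fun j => r s j + w s j) k) n) = - K s.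
    exact: is_deriveD D1 D2.
  rewrite (multiplierNl n (symC_bounded_symbol _) qs) (multiplierNr n (symS_bounded_symbol _) lap).
  rewrite -(multiplier_neg_lap (symS_bounded_symbol _) rw).
  have -> : (fun x => symS (t - s) x * absgrad x ^+ 2) = symK (t - s).
    by apply/funext => x; exact: symS_absgrad2.
  rewrite (multiplierDr n (symK_bounded_symbol _) rs ws) /K.
  move: (multiplier _ (r s) n) (multiplier _ (q s) n) (multiplier _ (w s) n) => a b d.
  by ring.
have cK : continuous K by exact: continuous_multiplierK.
have dN (s : R) : is_derive s 1 (fun s => - Phi s) (K s).
  by have := is_deriveN (dPhi s); rewrite opprK.
have E : - Phi t - - Phi 0 = int0 t K := int0_unique t cK dN.
have tt : t - t = 0 by ring.
have Pt : Phi t = r t n.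
  rewrite /Phi tt (multiplier_one (l2_le_norm (rl t))); last by move=> x; rewrite /symC mul0r cos0.
  rewrite (@multiplier_null (q t) _ (l2norm (q t))) ?addr0//; last exact: l2_le_norm.
  by have := symS_bounded_symbol (0 : R); rewrite normr0.
have P0 : Phi 0 = multiplier (symC t) (r 0) n + multiplier (symS t) (q 0) n.
  by rewrite /Phi (subr0 t).
transitivity (Phi 0 - int0 t K); last by rewrite P0.
by rewrite -E -Pt; move: (Phi t) (Phi 0) => a b; ring.
Qed.

End DuhamelFormula.

(** * Uniqueness of Duhamel solutions *)

Section Uniqueness.
Variable R : realType.
Implicit Types (w u v : R -> int -> R) (s t e : R).

Lemma int0_congr (h h' : R -> R) t :
  (forall s, `|s| <= `|t| -> h s = h' s) -> int0 t h = int0 t h'.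
Proof.
move=> hh; rewrite /int0; case: ifPn => t0.
  apply: eq_Rintegral => s; rewrite inE /= in_itv/= => /andP[s0 st].
  by apply: hh; rewrite !ger0_norm.
rewrite -ltNge in t0; congr (- _).
apply: eq_Rintegral => s; rewrite inE /= in_itv/= => /andP[s0 st].
by apply: hh; rewrite !ler0_norm ?lerN2// ltW.
Qed.

Lemma l2norm_dist (f g : int -> R) e : in_l2 f -> in_l2 g ->
  l2_le (fun k => f k - g k) e -> `|l2norm f - l2norm g| <= e.
Proof.
move=> /l2_le_norm fl /l2_le_norm gl fg.
have h1 : l2norm f <= e + l2norm g.
  apply: l2_le_norm_le; have := l2_leD fg gl.
  by under eq_fun do rewrite subrK.
have h2 : l2norm g <= l2norm f + e.
  apply: l2_le_norm_le; have := l2_leB fl fg.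
  by under eq_fun do rewrite opprB addrC subrK.
by rewrite ler_norml; apply/andP; split; lra.
Qed.

Lemma l2_curve_bounded w T : l2_curve w ->
  exists B, forall s, - T <= s <= T -> l2_le (w s) B.
Proof.
move=> cw; have [TT|TT] := leP (- T) T; last first.
  by exists 0 => s /andP[h1 h2]; have := le_lt_trans (le_trans h1 h2) TT; rewrite ltxx.
have cn : {within `[- T, T], continuous (fun s => l2norm (w s))}.
  apply: continuous_subspaceT => s; apply/cvgrPdist_le => e e0.
  have [ws H] := cw s; apply: filterS (H e e0) => s' Hs'.
  by rewrite distrC; apply: l2norm_dist => //; exact: (cw s').1.
have [c _ Hc] := EVT_max TT cn.
exists (l2norm (w c)) => s sT; apply: l2_leW (l2_le_norm (cw s).1) _.
by apply: Hc; rewrite in_itv.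
Qed.

Lemma l2_curve_continuous w : l2_curve w -> continuous_l2 setT w.
Proof.
move=> cw t _; have [wt H] := cw t; split=> //.
apply/cvgrPdist_le => e e0; apply: cvg_within.
apply: filterS (H e e0) => s Hs.
rewrite sub0r normrN ger0_norm; last exact: sqrtr_ge0.
exact: l2_le_norm_le.
Qed.

(** Freezing a solution outside its interval gives a curve on the whole line with the
    same values on the interval, so that calculus on the line applies. *)
Lemma clamped_curve w T : 0 <= T -> continuous_l2 `[- T, T] w ->
  l2_curve (fun s => w (clamp T s)).
Proof.
move=> T0 cw s.
have cI r : (`[- T, T] : set R) (clamp T r) by rewrite /= in_itv/= clamp_itv.
have [ws H] := cw _ (cI s); split=> // e e0.
have /cvgrPdist_le/(_ e e0) Hn := H.
have {}Hn : \forall s' \near s, (`[- T, T] : set R) (clamp T s') ->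
    `|0 - l2norm (w (clamp T s') \- w (clamp T s))| <= e.
  exact: (@clamp_continuous R T s _ Hn).
apply: filterS Hn => s' /(_ (cI s')).
rewrite sub0r normrN ger0_norm; last exact: sqrtr_ge0.
move=> Hm; apply: l2_leW Hm; apply: l2_le_norm; apply: l2_le_in.
exact: l2_leB (l2_le_norm (cw _ (cI s')).1) (l2_le_norm ws).
Qed.

Lemma l2_curve_comp w (N : R -> R) B L : 0 <= L -> N 0 = 0 ->
  (forall a b, - B <= a <= B -> - B <= b <= B -> `|N a - N b| <= L * `|a - b|) ->
  (forall s, l2_le (w s) B) -> l2_curve w -> l2_curve (fun s k => N (w s k)).
Proof.
move=> L0 N0 NL wB cw s; have B0 := l2_le_ge0 (wB s).
have wI r k : - B <= w r k <= B by rewrite -ler_norml; exact: l2_le_coord (wB r).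
split.
  apply: (@l2_le_in _ _ (L * B)); apply: (l2_le_lip (wB s)) => // k.
  have := NL (w s k) 0 (wI s k); rewrite N0 !subr0; apply.
  by rewrite oppr_le0 B0.
move=> e e0; have d0 : 0 < e / (L + 1) by rewrite divr_gt0// ltr_wpDl.
apply: filterS ((cw s).2 _ d0) => s' H.
apply: l2_leW (l2_le_lip H L0 _) _; first by move=> k; exact: NL.
rewrite mulrCA ler_piMr ?(ltW e0)// ler_pdivrMr ?ltr_wpDl//.
by rewrite mul1r lerDl.
Qed.

Variable V : R -> R.
Hypothesis V_C5 : C_k 5 V.
Hypothesis V'0 : V^`() 0 = 0.

Lemma anharm_locally_lipschitz B : 0 <= B -> exists L, 0 <= L /\
  forall a b, - B <= a <= B -> - B <= b <= B -> `|anharm V a - anharm V b| <= L * `|a - b|.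
Proof.
move=> B0; have [D HD] := bounded_V V_C5 (- B) B (isT : (2 < 5)%N).
have D0 : 0 <= D by apply: le_trans (HD 0 _); rewrite ?normr_ge0// oppr_le0 B0.
exists (D + 1); split; first exact: addr_ge0.
move=> a b; apply: lipschitz_of_derive => x; first exact: is_derive_anharm.
by move=> /HD H; apply: le_trans (ler_normB _ _) _; rewrite normr1 lerD2r.
Qed.

Lemma duhamel_symbols (r0 r1 : int -> R) (I : set R) r t n :
  duhamel V r0 r1 I r -> I t ->
  r t n = multiplier (symC t) r0 n + multiplier (symS t) r1 n
    - int0 t (fun s => multiplier (symK (t - s)) (fun k => anharm V (r s k)) n).
Proof. by move=> D tI; exact: (D t tI n). Qed.

(** Two solutions are bounded on the compact interval, where the nonlinearity is
    Lipschitz. The Duhamel integral halves a bound of the form C exp (4 L |t|) on the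
    difference, which therefore vanishes. *)
Theorem fpu_unique (r0 r1 : int -> R) T u v : 0 <= T ->
  fpu_solution V r0 r1 `[- T, T] u -> fpu_solution V r0 r1 `[- T, T] v ->
  forall t, - T <= t <= T -> u t = v t.
Proof.
move=> T0 [cu Du] [cv Dv].
have cu' := clamped_curve T0 cu; have cv' := clamped_curve T0 cv.
set u' := fun s => u (clamp T s) in cu'; set v' := fun s => v (clamp T s) in cv'.
have u'E s : `|s| <= T -> u' s = u s by move=> sT; rewrite /u' clamp_id.
have v'E s : `|s| <= T -> v' s = v s by move=> sT; rewrite /v' clamp_id.
have [Bu HBu] := l2_curve_bounded T cu'; have [Bv HBv] := l2_curve_bounded T cv'.
(* Both solutions stay in [-B, B], where the nonlinearity is L-Lipschitz. *)
pose B := Num.max Bu Bv.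
have bdd w Bw : (forall s, - T <= s <= T -> l2_le (w (clamp T s)) Bw) ->
    forall s, l2_le (w (clamp T s)) Bw.
  move=> H s; have := H _ (clamp_itv s T0); rewrite (@clamp_id _ T (clamp T s))//.
  by rewrite ler_norml clamp_itv.
have uB s : l2_le (u' s) B by apply: l2_leW (bdd u Bu HBu s) _; rewrite le_max lexx.
have vB s : l2_le (v' s) B by apply: l2_leW (bdd v Bv HBv s) _; rewrite le_max lexx orbT.
have B0 : 0 <= B := l2_le_ge0 (uB 0).
have [L [L0 HL]] := anharm_locally_lipschitz B0.
have a0 := anharm0 V'0.
have cwu := l2_curve_comp L0 a0 HL uB cu'; have cwv := l2_curve_comp L0 a0 HL vB cv'.
set wu := fun s k => anharm V (u' s k) in cwu.
set wv := fun s k => anharm V (v' s k) in cwv.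
have D t n : `|t| <= T -> u t n - v t n =
    - (int0 t (fun s => multiplier (symK (t - s)) (wu s) n)
       - int0 t (fun s => multiplier (symK (t - s)) (wv s) n)).
  move=> tT; have tI : (`[- T, T] : set R) t by rewrite /= in_itv/= -ler_norml.
  have Eu : u t n = multiplier (symC t) r0 n + multiplier (symS t) r1 n
      - int0 t (fun s => multiplier (symK (t - s)) (wu s) n).
    rewrite (duhamel_symbols n Du tI).
    apply: (congr1 (fun z => _ - z)); apply: int0_congr => s st.
    apply: (congr1 (fun f => multiplier (symK (t - s)) f n)); apply/funext => k.
    by rewrite /wu (u'E s (le_trans st tT)).
  have Ev : v t n = multiplier (symC t) r0 n + multiplier (symS t) r1 n
      - int0 t (fun s => multiplier (symK (t - s)) (wv s) n).
    rewrite (duhamel_symbols n Dv tI).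
    apply: (congr1 (fun z => _ - z)); apply: int0_congr => s st.
    apply: (congr1 (fun f => multiplier (symK (t - s)) f n)); apply/funext => k.
    by rewrite /wv (v'E s (le_trans st tT)).
  rewrite Eu Ev.
  have alg (a b c : R) : (a - b) - (a - c) = - (b - c) by ring.
  exact: alg.
have main k : forall t, `|t| <= T ->
    l2_le (fun n => u t n - v t n) (2 * B * 2^-1 ^+ k * expR (4 * L * `|t|)).
  elim: k => [|k IH] t tT.
    rewrite expr0 mulr1 -u'E// -v'E//; apply: l2_leW (l2_leB (uB t) (vB t)) _.
    have E1 : 1 <= expR (4 * L * `|t|) by rewrite -expR0 ler_expR !mulr_ge0.
    have : 0 <= 2 * B * (expR (4 * L * `|t|) - 1) by rewrite !mulr_ge0// subr_ge0.
    by lra.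
  have -> : (fun n => u t n - v t n) = (fun n =>
     - (int0 t (fun s => multiplier (symK (t - s)) (wu s) n)
       - int0 t (fun s => multiplier (symK (t - s)) (wv s) n))).
    by apply/funext => n; exact: D.
  have ku n := @continuous_multiplierK R wu t n cwu; have kv n := @continuous_multiplierK R wv t n cwv.
  apply: l2_leN; apply: (@l2_le_mean_value R
    (fun tau n => int0 tau (fun s => multiplier (symK (t - s)) (wu s) n)
       - int0 tau (fun s => multiplier (symK (t - s)) (wv s) n))
    (fun s n => multiplier (symK (t - s)) (wu s) n - multiplier (symK (t - s)) (wv s) n)
    (fun s => 2 * B * 2^-1 ^+ k.+1 * expR (4 * L * s))
    (fun s => 2 * B * 2^-1 ^+ k.+1 * (4 * L) * expR (4 * L * s))).
  - by move=> s n; apply: is_deriveB; [exact: is_derive_int0 (ku n)|exact: is_derive_int0 (kv n)].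
  - move=> n; apply: (etrans (congr2 (fun a b => a - b) (int0_0 (ku n)) (int0_0 (kv n)))).
    exact: subrr.
  - by move=> s; exact: is_derive_expR_scale.
  - by rewrite mulr_ge0 ?expR_ge0// !mulr_ge0.
  - move=> s st; have sT := le_trans st tT.
    have du : l2_le (wu s) (l2norm (wu s)) := l2_le_norm (cwu s).1.
    have dv : l2_le (wv s) (l2norm (wv s)) := l2_le_norm (cwv s).1.
    have dw : l2_le (fun k => wu s k - wv s k) (L * (2 * B * 2^-1 ^+ k * expR (4 * L * `|s|))).
      apply: (l2_le_lip (IH s sT)) => // j.
      rewrite /wu /wv u'E// v'E//; apply: HL; rewrite -ler_norml.
        by rewrite -u'E//; exact: l2_le_coord (uB s).
      by rewrite -v'E//; exact: l2_le_coord (vB s).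
    have -> : (fun n => multiplier (symK (t - s)) (wu s) n - multiplier (symK (t - s)) (wv s) n)
       = multiplier (symK (t - s)) (fun k => wu s k - wv s k).
      apply/funext => n.
      by rewrite (multiplierDr n (symK_bounded_symbol _) du (l2_leN dv)) (multiplierNr n (symK_bounded_symbol _) dv).
    apply: l2_leW (multiplier_bound (symK_bounded_symbol _) dw) _.
    rewrite exprS; move: (2^-1 ^+ k) (expR _) => a c.
    by rewrite le_eqVlt; apply/orP; left; apply/eqP; field.
move=> t; rewrite -ler_norml => tT; apply/funext => n.
apply/eqP; rewrite -subr_eq0 -normr_le0; apply/ler_addgt0Pr => e e0; rewrite add0r.
have E0 : 0 <= 2 * B * expR (4 * L * `|t|) by rewrite !mulr_ge0 ?expR_ge0.
have [k Hk] := half_pow_small E0 e0.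
apply: le_trans (l2_le_coord n (main k t tT)) _.
by rewrite mulrAC.
Qed.

End Uniqueness.

(** * Existence, uniqueness and the global bound *)

Section Assembly.
Variable R : realType.

Lemma l2_curve_of_remainder (r q : R -> int -> R) :
  (forall s, in_l2 (r s)) -> (forall s, in_l2 (q s)) ->
  (forall s : R, exists C, forall h : R, `|h| <= 1 ->
     l2_le (fun k => r (s + h) k - r s k - h * q s k) (C * h ^+ 2)) ->
  l2_curve r.
Proof.
move=> rl ql H s; split=> // e e0; have [C HC] := H s.
have qs := l2_le_norm (ql s); have Q0 := l2_le_ge0 qs.
have C0 : 0 <= C by have := l2_le_ge0 (HC 1 _); rewrite normr1 expr1n mulr1 lexx; exact.
have d0 : 0 < Num.min 1 (e / (l2norm (q s) + C + 1)).
  by rewrite lt_min ltr01 divr_gt0// ltr_wpDl// addr_ge0.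
near=> s'.
have : `|s - s'| <= Num.min 1 (e / (l2norm (q s) + C + 1)).
  by near: s'; apply: cvgr_dist_le; [exact: cvg_id|].
rewrite distrC le_min => /andP[h1 he].
pose h := s' - s; have s'E : s' = s + h by rewrite /h addrC subrK.
rewrite -/h in h1 he.
have := l2_leD (l2_leZ h qs) (HC h h1).
under eq_fun do rewrite addrC subrK.
rewrite -s'E => /l2_leW; apply.
move: he; rewrite ler_pdivlMr ?ltr_wpDl ?addr_ge0//.
rewrite -(real_normK (num_real h)); move: `|h| (normr_ge0 h) h1 => a a0 a1 he.
apply: le_trans he; have : 0 <= C * (a * (1 - a)) by rewrite !mulr_ge0// subr_ge0.
by lra.
Unshelve. all: by end_near. Qed.

Lemma is_derive_of_remainder (r : R -> int -> R) (q : int -> R) (s : R) (n : int) :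
  (exists C, forall h : R, `|h| <= 1 ->
     l2_le (fun k => r (s + h) k - r s k - h * q k) (C * h ^+ 2)) ->
  is_derive s 1 (fun t => r t n) (q n).
Proof.
move=> [C HC]; apply: (@is_derive_quadratic _ _ _ _ C) => h h1.
exact: l2_le_coord n (HC h h1).
Qed.

Lemma fpu_solution_restrict V (r0 r1 : int -> R) r T :
  fpu_solution V r0 r1 setT r -> fpu_solution V r0 r1 `[- T, T] r.
Proof.
move=> [cr Dr]; split=> [t tI|t tI n]; last exact: Dr.
have [rl H] := cr t I; split=> //.
by apply: cvg_trans H; apply: cvg_app; apply: within_subset.
Qed.

End Assembly.

Theorem proposition1p1 (R : realType) (V : R -> R) (r0 r1 : int -> R)
  (V_C5 : C_k 5 V)
  (V0 : V 0 = 0) (V'0 : V^`() 0 = 0) (V''0 : V^`(2) 0 = 1) (V'''0 : V^`(3) 0 = 1)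
  (r0_l2 : in_l2 r0) (r1_dom : in_dom_absgrad_inv r1)
  (small : l2norm r0 + l2norm (multiplier (@absgrad_inv R) r1) <=
     1 / (20 * Num.max 1 (sup [set `|V^`(3) x| | x in [set x : R | `|x| <= 1]]))) :
  exists r : R -> int -> R,
    [/\ fpu_solution V r0 r1 setT r,
        (forall T : R, 0 < T -> forall u : R -> int -> R,
           fpu_solution V r0 r1 `[- T, T] u ->
           forall t, t \in `[- T, T] -> u t = r t)
      & forall t : R,
        [/\ (forall n : int, derivable (fun s => r s n) t 1),
            in_dom_absgrad_inv (time_derivative r t)
          & l2norm (r t) + l2norm (multiplier (@absgrad_inv R) (time_derivative r t))
            <= 2 * l2norm r0 + 2 * l2norm (multiplier (@absgrad_inv R) r1)]].
Proof.
have [p0 [r1E p0P]] := momentum_exists r1_dom.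
pose P := l2norm (multiplier (@absgrad_inv R) r1).
have p0b : l2_le p0 P by exact: p0P.
have Psmall : l2norm r0 + P <= 1 / (20 * third_bound V) by exact: small.
have [r [p [rr0 pp0 bounds rem]]] := fpu_flow_exists
  (trunc_force_lip V_C5 V''0) (trunc_force_0 V'0)
  (is_derive_trunc_potential V_C5) (trunc_potential_ge V_C5 V'0 V''0)
  (trunc_potential_le V_C5 V'0 V''0) (l2_le_norm r0_l2) p0b.
have rl t : in_l2 (r t) by have [] := bounds t.
have pl t : in_l2 (p t) by have [] := bounds t.
pose q t n := p t (n + 1) - p t n.
have ql t : in_l2 (q t).
  have pt := l2_le_norm (pl t).
  exact: l2_le_in (l2_leB (l2_le_comp pt (@addz_inj 1)) pt).
(* The global bound keeps r below the cutoff, where the truncation is inactive; no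
   continuity argument in time is needed. *)
have rcut t : l2_le (r t) (cutoff V).
  apply: l2_leW (l2_le_norm (rl t)) _; have [_ _ H] := bounds t.
  have p0' : 0 <= l2norm (p t) by exact: sqrtr_ge0.
  apply: (@le_trans _ _ (2 * (l2norm r0 + P))).
    by apply: le_trans H; rewrite lerDl.
  have M0 := third_bound_gt0 V.
  have -> : cutoff V = 2 * (1 / (20 * third_bound V)).
    by rewrite /cutoff; field; rewrite gt_eqF.
  by rewrite ler_wpM2l.
have forceE t n : trunc_force V (r t n) = r t n + anharm V (r t n).
  rewrite trunc_force_id; last exact: l2_le_coord (rcut t).
  by rewrite /anharm addrC subrK.
have Hr s : exists C, forall h : R, `|h| <= 1 ->
    l2_le (fun k => r (s + h) k - r s k - h * q s k) (C * h ^+ 2).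
  by have [C HC] := rem s; exists C => h /HC[].
have Hq s : exists C, forall h : R, `|h| <= 1 ->
    l2_le (fun k => q (s + h) k - q s k -
      h * - neg_lap (fun j => r s j + anharm V (r s j)) k) (C * h ^+ 2).
  have [C HC] := rem s; exists (2 * C) => h /HC[_ H].
  have E : (fun k => q (s + h) k - q s k -
      h * - neg_lap (fun j => r s j + anharm V (r s j)) k) =
    (fun k => ((fun n => p (s + h) n - p s n -
        h * (trunc_force V (r s n) - trunc_force V (r s (n - 1)))) \o (fun n => n + 1)) k -
      (p (s + h) k - p s k - h * (trunc_force V (r s k) - trunc_force V (r s (k - 1))))).
    apply/funext => k; rewrite /= addrK /neg_lap /q -!forceE.
    by ring.
  rewrite E; apply: l2_leW (l2_leB (l2_le_comp H (@addz_inj 1)) H) _.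
  by rewrite le_eqVlt; apply/orP; left; apply/eqP; ring.
have cr := l2_curve_of_remainder rl ql Hr.
have [L [L0 HL]] := anharm_locally_lipschitz V_C5 (ltW (cutoff_gt0 V)).
have cw := l2_curve_comp L0 (anharm0 V'0) HL rcut cr.
have q0 : q 0 = r1 by apply/funext => n; rewrite /q pp0 r1E.
have sol : fpu_solution V r0 r1 setT r.
  split; first exact: l2_curve_continuous.
  by move=> t _ n; rewrite (duhamel_formula t n rl ql cw Hr Hq) rr0 q0.
exists r; split; first exact: sol.
  move=> T T0 u solu t; rewrite inE /= in_itv/= => tT.
  exact: (fpu_unique V_C5 V'0 (ltW T0) solu (fpu_solution_restrict T sol)).
move=> t; have dr n : is_derive t 1 (fun s : R => r s n) (q t n).
  by apply: (is_derive_of_remainder n); exact: Hr.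
have tE : time_derivative r t = q t.
  apply/funext => n; rewrite /time_derivative derive1E.
  exact: derive_val.
have [dom bd] := difference_in_domain (l2_le_norm (pl t)).
split.
- by move=> n; have [] := dr n.
- by rewrite tE.
- rewrite tE; have [_ _ H] := bounds t; rewrite -mulrDr; apply: le_trans H.
  by rewrite lerD2l; exact: l2_le_norm_le.
Qed.
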